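(* The metric $d_{\mathrm{sGHP}}$ induces the Gromov-Hausdorff-weak topology on $\mathbb{X}_{\mathrm c}$. Furthermore, $(\mathbb{X}_{\mathrm c},d_{\mathrm{sGHP}})$ is a complete, separable metric space.
   Context: A (pointed, complete, separable) metric measure space $(X,r,\rho,\mu)$ consists of a complete separable metric space $(X,r)$, a point $\rho\in X$ (the root) and a Borel measure $\mu$ on $X$. Two metric measure spaces are equivalent if there is a (surjective) isometry $\phi\colon\operatorname{supp}(\mu)\cup\{\rho\}\to\operatorname{supp}(\mu')\cup\{\rho'\}$ with $\phi(\rho)=\rho'$ and $\phi_*\mu=\mu'$. They are strongly equivalent if there is a surjective isometry $\phi\colon X\to X'$ with $\phi(\rho)=\rho'$ and $\phi_*\mu=\mu'$. $\mathbb{X}_{\mathrm c}$ is the set of equivalence classes of metric measure spaces with finite measure that contain a representative with $(X,r)$ compact; $\mathfrak{X}_c$ is the set of strong equivalence classes of compact metric (finite) measure spaces. Gromov-Hausdorff-weak convergence: $\mathcal{X}_n\to\mathcal{X}_\infty$ iff there are a pointed metric space $(E,d_E,\rho_E)$ and isometric embeddings $\varphi_n\colon\operatorname{supp}(\mu_n)\cup\{\rho_n\}\to E$, $n\in\mathbb{N}\cup\{\infty\}$, with $\varphi_n(\rho_n)=\rho_E$, such that $(\varphi_n)_*\mu_n\to(\varphi_\infty)_*\mu_\infty$ weakly and $d_{\mathrm H}(\varphi_n(\operatorname{supp}\mu_n),\varphi_\infty(\operatorname{supp}\mu_\infty))\to0$. Here $d_{\mathrm H}(A,B)=\inf\{\varepsilon>0: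 A^\varepsilon\supseteq B,\ B^\varepsilon\supseteq A\}$, with $A^\varepsilon=\{x:d(x,A)\le\varepsilon\}$ the closed $\varepsilon$-neighbourhood in the ambient space (so $d_{\mathrm H}(\emptyset,\emptyset)=0$ and $d_{\mathrm H}(\emptyset,B)=\infty$ for $B\neq\emptyset$). Gromov-Hausdorff-Prohorov metric on $\mathfrak{X}_c$: $d_{\mathrm{GHP}}(\mathcal{X},\mathcal{X}'):=\inf_d\big(d_{\mathrm{Pr}}^{(X\sqcup X',d)}(\mu,\mu')+d_{\mathrm H}^{(X\sqcup X',d)}(X,X')+d(\rho,\rho')\big)$, the infimum being over all metrics $d$ on the disjoint union $X\sqcup X'$ extending both $r$ and $r'$, where $d_{\mathrm{Pr}}(\mu,\mu')=\inf\{\varepsilon>0:\mu(A)\le\mu'(A^\varepsilon)+\varepsilon,\ \mu'(A)\le\mu(A^\varepsilon)+\varepsilon\ \forall A\text{ closed}\}$ is the Prohorov metric. Let $\iota\colon\mathbb{X}_{\mathrm c}\to\mathfrak{X}_c$, $\iota((X,r,\rho,\mu))=(\operatorname{supp}(\mu)\cup\{\rho\},r,\rho,\mu)$. Global lower mass function: $\mathfrak{m}_\delta((X,r,\rho,\mu)):=\inf\{\mu(\overline{B}_r(x,\delta)):x\in\operatorname{supp}(\mu)\}$ (closed balls; $\inf\emptyset=\infty$, $1/\infty=0$); it is strictly positive on $\mathbb{X}_{\mathrm c}$ for all $\delta>0$. The support Gromov-Hausdorff-Prohorov metric on $\mathbb{X}_{\mathrm c}$ is $$d_{\mathrm{sGHP}}(\mathcal{X},\mathcal{X}'):=d_{\mathrm{GHP}}(\iota(\mathcal{X}),\iota(\mathcal{X}'))+\int_0^1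 1\wedge\Big|\frac1{\mathfrak{m}_\delta(\mathcal{X})}-\frac1{\mathfrak{m}_\delta(\mathcal{X}')}\Big|\,d\delta.$$ *)

(* Defs.v *)
From HB Require Import structures.
From mathcomp Require Import all_boot all_order all_algebra.
From mathcomp Require Import all_classical all_reals all_analysis.

Set Implicit Arguments.
Unset Strict Implicit.
Unset Printing Implicit Defensive.

Import Order.TTheory GRing.Theory Num.Theory.
Import numFieldTopology.Exports numFieldNormedType.Exports.

Local Open Scope classical_set_scope.
Local Open Scope ring_scope.

(* Metrics are kept as functions on a bare carrier type, and [mtype d] is the
   carrier seen as a library metric space.  Carriers of metric measure spaces
   must not be bundled library structures: the type of equivalence classes of
   such spaces has to be a library metric space itself, which would be a
   universe inconsistency. *)
Record metric (R : realType) (T : Type) := IsMetric {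
  metric_fun :> T -> T -> R ;
  metric_xx : forall x, metric_fun x x = 0 ;
  metric_eq0 : forall x y, metric_fun x y = 0 -> x = y ;
  metric_symm : forall x y, metric_fun x y = metric_fun y x ;
  metric_tri : forall y x z, metric_fun x z <= metric_fun x y + metric_fun y z
}.

Definition mtype (R : realType) (T : Type) (d : metric R T) : Type := T.

Section mtype_instances.
Context (R : realType) (T : Type) (d : metric R T).
HB.instance Definition _ := gen_eqMixin (mtype d).
HB.instance Definition _ := gen_choiceMixin (mtype d).
HB.instance Definition _ := @isMetric.Build R (mtype d) d
  (metric_xx d) (@metric_eq0 _ _ d) (metric_symm d) (metric_tri d).
End mtype_instances.

#[short(type="pointedMetricType")]
HB.structure Definition PointedMetric (R : numDomainType) :=
  { M of Pointed M & Metric R M }.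

Definition pmtype (R : realType) (T : Type) (d : metric R T) (x0 : T) : Type :=
  T.

Section pmtype_instances.
Context (R : realType) (T : Type) (d : metric R T) (x0 : T).
HB.instance Definition _ := Metric.copy (pmtype d x0) (mtype d).
HB.instance Definition _ := isPointed.Build (pmtype d x0) x0.
End pmtype_instances.

Definition pmspace (R : realType) (T : Type) (d : metric R T) (x0 : T) :
  pointedMetricType R := pmtype d x0.

(* The axiom of the library's [completeType], for an unpointed space. *)
Definition complete_space (T : uniformType) : Prop :=
  forall F : set_system T, ProperFilter F -> cauchy F -> exists x : T, F --> x.

Definition separable_space (T : topologicalType) : Prop :=
  exists2 D : set T, countable D & dense D.

Definition borelType (R : realType) (E : pointedMetricType R) :=
  g_sigma_algebraType (@open E).

Record mmSpace (R : realType) := MMSpace {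
  car : Type ;
  car_metric : metric R car ;
  mm_root : car ;
  car_complete : complete_space (mtype car_metric) ;
  car_separable : separable_space (mtype car_metric) ;
  car_measure :
    {finite_measure set (borelType (pmspace car_metric mm_root)) -> \bar R}
}.

Definition mm_space (R : realType) (X : mmSpace R) : pointedMetricType R :=
  pmspace (car_metric X) (mm_root X).
Coercion mm_space : mmSpace >-> pointedMetricType.

Definition mu (R : realType) (X : mmSpace R) :
  {finite_measure set (borelType X) -> \bar R} := car_measure X.

Definition supp (R : realType) (X : mmSpace R) : set X :=
  [set x | forall U, open_nbhs x U -> (0 < mu X U)%E].
Arguments supp {R} X.

Section mm_iota.
Context (R : realType) (X : mmSpace R).

Definition rooted_supp : set X := supp X `|` [set mm_root X].

Definition iota_car : Type := {x : X | x \in rooted_supp}.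

Definition iota_fun (u v : iota_car) : R := car_metric X (val u) (val v).

Lemma iota_fun_eq0 u v : iota_fun u v = 0 -> u = v.
Proof. by move=> duv; apply: val_inj; exact: metric_eq0 duv. Qed.

Definition iota_metric : metric R iota_car :=
  IsMetric (fun u => metric_xx (car_metric X) (val u)) iota_fun_eq0
    (fun u v => metric_symm (car_metric X) (val u) (val v))
    (fun v u w => metric_tri (car_metric X) (val v) (val u) (val w)).

Lemma root_rooted_supp : mm_root X \in rooted_supp.
Proof. by apply/mem_set; right. Qed.

Definition iota_root : iota_car := exist _ (mm_root X) root_rooted_supp.

Lemma closed_rooted_supp : closed rooted_supp.
Proof.
apply: closedU.
  move=> x clx U Ux; have [y [sy Uy]] := clx U (open_nbhs_nbhs Ux).
  by apply: sy; split => //; case: Ux.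
by apply: accessible_closed_set1; apply: hausdorff_accessible;
  exact: metric_hausdorff.
Qed.

Lemma iota_complete : complete_space (mtype iota_metric).
Proof.
move=> F FF cF.
pose f : mtype iota_metric -> mtype (car_metric X) := fun u => val u.
have cG : cauchy (f @ F).
  apply: cauchy_exP => e e0.
  have [u Fu] := (cauchyP (R := R) F).1 cF e e0.
  by exists (f u); exact: Fu.
have [x Gx] := car_complete (fmap_proper_filter f FF) cG.
have Sx : rooted_supp x.
  apply: closed_rooted_supp => B Bx.
  have /filter_ex[u Bu] : F (f @^-1` B) by exact: Gx.
  by exists (f u); split => //; exact/set_mem/(valP u).
exists (exist _ x (mem_set Sx) : mtype iota_metric).
move=> B /nbhs_ballP[e /= e0 eB].
have : F (f @^-1` ball x e) by apply: Gx; exact: nbhsx_ballx.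
by apply: filterS => u; rewrite /preimage /= !ballEmdist /= => du; apply: eB;
  rewrite ballEmdist.
Qed.

Lemma iota_separable : separable_space (mtype iota_metric).
Proof.
have [D cD dD] := car_separable X.
pose near (qk : X * nat) (u : mtype iota_metric) :=
  mdist (qk.1 : mtype (car_metric X)) (val u) < (qk.2.+1%:R)^-1.
pose pick (qk : X * nat) : mtype iota_metric :=
    @xget (mtype iota_metric) iota_root (near qk).
exists (pick @` (D `*` [set: nat])).
  apply: (card_le_trans (card_image_le _ _)).
  exact: countableX.
move=> O [u Ou] oO.
have /nbhs_ballP[e /= e0 eO] : nbhs u O by exact: open_nbhs_nbhs.
have [k ke] : exists k, (k.+1%:R : R)^-1 < e / 2.
  have e20 : 0 < e / 2 by rewrite divr_gt0.
  exists (Num.truncn (e / 2)^-1).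
  by rewrite invf_plt ?posrE// truncnS_gt.
have [q [/interior_subset qu Dq]] :
    ((ball (val u : mtype (car_metric X)) k.+1%:R^-1)^° `&` D) !=set0.
  apply: dD; last exact: open_interior.
  exists (val u); apply: nbhs_singleton; apply: nbhs_interior.
  by apply: nbhsx_ballx; rewrite invr_gt0.
have pq : near (q, k) (pick (q, k)).
  apply: (@xgetI (mtype iota_metric) iota_root (near (q, k)) u).
  by move: qu; rewrite ballEmdist /near /= metric_sym.
exists (pick (q, k)); split; last by exists (q, k).
apply: eO; rewrite ballEmdist /= (le_lt_trans (metric_tri _ q _ _))//.
by rewrite (splitr e) ltrD// (lt_trans _ ke)//; move: qu; rewrite ballEmdist.
Qed.

Definition iota_measure (A : set (borelType (pmspace iota_metric iota_root))) :
  \bar R := mu X (val @` A).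

Lemma measurable_image_val
    (A : set (borelType (pmspace iota_metric iota_root))) :
  measurable A -> measurable (val @` A : set (borelType X)).
Proof.
have mS : measurable (rooted_supp : set (borelType X)).
  rewrite -[rooted_supp]setCK; apply: measurableC.
  by apply: sub_sigma_algebra; rewrite openC; exact: closed_rooted_supp.
pose G := [set B : set iota_car |
  measurable (val @` B : set (borelType X))].
apply: (@smallest_sub _ (sigma_algebra setT) _ G).
  split.
  - by rewrite /G /= image_set0.
  - move=> B GB; rewrite /G /=.
    rewrite (_ : val @` _ = rooted_supp `\` val @` B); first exact: measurableD.
    apply/seteqP; split=> [_ [u [_ Bu] <-]|x [Sx nBx]].
      split; first exact/set_mem/valP.
      by move=> [v Bv vu]; apply: Bu; rewrite -(val_inj vu).
    exists (exist _ x (mem_set Sx)) => //; split => // Bx; apply: nBx.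
    by exists (exist _ x (mem_set Sx)).
  - move=> B GB; rewrite /G /= image_bigcup; apply: bigcup_measurable => k _.
    exact: GB.
move=> U oU; rewrite /G /=.
pose W := \bigcup_(ue in [set ue : iota_car * R |
   ball (ue.1 : mtype iota_metric) ue.2 `<=` U])
   (ball (val ue.1 : X) ue.2)^°.
rewrite (_ : val @` _ = rooted_supp `&` W); last first.
  apply/seteqP; split=> [_ [u Uu <-]|x [Sx [[u e] /= ueU /interior_subset xu]]].
    split; first exact/set_mem/valP.
    have /nbhs_ballP[e /= e0 eU] : nbhs (u : mtype iota_metric) U.
      exact: open_nbhs_nbhs.
    exists (u, e) => //=; apply: nbhs_singleton; apply: nbhs_interior.
    exact: nbhsx_ballx.
  exists (exist _ x (mem_set Sx)) => //; apply: ueU.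
  by move: xu; rewrite !ballEmdist.
apply: measurableI => //; apply: sub_sigma_algebra.
apply: bigcup_open => ue _; exact: open_interior.
Qed.

Let iota_measure0 : iota_measure set0 = 0%E.
Proof. by rewrite /iota_measure image_set0 measure0. Qed.

Let iota_measure_ge0 A : (0 <= iota_measure A)%E.
Proof. exact: measure_ge0. Qed.

Let iota_measure_sigma_additive : semi_sigma_additive iota_measure.
Proof.
move=> F mF tF mUF; rewrite /iota_measure image_bigcup.
apply: measure_semi_sigma_additive.
- by move=> n; exact: measurable_image_val.
- apply/trivIsetP => i j _ _ ij; rewrite -subset0 => x [[u Fu ux] [v Fv vx]].
  have uv : u = v by apply: val_inj; rewrite ux vx.
  have /trivIsetP/(_ i j I I ij) := tF.
  by rewrite -subset0 => /(_ u); apply; split => //; rewrite uv.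
- by rewrite -image_bigcup; exact: measurable_image_val.
Qed.

HB.instance Definition _ := isMeasure.Build _ _ _ iota_measure
  iota_measure0 iota_measure_ge0 iota_measure_sigma_additive.

Let iota_measure_fin : fin_num_fun iota_measure.
Proof.
by move=> A mA; apply: fin_num_measure; exact: measurable_image_val.
Qed.

HB.instance Definition _ :=
  Measure_isFinite.Build _ _ _ iota_measure iota_measure_fin.

Definition mm_iota : mmSpace R :=
  MMSpace iota_complete iota_separable iota_measure.

End mm_iota.

Definition mm_strong_equiv (R : realType) (X Y : mmSpace R) : Prop :=
  exists f : X -> Y,
    [/\ forall x y, mdist (f x) (f y) = mdist x y,
        forall y, exists x, f x = y,
        f point = point &
        forall A : set (borelType Y), measurable A ->
          pushforward (mu X) (f : borelType X -> borelType Y) A = mu Y A].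

(* [mu (mm_iota X)] is the restriction of [mu X], so this is a root-preserving
   isometry of [supp X `|` [set mm_root X]] onto [supp Y `|` [set mm_root Y]]
   pushing [mu X] forward to [mu Y]. *)
Definition mm_equiv (R : realType) (X Y : mmSpace R) : Prop :=
  mm_strong_equiv (mm_iota X) (mm_iota Y).

Section distances.
Context (R : realType) (E : pointedMetricType R).
Implicit Types (A B : set E) (m : set (borelType E) -> \bar R).
Local Open Scope ereal_scope.

(* [+oo] when [A] is empty. *)
Definition dist_to A (x : E) : \bar R := ereal_inf [set (mdist x a)%:E | a in A].

Definition enlarge A (e : R) : set E := [set x | dist_to A x <= e%:E].

Definition hausdorff_dist A B : \bar R :=
  ereal_inf [set e%:E | e in
    [set e : R | [/\ (0 < e)%R, B `<=` enlarge A e & A `<=` enlarge B e]]].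

Definition prohorov_dist m m' : \bar R :=
  ereal_inf [set e%:E | e in [set e : R | (0 < e)%R /\
    forall A, closed A -> m A <= m' (enlarge A e) + e%:E /\
                          m' A <= m (enlarge A e) + e%:E]].

Definition weak_cvg (m_ : nat -> set (borelType E) -> \bar R) m : Prop :=
  forall f : E -> R, continuous f -> (exists M, forall x, (`|f x| <= M)%R) ->
    \int[m_ n]_x (f x)%:E @[n --> \oo] --> \int[m]_x (f x)%:E.

End distances.

Section sGHP.
Context (R : realType).
Local Open Scope ereal_scope.

Definition extends (X Y : mmSpace R) (d : metric R (car X + car Y)) : Prop :=
  (forall x x', d (inl x) (inl x') = car_metric X x x') /\
  (forall y y', d (inr y) (inr y') = car_metric Y y y').

(* The base point of the disjoint union plays no role in the value. *)
Definition GHP_cost (X Y : mmSpace R) (d : metric R (car X + car Y)) : \bar R :=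
  let E := pmspace d (inl (mm_root X)) in
  prohorov_dist (E := E)
    (pushforward (mu X) (inl : borelType X -> borelType E))
    (pushforward (mu Y) (inr : borelType Y -> borelType E))
  + hausdorff_dist (E := E) (range inl) (range inr)
  + (d (inl (mm_root X)) (inr (mm_root Y)))%:E.

Definition dGHP (X Y : mmSpace R) : \bar R :=
  ereal_inf [set GHP_cost d |
    d in [set d : metric R (car X + car Y) | extends d]].

(* [closed_ball] of the library is the closure of the open ball, which may be
   smaller than the ball needed here. *)
Definition lower_mass (delta : R) (X : mmSpace R) : \bar R :=
  ereal_inf [set mu X [set y : X | (mdist x y <= delta)%R] | x in supp X].

Definition dsGHP (X Y : mmSpace R) : \bar R :=
  dGHP (mm_iota X) (mm_iota Y) +
  \int[lebesgue_measure]_(delta in `[0%R, 1%R])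
     mine 1 `| (lower_mass delta X)^-1 - (lower_mass delta Y)^-1 |.

Definition isometric (X : mmSpace R) (E : pointedMetricType R) (f : X -> E) :=
  forall x y, mdist (f x) (f y) = mdist x y.

Definition iota_supp (X : mmSpace R) : set (mm_iota X) :=
  [set u | supp X (val u)].
Arguments iota_supp : clear implicits.

Definition GHw_cvg (X_ : nat -> mmSpace R) (X : mmSpace R) : Prop :=
  exists (E : pointedMetricType R)
         (phi_ : forall n, mm_iota (X_ n) -> E) (phi : mm_iota X -> E),
    [/\ (forall n, isometric (phi_ n) /\ phi_ n point = point),
        isometric phi /\ phi point = point,
        weak_cvg
          (fun n => pushforward (mu (mm_iota (X_ n)))
             (phi_ n : borelType (mm_iota (X_ n)) -> borelType E))
          (pushforward (mu (mm_iota X)) (phi : borelType (mm_iota X) -> borelType E)) &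
        hausdorff_dist (phi_ n @` iota_supp (X_ n)) (phi @` iota_supp X)
          @[n --> \oo] --> 0].

End sGHP.

Section classes.
Context (R : realType).

Definition Xc : Type :=
  {C : set (mmSpace R) |
     (exists X, C = [set Y | mm_equiv X Y]) /\
     (exists2 Y : mmSpace R, C Y & compact [set: Y])}.

Definition represents (X : mmSpace R) (C : Xc) : Prop := sval C X.

Definition GHw_cvg_class (C_ : nat -> Xc) (C : Xc) : Prop :=
  exists (X_ : nat -> mmSpace R) (X : mmSpace R),
    [/\ forall n, represents (X_ n) (C_ n), represents X C & GHw_cvg X_ X].

(* The Gromov-Hausdorff-weak topology is given by its convergent sequences: a
   set is open when it is sequentially open. *)
Definition GHw_open (U : set Xc) : Prop :=
  forall (C_ : nat -> Xc) (C : Xc), U C -> GHw_cvg_class C_ C ->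
    \forall n \near \oo, U (C_ n).

End classes.

(* Main.v *)
Require Import Defs.
From HB Require Import structures.
From mathcomp Require Import all_boot all_order all_algebra.
From mathcomp Require Import finmap.
From mathcomp Require Import all_classical all_reals all_analysis.
From mathcomp Require Import measurable_realfun lra.

(* A coupling of two spaces is the cross part of a pseudometric on their disjoint
   union.  Up to constant factors, the GHP distance is the least error of a
   coupling, and couplings compose, so that d_sGHP becomes a metric on classes;
   distance zero gives an isometry by taking an ultralimit of couplings.

   GHP convergence together with a bound on 1/m_delta along the sequence, for
   each delta, forces the supports to converge in the Hausdorff sense and the
   functions 1/m_delta to converge outside a countable set; conversely
   convergence of the integral term bounds 1/m_delta along the sequence by
   1/m_(delta/2) + 1 of the limit.  Hence
   d_sGHP-convergence is GHP convergence with bounded 1/m_delta, and this is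
   compared with Gromov-Hausdorff-weak convergence by gluing all the spaces of
   the sequence to the limit along couplings, and by testing weak convergence
   against bump functions (in one direction) and level sets (in the other).

   The limit of a Cauchy sequence is its metric ultraproduct, which is compact by
   countable saturation, with the Loeb measure: the content of a closed set K is
   the infimum of the limits of masses of closed internal sets that cover K, and
   a content on a compact space extends to a Borel measure.  The bound on
   1/m_delta puts every point but possibly the root in the support.  Separability follows from
   coding a space at scale 1/J by the rounded distances and masses of a finite
   net and the rounded values of 1/m_delta for finitely many delta. *)

Set Implicit Arguments.
Unset Strict Implicit.
Unset Printing Implicit Defensive.

Import Order.TTheory GRing.Theory Num.Theory.
Import numFieldTopology.Exports numFieldNormedType.Exports.

Local Open Scope classical_set_scope.
Local Open Scope ring_scope.

(** * Borel sets of a metric space *)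

(** The obstacle to completeness is a point whose mass fades out along a GHP-convergent sequence: it
    remains in the limit space but outside the support, so limits of values of [mm_iota] need not be
    values of [mm_iota]. Fading makes the inverse lower mass blow up at some small radius, and the
    integral term detects exactly this. Cross distances [0] are allowed because limits and infima of
    metrics on a disjoint union degenerate to pseudometrics, while ultralimits and infimal
    compositions of couplings are again couplings. Strict positivity is restored, by a small shift,
    only when [dGHP] itself is estimated. Infima need not be attained, hence the arbitrary slack
    [h > 0] in every neighbourhood. A free ultrafilter on the indices replaces extraction of
    subsequences: all distances and masses converge along it at once, without diagonal arguments.
    Most estimates use one error for all three terms of the cost; the constant factors lost are
    harmless, since only vanishing, convergence and the Cauchy property are at stake. *)

Lemma metric_ge0 (R : realType) (T : Type) (d : metric R T) x y : 0 <= d x y.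
Proof.
have := metric_tri d y x x; rewrite metric_xx (metric_symm d y x); lra.
Qed.

Section metric_topology.
Context (R : realType) (E : metricType R).
Implicit Types (A : set E) (x : E).

Lemma nbhs_mdist x A :
  nbhs x A <-> exists2 e : R, 0 < e & forall y, mdist x y < e -> A y.
Proof.
split.
  move=> /nbhs_ballP[e /= e0 eA]; exists e => // y xy; apply: eA.
  by rewrite ballEmdist.
move=> [e e0 eA]; apply/nbhs_ballP; exists e => //= y.
by rewrite ballEmdist; exact: eA.
Qed.

Lemma open_mdistP A : open A <->
  forall x, A x -> exists2 e : R, 0 < e & forall y, mdist x y < e -> A y.
Proof.
rewrite openE; split => oA x Ax; first by apply/nbhs_mdist; exact: oA.
by apply/nbhs_mdist; exact: oA.
Qed.

Lemma closed_mdistP A : closed A <->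
  forall x, (forall e : R, 0 < e -> exists2 a, A a & mdist x a < e) -> A x.
Proof.
split=> [cA x Ax|cA x Ax].
  apply: cA => B /nbhs_mdist[e e0 eB]; have [a Aa xa] := Ax e e0.
  by exists a; split => //; exact: eB.
apply: cA => e e0.
have /Ax[a [Aa xa]] : nbhs x (ball x e) by exact: nbhsx_ballx.
by exists a => //; rewrite ballEmdist in xa.
Qed.

Lemma closed_mdist_ball x r : closed [set y | mdist x y <= r].
Proof.
apply/closed_mdistP => y Ay /=; apply/ler_addgt0Pr => e e0.
have [a /= xa ya] := Ay e e0.
by rewrite (le_trans (metric_triangle x a y))// lerD// metric_sym ltW.
Qed.

Lemma open_mdist_ball x r : open [set y | mdist x y < r].
Proof.
apply/open_mdistP => y /= xy; exists (r - mdist x y); first by rewrite subr_gt0.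
move=> z; rewrite ltrBrDl; exact: (le_lt_trans (metric_triangle x y z)).
Qed.

End metric_topology.

Section borel.
Context (R : realType) (E : pointedMetricType R).

Lemma open_measurable_borel (A : set E) :
  open A -> measurable (A : set (borelType E)).
Proof. exact: sub_sigma_algebra. Qed.

Lemma closed_measurable_borel (A : set E) :
  closed A -> measurable (A : set (borelType E)).
Proof.
by move=> cA; rewrite -[A]setCK; apply: measurableC; apply: open_measurable_borel;
  rewrite openC.
Qed.

Lemma measurable_fun_borel (F : pointedMetricType R) (f : E -> F) :
  continuous f -> measurable_fun setT (f : borelType E -> borelType F).
Proof.
move=> cf; apply: (measurability (@open F : set (set (borelType F)))) => // _ [B oB <-].
by rewrite setTI; apply: open_measurable_borel; apply: open_comp.
Qed.

Lemma measurable_fun_borel_real (f : E -> R) :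
  continuous f -> measurable_fun setT (f : borelType E -> R).
Proof.
move=> /continuousP cf; apply: (measurability _ (RGenOpens.measurableE R)).
move=> _ [_ [a [b ->] <-]]; rewrite setTI; apply: open_measurable_borel.
exact/cf/interval_open.
Qed.

End borel.

Definition ms (R : realType) (X : mmSpace R) (A : set (car X)) : R :=
  fine (mu X (A : set (borelType X))).
Arguments ms {R} X A.

Definition mclosed (R : realType) (X : mmSpace R) (A : set (car X)) : Prop :=
  closed (A : set X).
Arguments mclosed {R} X A.

Definition mmeas (R : realType) (X : mmSpace R) (A : set (car X)) : Prop :=
  measurable (A : set (borelType X)).
Arguments mmeas {R} X A.

Section real_measure.
Context (R : realType) (X : mmSpace R).
Implicit Types (A B : set (car X)).

Lemma msE A : mmeas X A -> mu X (A : set (borelType X)) = (ms X A)%:E.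
Proof. by move=> mA; rewrite /ms fineK// fin_num_measure. Qed.

Lemma ms_ge0 A : 0 <= ms X A.
Proof. exact/fine_ge0/measure_ge0. Qed.

Lemma ms0 : ms X set0 = 0.
Proof. by rewrite /ms measure0. Qed.

Lemma closed_mmeas A : mclosed X A -> mmeas X A.
Proof. exact: closed_measurable_borel. Qed.

Lemma le_ms A B : mmeas X A -> mmeas X B -> A `<=` B -> ms X A <= ms X B.
Proof. by move=> mA mB AB; rewrite -lee_fin -!msE// le_measure// inE. Qed.

Lemma msU A B : mmeas X A -> mmeas X B -> ms X (A `|` B) <= ms X A + ms X B.
Proof.
move=> mA mB; rewrite -lee_fin EFinD -!msE//; last exact: measurableU.
exact: measureU2.
Qed.

Lemma msDU A B : mmeas X A -> mmeas X B -> A `&` B = set0 ->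
  ms X (A `|` B) = ms X A + ms X B.
Proof.
move=> mA mB AB; apply: EFin_inj; rewrite EFinD -!msE//; last exact: measurableU.
by rewrite measureU.
Qed.

Lemma mmeasT : mmeas X setT.
Proof. exact: measurableT. Qed.

Lemma mmeas0 : mmeas X set0.
Proof. exact: measurable0. Qed.

Lemma mmeasC A : mmeas X A -> mmeas X (~` A).
Proof. exact: measurableC. Qed.

Lemma mmeasI A B : mmeas X A -> mmeas X B -> mmeas X (A `&` B).
Proof. exact: measurableI. Qed.

Lemma mmeasU A B : mmeas X A -> mmeas X B -> mmeas X (A `|` B).
Proof. exact: measurableU. Qed.

Lemma mclosed_ball x r : mclosed X [set y | car_metric X x y <= r].
Proof. exact: (@closed_mdist_ball R X x r). Qed.

Lemma mmeas_ball x r : mmeas X [set y | car_metric X x y <= r].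
Proof. apply: closed_mmeas; exact: mclosed_ball. Qed.

Lemma mclosedP A : mclosed X A <-> forall x,
  (forall e, 0 < e -> exists2 a, A a & car_metric X x a < e) -> A x.
Proof. exact: (@closed_mdistP R X A). Qed.

End real_measure.

Arguments closed_mmeas {R X A} _.
Arguments mclosed_ball {R X} x r.
Arguments mmeas_ball {R X} x r.
Arguments mmeasT {R X}.

(** * Supports and lower masses *)

Lemma ball_mdistP (R : realType) (E : metricType R) (x y : E) (e : R) :
  ball x e y <-> mdist x y < e.
Proof. by rewrite ballEmdist. Qed.

Lemma countable_enum (T : Type) (A : set T) : countable A ->
  exists f : nat -> option T, forall x, A x -> exists n, f n = Some x.
Proof.
move=> /countable_injP[g gi].
exists (fun n => if pselect (exists2 x, A x & g x = n) is left p
  then Some (projT1 (cid2 p)) else None) => x Ax; exists (g x).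
case: pselect => [p|]; last by case; exists x.
case: (cid2 p) => y Ay /= gy; congr Some; apply: gi => //; exact: mem_set.
Qed.

Lemma inv_nat_lt (R : realType) (e : R) : 0 < e -> exists n : nat, n.+1%:R^-1 < e.
Proof.
move=> e0; exists (Num.truncn e^-1).
by rewrite invf_plt ?posrE// truncnS_gt.
Qed.

Lemma compact_net (R : realType) (E : pointedMetricType R) (A : set E) (e : R) :
  compact A -> 0 < e ->
  exists N (f : nat -> E), forall x, A x -> exists2 i, (i < N)%N & mdist (f i) x < e.
Proof.
rewrite compact_cover => cA e0.
have [||D' _ D'c] := cA E setT (fun x => [set y | mdist x y < e]).
- by move=> x _; exact: open_mdist_ball.
- by move=> x _; exists x => //=; rewrite mdistxx.
exists (size (enum_fset D')), (nth point (enum_fset D')) => x Ax.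
have [y /= yD yx] := D'c x Ax.
by exists (index y (enum_fset D')); rewrite ?index_mem// nth_index.
Qed.

Section supp.
Context (R : realType) (X : mmSpace R).
Implicit Types (x : car X).

Lemma suppP x : supp X x <->
  forall e : R, 0 < e -> 0 < ms X [set y | car_metric X x y <= e].
Proof.
split=> [sx e e0|sx U [oU Ux]].
  rewrite -lte_fin -msE; last exact: mmeas_ball.
  apply: (@lt_le_trans _ _ (mu X [set y : X | mdist (x : X) y < e])).
    by apply: sx; split; [exact: open_mdist_ball|rewrite /= mdistxx].
  apply: le_measure; rewrite ?inE.
  - exact: open_measurable_borel (open_mdist_ball _ _).
  - exact: mmeas_ball.
  - by move=> y /= /ltW.
have /nbhs_mdist[e e0 eU] : nbhs (x : X) U by exact: open_nbhs_nbhs.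
have e20 : 0 < e / 2 by rewrite divr_gt0.
have := sx (e / 2) e20; rewrite -lte_fin -msE; last exact: mmeas_ball.
move=> /lt_le_trans; apply; apply: le_measure; rewrite ?inE.
- exact: mmeas_ball.
- exact: open_measurable_borel.
- move=> y /= xy; apply: eU; apply: le_lt_trans xy _.
  by rewrite ltr_pdivrMr// ltr_pMr// ltr1n.
Qed.

Lemma suppPn x : ~ supp X x ->
  exists2 e : R, 0 < e & ms X [set y | car_metric X x y <= e] = 0.
Proof.
move=> nx; apply: contrapT => h; apply: nx; apply/suppP => e e0.
rewrite lt_neqAle ms_ge0 andbT; apply/eqP => /esym me; apply: h.
by exists e.
Qed.

Lemma mclosed_supp : mclosed X (supp X).
Proof.
move=> x clx U Ux; have [y [sy Uy]] := clx U (open_nbhs_nbhs Ux).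
by apply: sy; split => //; case: Ux.
Qed.

Lemma mclosed_rooted_supp : mclosed X (@rooted_supp R X).
Proof. exact: closed_rooted_supp. Qed.

(** Separability is the reason: a point outside the support has a null ball, inside which some ball
    around a dense point still contains it, and only countably many balls of radius [1 / (k + 1)]
    around dense points occur. *)
Lemma ms_suppC : ms X (~` supp X) = 0.
Proof.
have mC : mmeas X (~` supp X).
  apply: mmeasC; apply: closed_mmeas; exact: mclosed_supp.
have [D cD dD] := car_separable X.
have [f fP] := countable_enum cD.
pose B (q : car X) (k : nat) : set (car X) := [set y | car_metric X q y <= k.+1%:R^-1].
pose F (n : nat) : set (car X) :=
  if @choice.unpickle (nat * nat)%type n is Some jk then
    if f jk.1 is Some q then
      if ms X (B q jk.2) == 0 then B q jk.2 else set0
    else set0 else set0.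
have F0 n : (mu X).-negligible (F n : set (borelType X)).
  rewrite /F; case: choice.unpickle => [[j k]|] /=; last exact: negligible_set0.
  case: (f j) => [q|]; last exact: negligible_set0.
  case: ifPn => [/eqP m0|_]; last exact: negligible_set0.
  have mB : mmeas X (B q k) by exact: mmeas_ball.
  have m0' : mu X (B q k : set (borelType X)) = 0%E by rewrite (msE mB) m0.
  exact/(negligibleP _ mB).
have /negligibleP : (mu X).-negligible (~` supp X : set (borelType X)).
  apply: negligibleS (negligible_bigcup F0) => x /suppPn[e e0 me].
  have [k ke] : exists k : nat, k.+1%:R^-1 < e / 2.
    by apply: inv_nat_lt; rewrite divr_gt0.
  have [q [/= xq Dq]] : ([set y : mtype (car_metric X) | mdist x y < k.+1%:R^-1] `&` D) !=set0.
    apply: dD; last exact: open_mdist_ball.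
    by exists x => /=; rewrite mdistxx invr_gt0.
  have [j fj] := fP q Dq.
  exists (choice.pickle (j, k)) => //; rewrite /F choice.pickleK /= fj.
  have xB : B q k x by rewrite /B /= metric_symm ltW.
  suff -> : ms X (B q k) = 0 by rewrite eqxx.
  apply/eqP; rewrite eq_le ms_ge0 andbT -me; apply: le_ms; try exact: mmeas_ball.
  move=> y; rewrite /B /= => qy.
  rewrite (le_trans (metric_tri _ q _ _))//.
  have {}xq : car_metric X x q < k.+1%:R^-1 := xq.
  by move: xq ke qy; set r := k.+1%:R^-1; lra.
by move=> /(_ mC) m0; apply: EFin_inj; rewrite -msE// m0.
Qed.

Lemma ms_supp A : mmeas X A -> ms X (A `&` supp X) = ms X A.
Proof.
move=> mA; have mS : mmeas X (supp X) by apply: closed_mmeas; exact: mclosed_supp.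
have -> : ms X A = ms X ((A `&` supp X) `|` (A `&` ~` supp X)).
  by rewrite -setIUr setUCr setIT.
rewrite msDU; last 1 first.
- by rewrite setIACA setICr setI0.
- suff -> : ms X (A `&` ~` supp X) = 0 by rewrite addr0.
  apply/eqP; rewrite eq_le ms_ge0 andbT -ms_suppC; apply: le_ms.
  + by apply: mmeasI => //; apply: mmeasC.
  + exact: mmeasC.
  + by move=> x [].
- exact: mmeasI.
- by apply: mmeasI => //; exact: mmeasC.
Qed.

Lemma ms_pos_supp A : mmeas X A -> 0 < ms X A -> exists2 x, A x & supp X x.
Proof.
move=> mA; rewrite -ms_supp// => mA0; apply: contrapT => h.
move: mA0; suff -> : A `&` supp X = set0 by rewrite ms0 ltxx.
by rewrite -subset0 => x [Ax sx]; apply: h; exists x.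
Qed.

End supp.

(** Characterises the values of [mm_iota] up to strong equivalence; the completeness proof has to
    show that its limit is again of this form. *)
Definition full (R : realType) (X : mmSpace R) : Prop :=
  forall x : car X, supp X x \/ x = mm_root X.

Section iota.
Context (R : realType) (X : mmSpace R).

Lemma mu_iota_preimage (A : set (car X)) : mmeas X A ->
  mu X (val @` [set u : car (mm_iota X) | A (val u)] : set (borelType X)) =
  mu X (A : set (borelType X)).
Proof.
move=> mA.
have -> : val @` [set u : car (mm_iota X) | A (val u)] = A `&` @rooted_supp R X.
  apply/seteqP; split=> [_ [u Au <-]|x [Ax rx]].
    by split => //; exact/set_mem/(valP u).
  by exists (exist _ x (mem_set rx)).
have mS : mmeas X (@rooted_supp R X) by apply: closed_mmeas; exact: mclosed_rooted_supp.
rewrite !msE//; last exact: mmeasI.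
congr EFin; apply/eqP; rewrite eq_le; apply/andP; split.
  by apply: le_ms => //; exact: mmeasI.
rewrite -{1}(ms_supp mA); apply: le_ms.
- by apply: mmeasI => //; apply: closed_mmeas; exact: mclosed_supp.
- exact: mmeasI.
- by move=> x [Ax sx]; split => //; left.
Qed.

Lemma supp_iota (u : car (mm_iota X)) : supp (mm_iota X) u <-> supp X (val u).
Proof.
rewrite !suppP.
suff h (e : R) : ms (mm_iota X) [set y | car_metric (mm_iota X) u y <= e] =
    ms X [set y | car_metric X (val u) y <= e].
  by split => k e e0; [rewrite -h|rewrite h]; exact: k.
by rewrite /ms -(mu_iota_preimage (mmeas_ball (val u) e)).
Qed.

Lemma full_iota : full (mm_iota X).
Proof.
move=> u; have := valP u => /set_mem[su|ur]; first by left; exact/supp_iota.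
by right; apply: val_inj.
Qed.

Lemma lower_mass_iota t : lower_mass t (mm_iota X) = lower_mass t X.
Proof.
rewrite /lower_mass; congr ereal_inf; apply/seteqP; split.
  move=> _ [u /supp_iota su <-]; exists (val u) => //.
  by rewrite -(mu_iota_preimage (mmeas_ball (val u) t)).
move=> _ [x sx <-].
have rx : x \in @rooted_supp R X by apply/mem_set; left.
exists (exist _ x rx) => /=; first exact/supp_iota.
by rewrite -(mu_iota_preimage (mmeas_ball x t)).
Qed.

End iota.

Section lower_mass.
Context (R : realType) (X : mmSpace R) (cX : compact [set: X]).

(* The inverse lower mass: finite on compact spaces for [t > 0], and [0] when the
   support is empty. *)
Definition ilm (Y : mmSpace R) (t : R) : R := fine ((lower_mass t Y)^-1)%E.

Lemma lower_mass_ge0 (Y : mmSpace R) t : (0 <= lower_mass t Y)%E.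
Proof. by apply: le_ereal_inf_tmp => _ [x _ <-]; exact: measure_ge0. Qed.

(** Support points close to the same point of a [t / 4]-net are within [t / 2] of one another, so
    the [t / 2]-ball of one of them lies in the [t]-ball of every other. Finitely many masses
    remain, and their minimum is positive. *)
Lemma lower_mass_gt0 t : 0 < t -> (0 < lower_mass t X)%E.
Proof.
move=> t0.
have t40 : 0 < t / 4 by rewrite divr_gt0.
have [N [f fP]] := compact_net cX t40.
have [m [m0 mP]] : exists m : R, 0 < m /\
    forall x, supp X x -> m <= ms X [set y | car_metric X x y <= t].
  have h i : exists m : R, 0 < m /\ forall x, supp X x ->
      mdist (f i) x < t / 4 -> m <= ms X [set y | car_metric X x y <= t].
    have [[x sx fx]|] := pselect (exists2 x, supp X x & mdist (f i) x < t / 4).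
      exists (ms X [set y | car_metric X x y <= t / 2]); split.
        by have /suppP/(_ (t / 2)) := sx; apply; rewrite divr_gt0.
      move=> y sy fy; apply: le_ms; try exact: mmeas_ball.
      move=> z /= xz; rewrite (le_trans (metric_tri _ x _ _))//.
      have := metric_tri (car_metric X) (f i) y x.
      rewrite (metric_symm _ y (f i)); move: fx fy; rewrite /mdist /=; lra.
    move=> h; exists 1; split => // x sx fx; exfalso; apply: h.
    by exists x.
  have [m mP] := choice h.
  exists (\big[Num.min/1]_(i < N) m i); split.
    by apply: lt_bigmin => // i _; have [] := mP i.
  move=> x sx; have [i iN ix] := fP x I.
  have [_ /(_ x sx ix)] := mP i; apply: le_trans.
  exact: (bigmin_le _ (Ordinal iN) (m \o val)).
apply: (@lt_le_trans _ _ m%:E); first by rewrite lte_fin.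
apply: le_ereal_inf_tmp => _ [x sx <-].
by have := mP x sx; rewrite -lee_fin -msE//; exact: mmeas_ball.
Qed.

Lemma ilmE t : 0 < t -> ((lower_mass t X)^-1)%E = (ilm X t)%:E.
Proof.
move=> t0; rewrite /ilm fineK// ge0_fin_numE; last by rewrite inve_ge0 lower_mass_ge0.
by rewrite lt_neqAle leey andbT inve_eqy gt_eqF// lower_mass_gt0.
Qed.

Lemma ilm_ge0 (Y : mmSpace R) t : 0 <= ilm Y t.
Proof. by apply: fine_ge0; rewrite inve_ge0 lower_mass_ge0. Qed.

(** Clearing the denominator gives a meaning to [M = 0]: it says that there is no support point, in
    accordance with the convention that the inverse of infinity is [0]. *)
Lemma ilm_leP t M : 0 < t -> 0 <= M -> ilm X t <= M <->
  forall x, supp X x -> 1 <= M * ms X [set y | car_metric X x y <= t].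
Proof.
move=> t0 M0; rewrite -lee_fin -ilmE// inve_ple ?inE ?lee_fin//; last exact: lower_mass_ge0.
have M1 x : ((M%:E)^-1 <= mu X [set y : X | (mdist (x : X) y <= t)%R])%E =
    (1 <= M * ms X [set y | car_metric X x y <= t]).
  rewrite (msE (mmeas_ball x t)) inver; case: eqVneq => [->|Mn0].
    by rewrite leye_eq mul0r ler10.
  by rewrite lee_fin -[X in X <= _]mulr1 ler_pdivrMl// lt_neqAle eq_sym Mn0.
split=> [h x sx|h].
  by rewrite -M1; apply: (le_trans h); apply: ereal_inf_lbound; exists x.
by apply: le_ereal_inf_tmp => _ [x sx <-]; rewrite M1; exact: h.
Qed.

Lemma ilm_anti s t : 0 < s -> s <= t -> ilm X t <= ilm X s.
Proof.
move=> s0 st; have t0 := lt_le_trans s0 st.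
apply/(ilm_leP t0 (ilm_ge0 X s)) => x sx.
have /(ilm_leP s0 (ilm_ge0 X s))/(_ x sx) := lexx (ilm X s).
move=> /le_trans; apply; apply: ler_wpM2l; first exact: ilm_ge0.
apply: le_ms; try exact: mmeas_ball.
by move=> y /= /le_trans; exact.
Qed.

End lower_mass.

(** * Couplings *)

(* [c x y] is the cross part of a pseudometric on the disjoint union that
   extends both metrics: distances [0] between the two halves are allowed. *)
Record coupling (R : realType) (T U : Type) (dT : metric R T) (dU : metric R U)
    (c : T -> U -> R) : Prop := Coupling {
  cpl_l : forall x' x y, c x y <= dT x x' + c x' y ;
  cpl_r : forall y' x y, c x y <= c x y' + dU y' y ;
  cpl_dl : forall y x x', dT x x' <= c x y + c x' y ;
  cpl_dr : forall x y y', dU y y' <= c x y + c x y' }.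

Definition swap (T U V : Type) (c : T -> U -> V) : U -> T -> V := fun y x => c x y.

(** The slack [h] says that the distance from [A] is at most [e] without asking that it be attained;
    this makes the set closed and keeps the fattening of the empty set empty. *)
Definition fat (R : realType) (T U : Type) (c : T -> U -> R) (A : set T) (e : R) :
    set U :=
  [set y | forall h : R, 0 < h -> exists2 a, A a & c a y < e + h].

Section coupling.
Context (R : realType).

Lemma cpl_ge0 (T U : Type) (dT : metric R T) (dU : metric R U) c :
  coupling dT dU c -> forall x y, 0 <= c x y.
Proof. by move=> C x y; have := cpl_dl C y x x; rewrite metric_xx; lra. Qed.

Lemma coupling_swap (T U : Type) (dT : metric R T) (dU : metric R U) c :
  coupling dT dU c -> coupling dU dT (swap c).
Proof.
move=> C; split; rewrite /swap => x y z.
- by have := cpl_r C x z y; rewrite (metric_symm dU); lra.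
- by have := cpl_l C x z y; rewrite (metric_symm dT); lra.
- exact: cpl_dr C _ _ _.
- exact: cpl_dl C _ _ _.
Qed.

Lemma coupling_metric (T : Type) (d : metric R T) : coupling d d d.
Proof.
split=> x y z; [exact: metric_tri|exact: metric_tri| |].
- by rewrite (metric_symm d z); exact: metric_tri.
- by rewrite (metric_symm d x); exact: metric_tri.
Qed.

Lemma fat_sub (T U : Type) (c c' : T -> U -> R) A A' e e' :
  (forall x y, c' x y <= c x y) -> A `<=` A' -> e <= e' ->
  fat c A e `<=` fat c' A' e'.
Proof.
move=> cc AA ee y fy h h0; have [a Aa ay] := fy h h0.
by exists a; [exact: AA|have := cc a y; lra].
Qed.

Context (X Y : mmSpace R) (c : car X -> car Y -> R).
Hypothesis C : coupling (car_metric X) (car_metric Y) c.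

Lemma mclosed_fat A e : mclosed Y (fat c A e).
Proof.
apply/mclosedP => y h k k0.
have k20 : 0 < k / 2 by rewrite divr_gt0.
have [z fz yz] := h _ k20; have [a Aa az] := fz _ k20.
exists a => //; have := cpl_r C z a y; rewrite (metric_symm _ z); lra.
Qed.

Lemma mmeas_fat A e : mmeas Y (fat c A e).
Proof. by apply: closed_mmeas; exact: mclosed_fat. Qed.

End coupling.

Arguments mclosed_fat {R X Y c} C A e.
Arguments mmeas_fat {R X Y c} C A e.

(* [a], [b] and [r] bound the Prohorov, Hausdorff and root terms of the cost. *)
Record mmnear (R : realType) (X Y : mmSpace R) (c : car X -> car Y -> R)
    (a b r : R) : Prop := Near {
  near_cpl : coupling (car_metric X) (car_metric Y) c ;
  near_pl : forall A, mclosed X A -> ms X A <= ms Y (fat c A a) + a ;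
  near_pr : forall A, mclosed Y A -> ms Y A <= ms X (fat (swap c) A a) + a ;
  near_hl : forall x (h : R), 0 < h -> exists y, c x y < b + h ;
  near_hr : forall y (h : R), 0 < h -> exists x, c x y < b + h ;
  near_root : c (mm_root X) (mm_root Y) <= r }.

Section near.
Context (R : realType).
Implicit Types (X Y Z : mmSpace R).

Lemma near_sym X Y c a b r : mmnear (X := X) (Y := Y) c a b r -> mmnear (swap c) a b r.
Proof. by case=> C pl pr hl hr rt; split => //; exact: coupling_swap. Qed.

Lemma near_le X Y c a b r a' b' r' : a <= a' -> b <= b' -> r <= r' ->
  mmnear (X := X) (Y := Y) c a b r -> mmnear c a' b' r'.
Proof.
move=> aa bb rr [C pl pr hl hr rt]; split => //.
- move=> A cA; rewrite (le_trans (pl A cA))// lerD// le_ms//.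
  + exact: mmeas_fat.
  + exact: mmeas_fat.
  + exact: fat_sub.
- have C' := coupling_swap C.
  move=> A cA; rewrite (le_trans (pr A cA))// lerD// le_ms//.
  + exact: mmeas_fat.
  + exact: mmeas_fat.
  + exact: fat_sub.
- by move=> x h h0; have [y] := hl x h h0; exists y; lra.
- by move=> x h h0; have [y] := hr x h h0; exists y; lra.
- lra.
Qed.

(** Infimal composition: the cross distance obtained by gluing the two disjoint unions along the
    middle space. *)
Definition ccomp (T U V : Type) (c1 : T -> U -> R) (c2 : U -> V -> R) : T -> V -> R :=
  fun x z => inf [set c1 x y + c2 y z | y in [set: U]].

Section ccomp.
Context (T U V : Type) (dT : metric R T) (dU : metric R U) (dV : metric R V).
Context (c1 : T -> U -> R) (c2 : U -> V -> R) (u0 : U).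
Hypothesis C1 : coupling dT dU c1.
Hypothesis C2 : coupling dU dV c2.

Lemma ccomp_le y x z : ccomp c1 c2 x z <= c1 x y + c2 y z.
Proof.
apply: ge_inf; last by exists y.
by exists 0 => _ [u _ <-]; rewrite addr_ge0//; [exact: (cpl_ge0 C1)|exact: (cpl_ge0 C2)].
Qed.

Lemma ccomp_ge x z e : (forall y, e <= c1 x y + c2 y z) -> e <= ccomp c1 c2 x z.
Proof.
move=> h; apply: lb_le_inf; first by exists (c1 x u0 + c2 u0 z), u0.
by move=> _ [y _ <-].
Qed.

Lemma coupling_comp : coupling dT dV (ccomp c1 c2).
Proof.
split.
- move=> x' x z; rewrite -lerBlDl; apply: ccomp_ge => y.
  have := ccomp_le y x z; have := cpl_l C1 x' x y; lra.
- move=> z' x z; rewrite -lerBlDr; apply: ccomp_ge => y.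
  have := ccomp_le y x z; have := cpl_r C2 z' y z; lra.
- move=> z x x'; rewrite -lerBlDr; apply: ccomp_ge => y.
  rewrite lerBlDr -lerBlDl; apply: ccomp_ge => y'.
  have := cpl_dl C1 y x x'; have := cpl_r C1 y' x' y; have := cpl_dl C2 z y' y.
  lra.
- move=> x z z'; rewrite -lerBlDr; apply: ccomp_ge => y.
  rewrite lerBlDr -lerBlDl; apply: ccomp_ge => y'.
  have := cpl_dr C2 y z z'; have := cpl_l C2 y' y z'; have := cpl_dr C1 x y y'.
  lra.
Qed.

Lemma fat_comp A e1 e2 : fat c2 (fat c1 A e1) e2 `<=` fat (ccomp c1 c2) A (e1 + e2).
Proof.
move=> z fz h h0; have h20 : 0 < h / 2 by rewrite divr_gt0.
have [y fy yz] := fz _ h20; have [x Ax xy] := fy _ h20.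
by exists x => //; have := ccomp_le y x z; lra.
Qed.

End ccomp.

Lemma swap_ccomp (T U V : Type) (c1 : T -> U -> R) (c2 : U -> V -> R) :
  swap (ccomp c1 c2) = ccomp (swap c2) (swap c1).
Proof.
apply/funext => z; apply/funext => x; rewrite /swap /ccomp; congr inf.
by apply/seteqP; split => _ [y _ <-]; exists y => //; rewrite addrC.
Qed.

Lemma near_comp X Y Z c1 c2 a1 b1 r1 a2 b2 r2 :
  mmnear (X := X) (Y := Y) c1 a1 b1 r1 -> mmnear (X := Y) (Y := Z) c2 a2 b2 r2 ->
  mmnear (ccomp c1 c2) (a1 + a2) (b1 + b2) (r1 + r2).
Proof.
move=> [C1 pl1 pr1 hl1 hr1 rt1] [C2 pl2 pr2 hl2 hr2 rt2].
have C := coupling_comp (mm_root Y) C1 C2.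
have y0 := mm_root Y.
split => //.
- move=> A cA; have := pl1 A cA; have := pl2 _ (mclosed_fat C1 A a1).
  have : ms Z (fat c2 (fat c1 A a1) a2) <= ms Z (fat (ccomp c1 c2) A (a1 + a2)).
    apply: le_ms; [exact: mmeas_fat|exact: mmeas_fat|].
    exact: (fat_comp C1 C2).
  lra.
- have [C1' C2'] := (coupling_swap C1, coupling_swap C2).
  move=> A cA; rewrite swap_ccomp; have C' := coupling_comp y0 C2' C1'.
  have := pr2 A cA; have := pr1 _ (mclosed_fat C2' A a2).
  have : ms X (fat (swap c1) (fat (swap c2) A a2) a1) <=
      ms X (fat (ccomp (swap c2) (swap c1)) A (a2 + a1)).
    apply: le_ms; [exact: mmeas_fat|exact: mmeas_fat|].
    exact: (fat_comp C2' C1').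
  rewrite (addrC a2); lra.
- move=> x h h0; have h20 : 0 < h / 2 by rewrite divr_gt0.
  have [y xy] := hl1 x _ h20; have [z yz] := hl2 y _ h20.
  by exists z; have := ccomp_le C1 C2 y x z; lra.
- move=> z h h0; have h20 : 0 < h / 2 by rewrite divr_gt0.
  have [y yz] := hr2 z _ h20; have [x xy] := hr1 y _ h20.
  by exists x; have := ccomp_le C1 C2 y x z; lra.
- have := ccomp_le C1 C2 (mm_root Y) (mm_root X) (mm_root Z); lra.
Qed.

Lemma near_strong_equiv X Y : mm_strong_equiv X Y ->
  exists c, mmnear (X := X) (Y := Y) c 0 0 0.
Proof.
move=> [f [fi fs fr fm]].
have fi' x y : car_metric Y (f x) (f y) = car_metric X x y := fi x y.
exists (fun x y => car_metric Y (f x) y).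
have C : coupling (car_metric X) (car_metric Y) (fun x y => car_metric Y (f x) y).
  split.
  - by move=> x' x y; rewrite -fi'; exact: metric_tri.
  - by move=> y' x y; exact: metric_tri.
  - by move=> y x x'; rewrite -fi' (metric_symm _ (f x')); exact: metric_tri.
  - by move=> x y y'; rewrite (metric_symm _ (f x) y); exact: metric_tri.
have pres A : mmeas Y A -> ms Y A = ms X [set x | A (f x)].
  by move=> mA; rewrite /ms -fm.
have fc : measurable_fun setT (f : borelType X -> borelType Y).
  apply: measurable_fun_borel => x B /nbhs_mdist[e e0 eB]; apply/nbhs_mdist.
  by exists e => // y xy; apply: eB; rewrite fi.
split => //.
- move=> A cA; rewrite addr0 pres; last exact: mmeas_fat.
  apply: le_ms; first exact: closed_mmeas.
    by have := fc measurableT _ (mmeas_fat C A 0); rewrite setTI.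
  by move=> x Ax h h0; exists x => //; rewrite metric_xx add0r.
- move=> A cA; rewrite addr0 (pres _ (closed_mmeas cA)).
  apply: le_ms; last by move=> x Ax h h0; exists (f x) => //; rewrite /swap metric_xx add0r.
    by have := fc measurableT _ (closed_mmeas cA); rewrite setTI.
  by apply: mmeas_fat; exact: coupling_swap.
- by move=> x h h0; exists (f x); rewrite metric_xx add0r.
- by move=> y h h0; have [x <-] := fs y; exists x; rewrite metric_xx add0r.
- by have := fr; rewrite /point /= => ->; rewrite metric_xx.
Qed.

Section glue.
Context (X Y : mmSpace R) (c : car X -> car Y -> R).
Hypothesis C : coupling (car_metric X) (car_metric Y) c.

(* The shift by [h > 0] makes distinct halves distinguishable. *)
Definition glue_fun (h : R) (u v : car X + car Y) : R :=
  match u, v with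
  | inl x, inl x' => car_metric X x x'
  | inr y, inr y' => car_metric Y y y'
  | inl x, inr y => c x y + h
  | inr y, inl x => c x y + h
  end.

Lemma glue_metric (h : R) : 0 < h ->
  exists2 d : metric R (car X + car Y), extends d & d = glue_fun h :> (_ -> _ -> _).
Proof.
move=> h0; have c0 := cpl_ge0 C.
have g0 u : glue_fun h u u = 0 by case: u => x /=; exact: metric_xx.
have g1 u v : glue_fun h u v = 0 -> u = v.
  case: u v => [x|y] [x'|y'] /=; try by move=> e; congr (_ _); exact: metric_eq0 e.
    by move/eqP; rewrite gt_eqF// ltr_wpDl.
  by move/eqP; rewrite gt_eqF// ltr_wpDl.
have g2 u v : glue_fun h u v = glue_fun h v u.
  by case: u v => [x|y] [x'|y'] //=; exact: metric_symm.
have g3 v u w : glue_fun h u w <= glue_fun h u v + glue_fun h v w.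
  case: u v w => [x|y] [x'|y'] [x''|y''] //=; try exact: metric_tri.
  - by have := cpl_l C x' x y''; lra.
  - by have := cpl_dl C y' x x''; lra.
  - by have := cpl_r C y' x y''; lra.
  - by have := cpl_l C x' x'' y; rewrite (metric_symm _ x''); lra.
  - by have := cpl_dr C x' y y''; lra.
  - by have := cpl_r C y' x'' y; rewrite (metric_symm _ y); lra.
by exists (IsMetric g0 g1 g2 g3).
Qed.

End glue.

Section enlarge.
Context (E : pointedMetricType R).
Implicit Types (A : set E).

Lemma enlargeP A e y : enlarge A e y <->
  forall h : R, 0 < h -> exists2 a, A a & mdist y a < e + h.
Proof.
rewrite /enlarge /= /dist_to; split=> [H h h0|H].
  have : (ereal_inf [set (mdist y a)%:E | a in A] < (e + h)%:E)%E.
    by apply: le_lt_trans H _; rewrite lte_fin ltrDl.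
  by move=> /ereal_inf_lt[_ [a Aa <-]]; rewrite lte_fin; exists a.
apply/lee_addgt0Pr => h h0; have [a Aa ya] := H h h0.
apply: (@le_trans _ _ (mdist y a)%:E); first by apply: ereal_inf_lbound; exists a.
by rewrite -EFinD lee_fin ltW.
Qed.

Lemma closed_enlarge A e : closed (enlarge A e).
Proof.
apply/closed_mdistP => y H; apply/enlargeP => h h0.
have h20 : 0 < h / 2 by rewrite divr_gt0.
have [z /enlargeP/(_ _ h20)[a Aa za] yz] := H _ h20.
by exists a => //; have := metric_triangle y z a; lra.
Qed.

Lemma enlarge_closure A e : enlarge (closure A) e `<=` enlarge A e.
Proof.
move=> y /enlargeP H; apply/enlargeP => h h0.
have h20 : 0 < h / 2 by rewrite divr_gt0.
have [z cz yz] := H _ h20.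
have /cz[a [Aa za]] : nbhs z (ball z (h / 2)) by exact: nbhsx_ballx.
exists a => //; have := metric_triangle y z a.
by move: za; rewrite ball_mdistP; lra.
Qed.

End enlarge.

Section dGHP.
Context (X Y : mmSpace R).
Local Open Scope ereal_scope.

Lemma mclosed_inl (d : metric R (car X + car Y)) (A : set (car X + car Y)) :
  extends d -> closed (A : set (pmspace d (inl (mm_root X)))) ->
  mclosed X [set x | A (inl x)].
Proof.
move=> [dl _] /closed_mdistP cA; apply/mclosedP => x H; apply: cA => e e0.
by have [a Aa xa] := H e e0; exists (inl a) => //; rewrite /mdist /= dl.
Qed.

Lemma mclosed_inr (d : metric R (car X + car Y)) (A : set (car X + car Y)) :
  extends d -> closed (A : set (pmspace d (inl (mm_root X)))) ->
  mclosed Y [set y | A (inr y)].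
Proof.
move=> [_ dr] /closed_mdistP cA; apply/mclosedP => x H; apply: cA => e e0.
by have [a Aa xa] := H e e0; exists (inr a) => //; rewrite /mdist /= dr.
Qed.

Lemma near_dGHP c a b r : mmnear (X := X) (Y := Y) c a b r ->
  (0 <= a)%R -> (0 <= b)%R -> dGHP X Y <= (a + b + r)%:E.
Proof.
move=> [C pl pr hl hr rt] a0 b0; apply/lee_addgt0Pr => e e0.
have h0 : (0 < e / 4)%R by rewrite divr_gt0.
set h := (e / 4)%R in h0.
have [d ext dE] := glue_metric C h0.
pose E := pmspace d (inl (mm_root X)).
apply: (@le_trans _ _ (GHP_cost d)); first by apply: ereal_inf_lbound; exists d.
have el x y : mdist (inl x : E) (inr y) = (c x y + h)%R by rewrite /mdist /= dE.
have er x y : mdist (inr y : E) (inl x) = (c x y + h)%R by rewrite /mdist /= dE.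
have C' := coupling_swap C.
rewrite /GHP_cost; apply: (@le_trans _ _ ((a + h)%:E + (b + h)%:E + (r + h)%:E)).
  apply: leeD; first apply: leeD; last by rewrite dE /= lee_fin; lra.
  - apply: ereal_inf_lbound; exists (a + h)%R => //; split; first lra.
    move=> A cA; have [cl cr] := (mclosed_inl ext cA, mclosed_inr ext cA).
    have cl' := mclosed_inl ext (@closed_enlarge E A (a + h)).
    have cr' := mclosed_inr ext (@closed_enlarge E A (a + h)).
    have ml := msE (closed_mmeas cl); have mr := msE (closed_mmeas cr).
    have ml' := msE (closed_mmeas cl'); have mr' := msE (closed_mmeas cr').
    have X1 : (ms X [set x | A (inl x)] <=
        ms Y [set y | enlarge (E := E) A (a + h) (inr y)] + (a + h))%R.
      apply: (le_trans (pl _ cl)); apply: lerD; last lra.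
      apply: le_ms; [exact: mmeas_fat|exact: closed_mmeas|].
      move=> y fy; apply/enlargeP => k k0; have [x Ax xy] := fy k k0.
      by exists (inl x) => //; rewrite er; lra.
    have Y1 : (ms Y [set y | A (inr y)] <=
        ms X [set x | enlarge (E := E) A (a + h) (inl x)] + (a + h))%R.
      apply: (le_trans (pr _ cr)); apply: lerD; last lra.
      apply: le_ms; [exact: mmeas_fat|exact: closed_mmeas|].
      move=> y fy; apply/enlargeP => k k0; have [x Ax xy] := fy k k0.
      by exists (inr x) => //; rewrite el; move: xy; rewrite /swap; lra.
    split.
      by move: X1; rewrite -lee_fin EFinD -ml -mr'.
    by move: Y1; rewrite -lee_fin EFinD -mr -ml'.
  - apply: ereal_inf_lbound; exists (b + h)%R => //; split; first lra.
      move=> _ [y _ <-]; apply/enlargeP => k k0; have [x xy] := hr y k k0.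
      by exists (inl x); [exists x|rewrite er; lra].
    move=> _ [x _ <-]; apply/enlargeP => k k0; have [y xy] := hl x k k0.
    by exists (inr y); [exists y|rewrite el; lra].
by rewrite -!EFinD lee_fin /h; lra.
Qed.

Lemma dGHP_near e : dGHP X Y < e%:E ->
  exists c a b r, [/\ mmnear (X := X) (Y := Y) c a b r, (0 <= a)%R, (0 <= b)%R &
    (a + b + r < e)%R].
Proof.
move=> /ereal_inf_lt[_ [d ext <-]]; rewrite /GHP_cost.
set E := pmspace d (inl (mm_root X)); set r := d _ _.
set P := prohorov_dist _ _; set H := hausdorff_dist _ _.
have P0 : 0 <= P by apply: le_ereal_inf_tmp => _ [a [/ltW a0 _] <-]; rewrite lee_fin.
have H0 : 0 <= H by apply: le_ereal_inf_tmp => _ [a [/ltW a0 _ _] <-]; rewrite lee_fin.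
move=> PHr; have Pf : P \is a fin_num.
  rewrite ge0_fin_numE// ltey; apply/eqP => Py; move: PHr; rewrite Py.
  by rewrite addye ?gt_eqF// ?(lt_le_trans _ H0)// addye// ltNge leey.
have Hf : H \is a fin_num.
  rewrite ge0_fin_numE// ltey; apply/eqP => Hy; move: PHr; rewrite Hy.
  by rewrite -(fineK Pf) addey// addye// ltNge leey.
have s0 : (0 < (e - (fine P + fine H + r)) / 2)%R.
  rewrite divr_gt0// subr_gt0 -lte_fin !EFinD !fineK//.
set s := (_ / 2)%R in s0.
have [_ [a [a0 Pa] <-]] := lb_ereal_inf_adherent s0 Pf.
have [_ [b [b0 Hb1 Hb2] <-]] := lb_ereal_inf_adherent s0 Hf.
move=> bH aP.
have {}bH : (b < fine H + s)%R by rewrite -lte_fin EFinD fineK.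
have {}aP : (a < fine P + s)%R by rewrite -lte_fin EFinD fineK.
have [dl dr] := ext.
exists (fun x y => d (inl x) (inr y)), a, b, r.
have C : coupling (car_metric X) (car_metric Y) (fun x y => d (inl x) (inr y)).
  split.
  - by move=> x' x y; rewrite -dl; exact: metric_tri.
  - by move=> y' x y; rewrite -dr; exact: metric_tri.
  - by move=> y x x'; rewrite -dl (metric_symm _ (inl x')); exact: metric_tri.
  - by move=> x y y'; rewrite -dr (metric_symm _ (inl x) (inr y)); exact: metric_tri.
split; [split => //|exact: ltW|exact: ltW|].
(* The Prohorov condition speaks of closed sets of the union. Replacing the image of [A] by its
   closure can only raise its mass and does not raise its enlargement. *)
- move=> A cA; pose B : set E := closure ([set inl x | x in A] : set E).
  have cB : closed B by exact: closed_closure.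
  have [PB _] := Pa B cB.
  have mB := closed_mmeas (mclosed_inl ext cB).
  have mB' := closed_mmeas (mclosed_inr ext (@closed_enlarge E B a)).
  have PB' : (ms X [set x | B (inl x)] <= ms Y [set y | enlarge B a (inr y)] + a)%R.
    by rewrite -lee_fin EFinD -(msE mB) -(msE mB').
  have l1 : (ms X A <= ms X [set x | B (inl x)])%R.
    apply: le_ms => //; first exact: closed_mmeas.
    by move=> x Ax; apply: subset_closure; exists x.
  have l2 : (ms Y [set y | enlarge B a (inr y)] <=
      ms Y (fat (fun x y => d (inl x) (inr y)) A a))%R.
    apply: le_ms => //; first exact: mmeas_fat.
    move=> y /enlarge_closure/enlargeP ey h h0.
    have [_ [x Ax <-] yx] := ey h h0.
    by exists x => //; rewrite metric_symm.
  lra.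
- move=> A cA; pose B : set E := closure ([set inr y | y in A] : set E).
  have cB : closed B by exact: closed_closure.
  have [_ PB] := Pa B cB.
  have mB := closed_mmeas (mclosed_inr ext cB).
  have mB' := closed_mmeas (mclosed_inl ext (@closed_enlarge E B a)).
  have PB' : (ms Y [set x | B (inr x)] <= ms X [set y | enlarge B a (inl y)] + a)%R.
    by rewrite -lee_fin EFinD -(msE mB) -(msE mB').
  have l1 : (ms Y A <= ms Y [set x | B (inr x)])%R.
    apply: le_ms => //; first exact: closed_mmeas.
    by move=> x Ax; apply: subset_closure; exists x.
  have l2 : (ms X [set y | enlarge B a (inl y)] <=
      ms X (fat (swap (fun x y => d (inl x) (inr y))) A a))%R.
    apply: le_ms => //; first by apply: mmeas_fat; exact: coupling_swap.
    move=> y /enlarge_closure/enlargeP ey h h0.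
    have [_ [x Ax <-] yx] := ey h h0.
    by exists x.
  lra.
- move=> x h h0.
  have /Hb2/enlargeP/(_ _ h0)[_ [y _ <-] xy] : range (@inl (car X) (car Y)) (inl x) by exists x.
  by exists y.
- move=> y h h0.
  have /Hb1/enlargeP/(_ _ h0)[_ [x _ <-] xy] : range (@inr (car X) (car Y)) (inr y) by exists y.
  by exists x; rewrite metric_symm.
- move: s0 aP bH; rewrite /s; lra.
Qed.

End dGHP.

End near.

(** * Ultralimits *)

Lemma free_ultrafilter : exists U : set_system nat, UltraFilter U /\
  forall n, U [set m | (n <= m)%N].
Proof.
have [U [UU oU]] := ultraFilterLemma (eventually_filter : ProperFilter (nbhs \oo)).
by exists U; split => // n; apply: oU; exists n.
Qed.

Lemma ultra_ex2 (U : set_system nat) {UU : UltraFilter U} (P Q : set nat) :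
  U P -> U Q -> exists n, P n /\ Q n.
Proof.
move=> UP UQ; have UPQ : U (P `&` Q) by exact: filterI.
by have [n [Pn Qn]] := @filter_ex _ U _ _ UPQ;
  exists n.
Qed.

Lemma ultraW (U : set_system nat) {UU : UltraFilter U} (P : set nat) :
  (forall n, P n) -> U P.
Proof. by move=> h; apply: filterS (@filterT _ U _) => n _. Qed.

Section ultralimit.
Context (R : realType) (U : set_system nat) {UU : UltraFilter U}.

Definition ubounded (u : nat -> R) := exists M, forall n, `|u n| <= M.

(** The limit is the supremum of the reals that lie below [u n] for [U]-many [n]: for a larger real
    the ultrafilter must contain the complementary set. *)
Lemma ulim_exists (u : nat -> R) : ubounded u ->
  exists l, forall e : R, 0 < e -> U [set n | `|u n - l| < e].
Proof.
move=> [M uM]; pose S := [set r : R | U [set n | r <= u n]].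
have hS : has_sup S.
  split.
    exists (- M); rewrite /S /=; apply: filterS filterT => n _ /=.
    by have := uM n; rewrite ler_norml => /andP[].
  exists M => r /filter_ex[n /= rn]; apply: le_trans rn _.
  exact: le_trans (ler_norm _) (uM n).
exists (sup S) => e e0.
have [r Sr rs] := sup_adherent e0 hS.
have nS : ~ S (sup S + e).
  by move=> /(ub_le_sup hS.2); rewrite leNgt ltrDl e0.
have [|h] := in_ultra_setVsetC [set n | sup S + e <= u n] UU; first by [].
apply: filterS2 Sr h => n /= rn /negP; rewrite -ltNge => nu.
by rewrite ltr_norml; apply/andP; split; lra.
Qed.

Definition ulim (u : nat -> R) : R :=
  xget 0 [set l | forall e : R, 0 < e -> U [set n | `|u n - l| < e]].

Lemma ulimP u : ubounded u -> forall e : R, 0 < e -> U [set n | `|u n - ulim u| < e].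
Proof.
move=> bu; have [l lP] := ulim_exists bu.
exact: (@xgetI _ 0 [set l | forall e : R, 0 < e -> U [set n | `|u n - l| < e]] l lP).
Qed.

Lemma ulim_le u M : ubounded u ->
  (forall e : R, 0 < e -> U [set n | u n <= M + e]) -> ulim u <= M.
Proof.
move=> bu h; apply/ler_addgt0Pr => e e0; have e20 : 0 < e / 2 by rewrite divr_gt0.
have [n [/= + +]] := ultra_ex2 (ulimP bu e20) (h _ e20).
by rewrite ltr_norml => /andP[]; lra.
Qed.

Lemma ulim_ge u M : ubounded u ->
  (forall e : R, 0 < e -> U [set n | M <= u n + e]) -> M <= ulim u.
Proof.
move=> bu h; apply/ler_addgt0Pr => e e0; have e20 : 0 < e / 2 by rewrite divr_gt0.
have [n [/= + +]] := ultra_ex2 (ulimP bu e20) (h _ e20).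
by rewrite ltr_norml => /andP[]; lra.
Qed.

Lemma ulim_lt u M : ubounded u -> ulim u < M -> U [set n | u n < M].
Proof.
move=> bu uM; have e0 : 0 < M - ulim u by rewrite subr_gt0.
by apply: filterS (ulimP bu e0) => n /=; rewrite ltr_norml => /andP[]; lra.
Qed.

Lemma ulim_gt u M : ubounded u -> M < ulim u -> U [set n | M < u n].
Proof.
move=> bu uM; have e0 : 0 < ulim u - M by rewrite subr_gt0.
by apply: filterS (ulimP bu e0) => n /=; rewrite ltr_norml => /andP[]; lra.
Qed.

Lemma ulim_eq u l : ubounded u -> (forall e : R, 0 < e -> U [set n | `|u n - l| < e]) ->
  ulim u = l.
Proof.
move=> bu h; apply/eqP; rewrite eq_le; apply/andP; split.
  apply: ulim_le => // e e0; apply: filterS (h e e0) => n /=.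
  by rewrite ltr_norml => /andP[]; lra.
apply: ulim_ge => // e e0; apply: filterS (h e e0) => n /=.
by rewrite ltr_norml => /andP[]; lra.
Qed.

Lemma compact_ulim (E : pointedMetricType R) (A : set E) (x_ : nat -> E) :
  compact A -> U [set n | A (x_ n)] ->
  exists2 x, A x & forall e : R, 0 < e -> U [set n | mdist x (x_ n) < e].
Proof.
move=> cA UA; have [x [Ax clx]] := cA (x_ @ U) _ UA.
exists x => // e e0.
have [//|h] := in_ultra_setVsetC [set n | mdist x (x_ n) < e] UU.
have h' : (x_ @ U) (~` ball x e) by apply: (@filterS _ U _ _ _ _ h) => n nd xd; apply: nd; exact/ball_mdistP.
by have [y [/= ny xy]] := clx _ _ h' (nbhsx_ballx x e e0).
Qed.

Lemma inv_nat_U (e : R) : (forall n, U [set m | (n <= m)%N]) -> 0 < e ->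
  U [set m : nat | m.+1%:R^-1 < e].
Proof.
move=> fU e0; have [n ne] := inv_nat_lt e0.
apply: filterS (fU n) => m /= nm; apply: le_lt_trans ne.
by rewrite lef_pV2 ?posrE// ler_nat.
Qed.

End ultralimit.

Section fatten.
Context (R : realType).
Implicit Types (X Y : mmSpace R).

(** Continuity from above along the fattenings of radius [1 / (n + 1)], which decrease to [B]
    because [B] is closed. *)
Lemma ms_fat_le X (B : set (car X)) (m : R) : mclosed X B ->
  (forall h : R, 0 < h -> m <= ms X (fat (car_metric X) B h) + h) -> m <= ms X B.
Proof.
move=> cB H; pose F n : set (borelType X) := fat (car_metric X) B n.+1%:R^-1.
have mF n : measurable (F n) by exact: mmeas_fat (coupling_metric _) _ _.
have FB : \bigcap_n F n = B.
  apply/seteqP; split=> [x Fx|x Bx n _ h h0].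
    move/mclosedP : cB; apply => e e0; have e20 : 0 < e / 2 by rewrite divr_gt0.
    have [n ne] := inv_nat_lt e20; have [b Bb bx] := Fx n I _ e20.
    by exists b => //; rewrite metric_symm; move: bx ne; set r := n.+1%:R^-1; lra.
  by exists x => //; rewrite metric_xx ltr_wpDl// invr_ge0.
have cv : mu X (F n) @[n --> \oo] --> mu X (\bigcap_n F n).
  apply: nonincreasing_cvg_mu => //.
  - by rewrite ltey_eq fin_num_measure.
  - exact: bigcapT_measurable.
  - move=> i j ij; apply/subsetPset; apply: fat_sub => //.
    by rewrite lef_pV2 ?posrE// ler_nat.
rewrite FB in cv; apply/ler_addgt0Pr => e e0.
have e20 : 0 < e / 2 by rewrite divr_gt0.
rewrite (msE (closed_mmeas cB)) in cv.
have /fine_cvgP[_ cv'] := cv.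
have /cvgrPdist_lt/(_ _ e20)[N _ NP] := cv'.
have [M Me] := inv_nat_lt e20.
have := H (maxn N M).+1%:R^-1; rewrite invr_gt0 ltr0n => /(_ isT).
have := NP (maxn N M) (leq_maxl _ _); rewrite /= -/(ms X _).
have : (maxn N M).+1%:R^-1 <= M.+1%:R^-1 :> R.
  by rewrite lef_pV2 ?posrE// ler_nat ltnS leq_maxr.
rewrite /F; move: (ms X (fat _ _ _)) Me.
set r := M.+1%:R^-1; set r' := (maxn N M).+1%:R^-1 => s Me rr.
rewrite ltr_norml => /andP[]; lra.
Qed.

Lemma compact_bounded X : compact [set: X] ->
  exists B, forall x, car_metric X (mm_root X) x <= B.
Proof.
move=> cX; have [N [f fP]] := compact_net cX ltr01.
exists (\sum_(i < N) car_metric X (mm_root X) (f i) + 1) => x.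
have [i iN ix] := fP x I.
rewrite (le_trans (metric_tri _ (f i) _ _))// lerD//; last exact: ltW.
rewrite (bigD1 (Ordinal iN))//= lerDl sumr_ge0// => j _.
exact: metric_ge0.
Qed.

(** The cross distance is that of the two spaces joined at their roots, and the total masses serve
    as a crude Prohorov error. This makes the GHP distance finite on compact spaces. *)
Lemma near_exists X Y : compact [set: X] -> compact [set: Y] ->
  exists c a b r, [/\ mmnear (X := X) (Y := Y) c a b r, 0 <= a & 0 <= b].
Proof.
move=> /compact_bounded[B1 B1P] /compact_bounded[B2 B2P].
have B10 : 0 <= B1 by rewrite -(metric_xx (car_metric X) (mm_root X)).
have B20 : 0 <= B2 by rewrite -(metric_xx (car_metric Y) (mm_root Y)).
exists (fun x y => car_metric X (mm_root X) x + car_metric Y (mm_root Y) y).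
exists (ms X setT + ms Y setT), (B1 + B2), 0.
have C : coupling (car_metric X) (car_metric Y)
  (fun x y => car_metric X (mm_root X) x + car_metric Y (mm_root Y) y).
  split=> x y z.
  - have := metric_tri (car_metric X) x (mm_root X) y.
    by rewrite (metric_symm _ x y); lra.
  - by have := metric_tri (car_metric Y) x (mm_root Y) z; lra.
  - have := metric_tri (car_metric X) (mm_root X) y z.
    have := metric_ge0 (car_metric Y) (mm_root Y) x.
    by rewrite (metric_symm _ y (mm_root X)); lra.
  - have := metric_tri (car_metric Y) (mm_root Y) y z.
    have := metric_ge0 (car_metric X) (mm_root X) x.
    by rewrite (metric_symm _ y (mm_root Y)); lra.
split; [split => //|by rewrite addr_ge0// ms_ge0|exact: addr_ge0].
- move=> A cA; have := le_ms (closed_mmeas cA) (mmeasT (X := X)) (@subsetT _ A).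
  have := ms_ge0 (X := Y) (fat (fun x y =>
    car_metric X (mm_root X) x + car_metric Y (mm_root Y) y) A (ms X setT + ms Y setT)).
  have := ms_ge0 (X := Y) setT; lra.
- move=> A cA; have := le_ms (closed_mmeas cA) (mmeasT (X := Y)) (@subsetT _ A).
  have := ms_ge0 (X := X) (fat (swap (fun x y =>
    car_metric X (mm_root X) x + car_metric Y (mm_root Y) y)) A (ms X setT + ms Y setT)).
  have := ms_ge0 (X := X) setT; lra.
- by move=> x h h0; exists (mm_root Y); rewrite metric_xx; have := B1P x; lra.
- by move=> y h h0; exists (mm_root X); rewrite metric_xx; have := B2P y; lra.
- by rewrite !metric_xx addr0.
Qed.

End fatten.

(** * Couplings of vanishing error yield a measure-preserving isometry *)

Section zero_distance.
Context (R : realType) (X Y : mmSpace R).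
Hypotheses (cX : compact [set: X]) (cY : compact [set: Y]).
Hypothesis XY : forall e : R, 0 < e -> exists c, mmnear (X := X) (Y := Y) c e e e.

Lemma zero_strong_equiv : mm_strong_equiv X Y.
Proof.
have [U [UU fU]] := free_ultrafilter.
have r0 n : 0 < n.+1%:R^-1 :> R by rewrite invr_gt0.
have [c cP] := choice (fun n => XY (r0 n)).
have C n := near_cpl (cP n).
(* Passing through both roots bounds [c n x y] independently of [n], so that its ultralimit
   exists. *)
have cb x y : ubounded (fun n => c n x y).
  exists (car_metric X x (mm_root X) + 1 + car_metric Y (mm_root Y) y) => n.
  rewrite ger0_norm; last exact: (cpl_ge0 (C n)).
  have := cpl_l (C n) (mm_root X) x y; have := cpl_r (C n) (mm_root Y) (mm_root X) y.
  have := near_root (cP n).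
  have : n.+1%:R^-1 <= 1 :> R by rewrite invf_le1// ler1n.
  set r := n.+1%:R^-1; lra.
pose d x y := ulim U (fun n => c n x y).
have dlt x y e : d x y < e -> U [set n | c n x y < e] by exact: ulim_lt.
have dle x y e : (forall h : R, 0 < h -> U [set n | c n x y <= e + h]) -> d x y <= e.
  exact: ulim_le.
have small (e : R) : 0 < e -> U [set n : nat | n.+1%:R^-1 < e] by exact: inv_nat_U.
have D : coupling (car_metric X) (car_metric Y) d.
  split.
  - move=> x' x y; apply/ler_addgt0Pr => e e0.
    have h : d x' y < d x' y + e by rewrite ltrDl.
    apply: dle => h' h'0; apply: filterS (dlt _ _ _ h) => n /= h1.
    by have := cpl_l (C n) x' x y; lra.
  - move=> y' x y; apply/ler_addgt0Pr => e e0.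
    have h : d x y' < d x y' + e by rewrite ltrDl.
    apply: dle => h' h'0; apply: filterS (dlt _ _ _ h) => n /= h1.
    by have := cpl_r (C n) y' x y; lra.
  - move=> y x x'; apply/ler_addgt0Pr => e e0; have e20 : 0 < e / 2 by rewrite divr_gt0.
    have h : d x y < d x y + e / 2 by rewrite ltrDl.
    have h' : d x' y < d x' y + e / 2 by rewrite ltrDl.
    have [n [/= h1 h2]] := ultra_ex2 (dlt _ _ _ h) (dlt _ _ _ h').
    by have := cpl_dl (C n) y x x'; lra.
  - move=> x y y'; apply/ler_addgt0Pr => e e0; have e20 : 0 < e / 2 by rewrite divr_gt0.
    have h : d x y < d x y + e / 2 by rewrite ltrDl.
    have h' : d x y' < d x y' + e / 2 by rewrite ltrDl.
    have [n [/= h1 h2]] := ultra_ex2 (dlt _ _ _ h) (dlt _ _ _ h').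
    by have := cpl_dr (C n) x y y'; lra.
have d0 := cpl_ge0 D.
(* Ultralimits of approximate partners are exact partners. With compactness this gives each point of
   either space a partner at [d]-distance [0], and hence the map [f]. *)
have lim0 (x_ : nat -> car X) (y_ : nat -> car Y) x y :
    (forall e : R, 0 < e -> U [set n | car_metric X x (x_ n) < e]) ->
    (forall e : R, 0 < e -> U [set n | car_metric Y y (y_ n) < e]) ->
    U [set n | c n (x_ n) (y_ n) < 2 * n.+1%:R^-1] -> d x y = 0.
  move=> xl yl h; apply/eqP; rewrite eq_le d0 andbT; apply: dle => e e0.
  have e40 : 0 < e / 4 by rewrite divr_gt0.
  apply: filterS3 (filterI (xl _ e40) (yl _ e40)) h (small _ e40) => n /= [h1 h2].
  have := cpl_l (C n) (x_ n) x y; have := cpl_r (C n) (y_ n) (x_ n) y.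
  by rewrite (metric_symm _ _ y); set r := n.+1%:R^-1; lra.
have uconst (T : Type) (m : metric R T) x : forall e : R, 0 < e -> U [set n : nat | m x x < e].
  by move=> e e0; apply: ultraW => n /=; rewrite metric_xx.
have ex1 x : exists y, d x y = 0.
  have [y_ yP] := choice (fun n => near_hl (cP n) x (r0 n)).
  have [y _ yl] := compact_ulim (E := Y) cY (x_ := y_) filterT.
  exists y; apply: (lim0 (fun=> x) y_ _ _ (uconst _ _ x) yl).
  by apply: ultraW => n /=; have := yP n; set r := n.+1%:R^-1; lra.
have ex2 y : exists x, d x y = 0.
  have [x_ xP] := choice (fun n => near_hr (cP n) y (r0 n)).
  have [x _ xl] := compact_ulim (E := X) cX (x_ := x_) filterT.
  exists x; apply: (lim0 x_ (fun=> y) _ _ xl (uconst _ _ y)).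
  by apply: ultraW => n /=; have := xP n; set r := n.+1%:R^-1; lra.
have [f fP] := choice ex1.
have fE x y : d x y = car_metric Y (f x) y.
  apply/eqP; rewrite eq_le.
  have := cpl_r D (f x) x y; have := cpl_dr D x (f x) y.
  rewrite fP => h1 h2; apply/andP; split; lra.
have fi x x' : car_metric Y (f x) (f x') = car_metric X x x'.
  apply/eqP; rewrite eq_le; have := cpl_l D x' x (f x').
  have := cpl_dl D (f x') x x'; rewrite !fP fE => h1 h2.
  by apply/andP; split; lra.
(* By [ms_fat_le] it is enough that the fattening of [A] under [c n] lies near the image of [A] for
   [U]-many [n]. Otherwise there are points of [A] with approximate partners off that neighbourhood;
   their ultralimits [x] and [y] satisfy [d x y = 0], so [y = f x], and the partners do come near
   the image. *)
have ms1 A : mclosed X A -> ms X A <= ms Y (f @` A).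
  move=> cA; apply: ms_fat_le.
    apply/mclosedP => y H.
    have [x xy] := ex2 y; have xe : f x = y.
      by apply: (@metric_eq0 _ _ (car_metric Y)); rewrite -fE.
    exists x => //; move/mclosedP : cA; apply => e e0.
    by have [_ [a Aa <-]] := H e e0; rewrite -xe fi; exists a.
  move=> h h0; have e0 : 0 < h by [].
  suff UF : U [set n | fat (c n) A n.+1%:R^-1 `<=` fat (car_metric Y) (f @` A) h].
    have [n [/= nF nh]] := ultra_ex2 UF (small _ h0).
    have := near_pl (cP n) cA.
    have := le_ms (mmeas_fat (C n) A n.+1%:R^-1) (mmeas_fat (coupling_metric _) _ _) nF.
    by move: nh; set r := n.+1%:R^-1; lra.
  have [//|nU] := in_ultra_setVsetC
    [set n | fat (c n) A n.+1%:R^-1 `<=` fat (car_metric Y) (f @` A) h] UU.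
  have ex n : exists ay : car X * car Y,
      ~ (fat (c n) A n.+1%:R^-1 `<=` fat (car_metric Y) (f @` A) h) ->
      [/\ A ay.1, c n ay.1 ay.2 < 2 * n.+1%:R^-1 &
        ~ fat (car_metric Y) (f @` A) h ay.2].
    have [//|/existsNP[y /not_implyP[fy nfy]]] :=
        pselect (fat (c n) A n.+1%:R^-1 `<=` fat (car_metric Y) (f @` A) h).
      by exists (mm_root X, mm_root Y).
    have [a Aa ay] := fy _ (r0 n).
    by exists (a, y) => _; split => //=; move: ay; set r := n.+1%:R^-1; lra.
  have [ay ayP] := choice ex.
  have cA' : compact (A : set X) by exact: (subclosed_compact cA cX).
  have [x Ax xl] := compact_ulim (E := X) cA' (x_ := fun n => (ay n).1)
    (filterS (fun n h => let: And3 h _ _ := ayP n h in h) nU).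
  have [y _ yl] := compact_ulim (E := Y) cY (x_ := fun n => (ay n).2) filterT.
  have xy : d x y = 0.
    apply: (lim0 _ _ x y xl yl).
    by apply: filterS nU => n /= h'; have [] := ayP n h'.
  have [n [/= h1 /ayP[_ _]]] := ultra_ex2 (yl _ h0) nU.
  case=> k k0; exists (f x); first by exists x.
  have <- : y = f x by apply: (@metric_eq0 _ _ (car_metric Y)); rewrite metric_symm -fE.
  by have {}h1 : car_metric Y y (ay n).2 < h by []; lra.
have fc : continuous (f : X -> Y).
  move=> x B /nbhs_mdist[e e0 eB]; apply/nbhs_mdist.
  by exists e => // x' xx'; apply: eB; rewrite /mdist /= fi.
have mf A : mmeas Y A -> mmeas X [set x | A (f x)].
  by move=> mA; have := measurable_fun_borel fc measurableT mA; rewrite setTI.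
have clf A : mclosed Y A -> mclosed X [set x | A (f x)].
  move=> /mclosedP cA; apply/mclosedP => x H; apply: cA => e e0.
  by have [a Aa xa] := H e e0; exists (f a) => //; rewrite fi.
have fs y : exists x, f x = y.
  have [x xy] := ex2 y; exists x.
  by apply: (@metric_eq0 _ _ (car_metric Y)); rewrite -fE.
have imf (A : set (car Y)) : f @` [set x | A (f x)] = A.
  apply/seteqP; split=> [_ [x Ax <-] //|y Ay].
  by have [x xy] := fs y; exists x => //=; rewrite xy.
have total : ms Y setT <= ms X setT.
  apply/ler_addgt0Pr => e e0; have [n ne] := inv_nat_lt e0.
  have := near_pr (cP n) (closedT : mclosed Y setT).
  have CC := coupling_swap (C n).
  have := le_ms (mmeas_fat CC setT n.+1%:R^-1) (mmeasT (X := X)) (@subsetT _ _).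
  by move: ne; set r := n.+1%:R^-1; lra.
have compl (Z : mmSpace R) (A : set (car Z)) : mmeas Z A -> ms Z (~` A) = ms Z setT - ms Z A.
  move=> mA; rewrite -(setUv A) msDU ?setICr//; last exact: mmeasC.
  by rewrite addrC addKr.
(* The reverse inequality comes from [ms1] for the complement of an open neighbourhood [O] of [B],
   subtracted from the inequality [total]. *)
have ms2 B : mclosed Y B -> ms Y B <= ms X [set x | B (f x)].
  move=> cB; apply: ms_fat_le; first exact: clf.
  move=> h h0.
  pose O : set (car Y) := [set y | exists2 b, B b & car_metric Y y b < h].
  have cO : mclosed Y (~` O).
    apply/mclosedP => y H [b Bb yb].
    have [z nOz yz] : exists2 z, (~` O) z & car_metric Y y z < h - car_metric Y y b.
      by apply: H; rewrite subr_gt0.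
    apply: nOz; exists b => //; have := metric_tri (car_metric Y) y z b.
    by rewrite (metric_symm _ z y); lra.
  have mO := closed_mmeas cO.
  have mO' : mmeas Y O by rewrite -(setCK O); exact: mmeasC.
  have := ms1 _ (clf _ cO); rewrite imf (compl Y _ mO').
  have -> : [set x | (~` O) (f x)] = ~` [set x | O (f x)] by [].
  rewrite compl; last exact: mf.
  have : ms Y B <= ms Y O.
    apply: le_ms => //; first exact: closed_mmeas.
    by move=> y By; exists y => //; rewrite metric_xx.
  have : ms X [set x | O (f x)] <= ms X (fat (car_metric X) [set x | B (f x)] h).
    apply: le_ms; [exact: mf|exact: mmeas_fat (coupling_metric _) _ _|].
    move=> x [b Bb xb] k k0; have [x' x'b] := fs b.
    exists x'; first by rewrite /= x'b.
    by rewrite -fi x'b metric_symm; lra.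
  lra.
have closedE B : mclosed Y B -> ms X [set x | B (f x)] = ms Y B.
  move=> cB; apply/eqP; rewrite eq_le ms2// andbT.
  by rewrite -{2}(imf B); apply: ms1; exact: clf.
exists f; split=> //.
  apply: (@metric_eq0 _ _ (car_metric Y)); rewrite -fE.
  apply/eqP; rewrite eq_le d0 andbT; apply: dle => e e0.
  apply: filterS (small _ e0) => n /= ne; have := near_root (cP n).
  by move: ne; set r := n.+1%:R^-1; lra.
move=> A mA.
have mfun := measurable_fun_borel fc.
(* The pushforward as a bundled measure, so that uniqueness on the intersection-stable family of
   open sets applies; on an open set, equality follows from [closedE] for the complement. *)
have nuE B : measurable (B : set (borelType Y)) ->
    measure_function_pushforward__canonical__measure_function_Measure (mu X) mfun B =
    mu X [set x | B (f x)] by [].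
rewrite -[LHS](nuE A mA).
apply: (measure_unique (@open Y : set (set (borelType Y))) (fun=> setT)) => //.
- exact: openI.
- by move=> _; exact: openT.
- by rewrite bigcup_const.
- move=> B oB; rewrite nuE; last exact: open_measurable_borel.
  have cB : mclosed Y (~` B) by exact: open_closedC.
  have mB : mmeas Y B by exact: open_measurable_borel.
  have : ms X (~` [set x | B (f x)]) = ms Y (~` B) := closedE _ cB.
  rewrite (compl X _ (mf _ mB)) (compl Y _ mB).
  have -> : ms X setT = ms Y setT by apply: (closedE setT); exact: closedT.
  move=> /(congr1 (fun r => ms Y setT - r)); rewrite !subKr => e; apply: (etrans (msE (mf _ mB)));
  rewrite e; exact: (esym (msE mB)).
- move=> _; rewrite [X in (X < _)%E](nuE setT measurableT) ltey_eq.
  by rewrite (fin_num_measure (mu X) _ (mf setT measurableT)).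
Qed.

End zero_distance.

(** * The support Gromov-Hausdorff-Prohorov metric *)

Section strong_equiv.
Context (R : realType).
Implicit Types (X Y Z : mmSpace R).

Lemma isometry_continuous (E F : metricType R) (f : E -> F) :
  (forall x y, mdist (f x) (f y) = mdist x y) -> continuous f.
Proof.
move=> fi x B /nbhs_mdist[e e0 eB]; apply/nbhs_mdist.
by exists e => // x' xx'; apply: eB; rewrite fi.
Qed.

Lemma isometry_measurable X Y (f : X -> Y) :
  (forall x y, mdist (f x) (f y) = mdist x y) ->
  forall A, mmeas Y A -> mmeas X [set x | A (f x)].
Proof.
move=> /isometry_continuous cf A mA.
by have := measurable_fun_borel cf measurableT mA; rewrite setTI.
Qed.

Lemma strong_equiv_sym X Y : mm_strong_equiv X Y -> mm_strong_equiv Y X.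
Proof.
move=> [f [fi fs fr fm]]; have [g gf] := choice fs.
have gi x y : mdist (g x) (g y) = mdist x y by rewrite -fi !gf.
have fg x : g (f x) = x by apply: mdist_positivity; rewrite -fi gf mdistxx.
exists g; split => //.
- by move=> x; exists (f x).
- by rewrite -{1}fr fg.
- move=> A mA; rewrite /pushforward -fm; last exact: (isometry_measurable gi mA).
  by rewrite /pushforward; congr (mu X _); apply/funext => x /=; rewrite /preimage /= fg.
Qed.

Lemma strong_equiv_trans X Y Z :
  mm_strong_equiv X Y -> mm_strong_equiv Y Z -> mm_strong_equiv X Z.
Proof.
move=> [f [fi fs fr fm]] [g [gi gs gr gm]]; exists (g \o f); split => /=.
- by move=> x y; rewrite gi fi.
- by move=> z; have [y <-] := gs z; have [x <-] := fs y; exists x.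
- by rewrite fr gr.
- move=> A mA; rewrite -gm// /pushforward -fm//.
  exact: (isometry_measurable gi mA).
Qed.

Lemma strong_equiv_compact X Y :
  mm_strong_equiv X Y -> compact [set: X] -> compact [set: Y].
Proof.
move=> [f [fi fs _ _]] cX.
have -> : [set: Y] = f @` [set: X].
  by apply/seteqP; split=> // y _; have [x <-] := fs y; exists x.
apply: continuous_compact => //; apply: continuous_subspaceT.
exact: isometry_continuous.
Qed.

Lemma strong_equiv_lower_mass X Y t :
  mm_strong_equiv X Y -> lower_mass t X = lower_mass t Y.
Proof.
move=> [f [fi fs fr fm]].
have e x r : mu X [set y : X | mdist x y <= r] = mu Y [set y : Y | mdist (f x) y <= r].
  rewrite -fm; last exact: (mmeas_ball (f x : car Y)).
  by rewrite /pushforward /preimage /=; congr (mu X _); apply/funext => y /=; rewrite fi.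
have sf x : supp X x <-> supp Y (f x).
  split=> /suppP h; apply/suppP => r r0.
    have := h r r0; rewrite /ms; have := e x r; rewrite /mdist /= => -> //.
  have := h r r0; rewrite /ms; have := e x r; rewrite /mdist /= => -> //.
rewrite /lower_mass; congr ereal_inf; apply/seteqP; split.
  by move=> _ [x sx <-]; exists (f x); [exact/sf|rewrite e].
move=> _ [y sy <-]; have [x xy] := fs y; exists x.
  by apply/sf; rewrite xy.
by rewrite e xy.
Qed.

Lemma compact_iota X : compact [set: X] -> compact [set: mm_iota X].
Proof.
move=> cX F FF _.
have cS : compact (@rooted_supp R X) by exact: (subclosed_compact (@closed_rooted_supp R X) cX).
pose f (u : mm_iota X) : X := val u.
have FS : (f @ F) (@rooted_supp R X).
  by apply: (@filterS _ F _ _ _ _ (@filterT _ F _)) => u _; exact/set_mem/(valP u).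
have [x [Sx clx]] := cS (f @ F) _ FS.
exists (exist _ x (mem_set Sx)); split => // A B FA /nbhs_mdist[e e0 eB].
have FA' : (f @ F) (f @` A) by apply: (@filterS _ F _ _ _ _ FA) => u Au; exists u.
have [_ [[u Au <-] /ball_mdistP xu]] := clx _ _ FA' (nbhsx_ballx x e e0).
by exists u; split => //; apply: eB.
Qed.

End strong_equiv.

Section ghp.
Context (R : realType).
Implicit Types (X Y Z : mmSpace R).

Definition ghp X Y : R := fine (dGHP X Y).

Lemma dGHP_ge0 X Y : (0 <= dGHP X Y)%E.
Proof.
apply: le_ereal_inf_tmp => _ [d _ <-]; rewrite /GHP_cost.
apply: adde_ge0; last by rewrite lee_fin metric_ge0.
by apply: adde_ge0; apply: le_ereal_inf_tmp => _ [e h <-]; rewrite lee_fin ltW//; case: h.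
Qed.

Lemma dGHPE X Y : compact [set: X] -> compact [set: Y] -> dGHP X Y = (ghp X Y)%:E.
Proof.
move=> cX cY; rewrite /ghp fineK// ge0_fin_numE; last exact: dGHP_ge0.
have [c [a [b [r [nc a0 b0]]]]] := near_exists cX cY.
by rewrite (le_lt_trans (near_dGHP nc a0 b0))// ltry.
Qed.

Lemma ghp_ge0 X Y : 0 <= ghp X Y.
Proof. by apply: fine_ge0; exact: dGHP_ge0. Qed.

Lemma ghp_le X Y c a b r : compact [set: X] -> compact [set: Y] ->
  mmnear (X := X) (Y := Y) c a b r -> 0 <= a -> 0 <= b -> ghp X Y <= a + b + r.
Proof. by move=> cX cY nc a0 b0; rewrite -lee_fin -dGHPE//; exact: near_dGHP nc a0 b0. Qed.

Lemma ghp_lt X Y e : compact [set: X] -> compact [set: Y] -> ghp X Y < e ->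
  exists c a b r, [/\ mmnear (X := X) (Y := Y) c a b r, 0 <= a, 0 <= b & a + b + r < e].
Proof. by move=> cX cY; rewrite -lte_fin -dGHPE//; exact: dGHP_near. Qed.

(** All three terms of the cost are nonnegative, so each lies below a bound on their sum and one
    error serves for all; the way back costs the factor [3] of [near_ghp]. *)
Lemma ghp_near X Y e : compact [set: X] -> compact [set: Y] -> ghp X Y < e ->
  exists c, mmnear (X := X) (Y := Y) c e e e.
Proof.
move=> cX cY /ghp_lt[]// c [a [b [r [nc a0 b0 abr]]]]; exists c.
have r0 := le_trans (cpl_ge0 (near_cpl nc) _ _) (near_root nc).
by apply: near_le nc; lra.
Qed.

Lemma near_ghp X Y c e : compact [set: X] -> compact [set: Y] -> 0 <= e ->
  mmnear (X := X) (Y := Y) c e e e -> ghp X Y <= 3 * e.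
Proof. by move=> cX cY e0 nc; have := ghp_le cX cY nc e0 e0; lra. Qed.

Lemma ghp_sym X Y : compact [set: X] -> compact [set: Y] -> ghp X Y = ghp Y X.
Proof.
have h (Z W : mmSpace R) : compact [set: Z] -> compact [set: W] -> ghp Z W <= ghp W Z.
  move=> cZ cW; apply/ler_addgt0Pr => e e0.
  have : ghp W Z < ghp W Z + e by rewrite ltrDl.
  move=> /ghp_lt[]// c [a [b [r [nc a0 b0 abr]]]].
  by have := ghp_le cZ cW (near_sym nc) a0 b0; lra.
by move=> cX cY; apply/eqP; rewrite eq_le !h.
Qed.

Lemma ghp_tri Y X Z : compact [set: X] -> compact [set: Y] -> compact [set: Z] ->
  ghp X Z <= ghp X Y + ghp Y Z.
Proof.
move=> cX cY cZ; apply/ler_addgt0Pr => e e0; have e20 : 0 < e / 2 by rewrite divr_gt0.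
have : ghp X Y < ghp X Y + e / 2 by rewrite ltrDl.
move=> /ghp_lt[]// c1 [a1 [b1 [r1 [nc1 a10 b10 abr1]]]].
have : ghp Y Z < ghp Y Z + e / 2 by rewrite ltrDl.
move=> /ghp_lt[]// c2 [a2 [b2 [r2 [nc2 a20 b20 abr2]]]].
by have := ghp_le cX cZ (near_comp nc1 nc2) (addr_ge0 a10 a20) (addr_ge0 b10 b20); lra.
Qed.

Lemma ghp_strong_equiv X Y : compact [set: X] -> compact [set: Y] ->
  ghp X Y = 0 <-> mm_strong_equiv X Y.
Proof.
move=> cX cY; split=> [h|/near_strong_equiv[c nc]].
  by apply: zero_strong_equiv => // e e0; apply: ghp_near => //; rewrite h.
by apply/eqP; rewrite eq_le ghp_ge0 andbT; have := ghp_le cX cY nc (lexx _) (lexx _); lra.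
Qed.

End ghp.

Section ilm_dist.
Context (R : realType).
Implicit Types (X Y Z : mmSpace R).

Definition ilm_gap X Y (t : R) : R := Num.min 1 `|ilm X t - ilm Y t|.

(** The endpoint [0] is left out because the inverse lower mass may be infinite there, and [fine]
    would turn it into [0]; a single point does not change the integral. *)
Definition ilm_dist X Y : R :=
  fine (\int[lebesgue_measure]_(t in `]0%R, 1%R]) (ilm_gap X Y t)%:E)%E.

Lemma nonincreasing_measurable_in (a b : R) (f : R -> R) :
  {in `]a, b] &, nonincreasing_fun f} -> measurable_fun `]a, b] f.
Proof.
move=> f_ni mD; apply: (measurability _ (RGenCInfty.measurableE R)) => //= _ [_] [r] -> <-.
apply: is_interval_measurable => s t/= [sD fs] [tD ft] u /andP[su ut].
have uD : u \in `]a, b].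
  by move: sD tD; rewrite !in_itv/= => /andP[as_ _] /andP[_ tb]; rewrite (lt_le_trans as_)//= (le_trans ut).
split => //=; move: ft; rewrite !in_itv/= !andbT => /le_trans; apply.
exact: f_ni.
Qed.

Lemma measurable_ilm X : compact [set: X] -> measurable_fun (`]0, 1] : set R) (ilm X).
Proof.
move=> cX; apply: nonincreasing_measurable_in => s t; rewrite !in_itv/= => /andP[s0 _] _ st.
exact: ilm_anti.
Qed.

Lemma measurable_ilm_gap X Y : compact [set: X] -> compact [set: Y] ->
  measurable_fun (`]0, 1] : set R) (ilm_gap X Y).
Proof.
move=> cX cY; apply: measurable_minr; first exact: measurable_cst.
apply: measurableT_comp => //; apply: measurable_funB; exact: measurable_ilm.
Qed.

Lemma ilm_gap_ge0 X Y t : 0 <= ilm_gap X Y t.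
Proof. by rewrite /ilm_gap le_min ler01 normr_ge0. Qed.

Lemma ilm_gap_le1 X Y t : ilm_gap X Y t <= 1.
Proof. by rewrite /ilm_gap ge_min lexx. Qed.

Lemma ilm_gap_tri Y X Z t : ilm_gap X Z t <= ilm_gap X Y t + ilm_gap Y Z t.
Proof.
rewrite /ilm_gap; have := ler_distD (ilm Y t) (ilm X t) (ilm Z t).
have := normr_ge0 (ilm X t - ilm Y t); have := normr_ge0 (ilm Y t - ilm Z t).
move: `|_ - _| `|ilm X t - ilm Y t| `|ilm Y t - ilm Z t| => a b c.
by rewrite !minEle; do 3 case: ifPn; rewrite -?ltNge; lra.
Qed.

Lemma ilm_distE X Y : compact [set: X] -> compact [set: Y] ->
  (\int[lebesgue_measure]_(t in `]0%R, 1%R]) (ilm_gap X Y t)%:E)%E = (ilm_dist X Y)%:E.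
Proof.
move=> cX cY; rewrite /ilm_dist fineK// ge0_fin_numE; last first.
  by apply: integral_ge0 => t _; rewrite lee_fin ilm_gap_ge0.
apply: (@le_lt_trans _ _ (\int[lebesgue_measure]_(t in `]0%R, 1%R]) (cst 1 t))%E).
  apply: ge0_le_integral => //.
  - by move=> t _; rewrite lee_fin ilm_gap_ge0.
  - by apply/measurable_EFinP; exact: measurable_ilm_gap.
  - by move=> t _; rewrite lee_fin ilm_gap_le1.
by rewrite integral_cst//= lebesgue_measure_itv/= lte_fin ltr01 mul1e -EFinB ltry.
Qed.

Lemma ilm_dist_ge0 X Y : 0 <= ilm_dist X Y.
Proof.
by apply: fine_ge0; apply: integral_ge0 => t _; rewrite lee_fin ilm_gap_ge0.
Qed.

Lemma ilm_dist_sym X Y : ilm_dist X Y = ilm_dist Y X.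
Proof.
by rewrite /ilm_dist; congr fine; apply: eq_integral => t _; rewrite /ilm_gap distrC.
Qed.

Lemma ilm_dist_tri Y X Z : compact [set: X] -> compact [set: Y] -> compact [set: Z] ->
  ilm_dist X Z <= ilm_dist X Y + ilm_dist Y Z.
Proof.
move=> cX cY cZ; rewrite -lee_fin EFinD -!ilm_distE// -ge0_integralD//; last first.
- by apply/measurable_EFinP; exact: measurable_ilm_gap.
- by move=> t _; rewrite lee_fin ilm_gap_ge0.
- by apply/measurable_EFinP; exact: measurable_ilm_gap.
- by move=> t _; rewrite lee_fin ilm_gap_ge0.
apply: ge0_le_integral => //.
- by move=> t _; rewrite lee_fin ilm_gap_ge0.
- by apply/measurable_EFinP; exact: measurable_ilm_gap.
- by apply: emeasurable_funD; apply/measurable_EFinP; exact: measurable_ilm_gap.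
- by move=> t _; rewrite lee_fin ilm_gap_tri.
Qed.

Lemma ilm_dist_strong_equiv X Y : mm_strong_equiv X Y -> ilm_dist X Y = 0.
Proof.
move=> XY; rewrite /ilm_dist integral0_eq// => t _.
by rewrite /ilm_gap /ilm (strong_equiv_lower_mass _ XY) subrr normr0 minEle ler10.
Qed.

Lemma dsGHPE X Y : compact [set: mm_iota X] -> compact [set: mm_iota Y] ->
  dsGHP X Y = (ghp (mm_iota X) (mm_iota Y) + ilm_dist (mm_iota X) (mm_iota Y))%:E.
Proof.
move=> cX cY; rewrite /dsGHP EFinD dGHPE// -ilm_distE//; congr (_ + _)%E.
have e t : t \in `]0%R, 1%R] ->
    mine 1%E `| (lower_mass t X)^-1 - (lower_mass t Y)^-1 |%E =
    (ilm_gap (mm_iota X) (mm_iota Y) t)%:E.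
  rewrite in_itv/= => /andP[t0 _].
  rewrite -(lower_mass_iota X) -(lower_mass_iota Y) (ilmE cX t0) (ilmE cY t0).
  by rewrite -EFinB abse_EFin -EFin_min.
rewrite -integral_itv_obnd_cbnd.
  by apply: eq_integral => t; rewrite inE/= => /e.
apply: (eq_measurable_fun (fun t => (ilm_gap (mm_iota X) (mm_iota Y) t)%:E)).
  by move=> t; rewrite inE /= => /e.
by apply/measurable_EFinP; exact: measurable_ilm_gap.
Qed.

End ilm_dist.

Definition sdist (R : realType) (X Y : mmSpace R) : R := ghp X Y + ilm_dist X Y.

Section sdist.
Context (R : realType).
Implicit Types (X Y Z : mmSpace R).

Lemma sdist_sym X Y : compact [set: X] -> compact [set: Y] -> sdist X Y = sdist Y X.
Proof. by move=> cX cY; rewrite /sdist ghp_sym// ilm_dist_sym. Qed.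

Lemma sdist_tri Y X Z : compact [set: X] -> compact [set: Y] -> compact [set: Z] ->
  sdist X Z <= sdist X Y + sdist Y Z.
Proof.
move=> cX cY cZ; rewrite /sdist.
by have := ghp_tri cX cY cZ; have := ilm_dist_tri cX cY cZ; lra.
Qed.

Lemma sdist_eq0 X Y : compact [set: X] -> compact [set: Y] ->
  sdist X Y = 0 <-> mm_strong_equiv X Y.
Proof.
move=> cX cY; split=> [h|XY].
  apply/ghp_strong_equiv => //; have := ghp_ge0 X Y; have := ilm_dist_ge0 X Y.
  by move: h; rewrite /sdist; lra.
by rewrite /sdist ilm_dist_strong_equiv// addr0; apply/ghp_strong_equiv.
Qed.

Lemma strong_equiv_refl X : mm_strong_equiv X X.
Proof. by exists id; split => // y; exists y. Qed.

Lemma full_equiv_iota X : full X -> mm_strong_equiv X (mm_iota X).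
Proof.
move=> fX; apply: strong_equiv_sym.
have fi (u v : mm_iota X) : mdist (val u : X) (val v) = mdist u v by [].
exists (fun u => val u); split => //.
- move=> y; have ry : @rooted_supp R X y by have [sy|->] := fX y; [left|right].
  by exists (exist _ y (mem_set ry)).
- by move=> A mA; exact: mu_iota_preimage.
Qed.

End sdist.

Section classes.
Context (R : realType).
Implicit Types (X Y : mmSpace R) (C : Xc R).

Lemma represents_ex C : exists X, represents X C.
Proof.
case: C => C [[X CE] [Y CY cY]]; exists X; rewrite /represents /= CE /=.
exact: strong_equiv_refl.
Qed.

Lemma represents_equiv C X Y : represents X C -> represents Y C <-> mm_equiv X Y.
Proof.
case: C => C [[Z CE] ?]; rewrite /represents /= CE /= => ZX; split => h.
  exact: strong_equiv_trans (strong_equiv_sym ZX) h.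
exact: strong_equiv_trans ZX h.
Qed.

Lemma represents_inj C C' X : represents X C -> represents X C' -> C = C'.
Proof.
move=> XC XC'; apply: eq_sig_hprop; first by move=> A p q; exact: Prop_irrelevance.
apply/seteqP; split => Y YC.
  by apply/(represents_equiv Y XC')/(represents_equiv Y XC).
by apply/(represents_equiv Y XC)/(represents_equiv Y XC').
Qed.

(** The compact member of the class may be another space. Its [mm_iota] is compact, as a closed
    subspace, and the strong equivalence carries compactness over. *)
Lemma represents_compact C X : represents X C -> compact [set: mm_iota X].
Proof.
case: C => C p XC.
have [Y CY cY] := p.2.
have /(represents_equiv _ XC) XY : represents Y (exist _ C p) by [].
exact: strong_equiv_compact (strong_equiv_sym XY) (compact_iota cY).
Qed.

Lemma compact_represents X : compact [set: X] -> exists C, represents X C.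
Proof.
move=> cX; have p : (exists Y, [set Z | mm_equiv X Z] = [set Z | mm_equiv Y Z]) /\
    (exists2 Y, [set Z | mm_equiv X Z] Y & compact [set: Y]).
  by split; exists X => //; exact: strong_equiv_refl.
by exists (exist _ [set Z | mm_equiv X Z] p); exact: strong_equiv_refl.
Qed.

(** The value is defined on chosen representatives. Independence of the choice follows from triangle
    inequalities in which equivalent representatives are at distance [0]. *)
Lemma sGHP_metric_exists : exists d : metric R (Xc R),
  forall (C C' : Xc R) X X', represents X C -> represents X' C' ->
    d C C' = sdist (mm_iota X) (mm_iota X').
Proof.
have [r rP] := choice represents_ex.
have cr C := represents_compact (rP C).
pose f C C' := sdist (mm_iota (r C)) (mm_iota (r C')).
have f0 C : f C C = 0 by apply/sdist_eq0 => //; exact: strong_equiv_refl.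
have f1 C C' : f C C' = 0 -> C = C'.
  move=> /sdist_eq0 h; apply: (represents_inj (rP C)).
  apply/(represents_equiv _ (rP C')); apply: strong_equiv_sym.
  exact: (h (cr C) (cr C')).
have f2 C C' : f C C' = f C' C by exact: sdist_sym.
have f3 C' C C'' : f C C'' <= f C C' + f C' C'' by exact: sdist_tri.
exists (IsMetric f0 f1 f2 f3) => C C' X X' XC XC' /=.
have cX := represents_compact XC; have cX' := represents_compact XC'.
have /(represents_equiv _ (rP C))/(sdist_eq0 (cr C) cX) e := XC.
have /(represents_equiv _ (rP C'))/(sdist_eq0 (cr C') cX') e' := XC'.
have e1 := sdist_sym (cr C) cX; have e1' := sdist_sym (cr C') cX'.
apply/eqP; rewrite /f eq_le; apply/andP; split.
  apply: (le_trans (sdist_tri (cr C) cX (cr C'))); rewrite e add0r.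
  by apply: (le_trans (sdist_tri cX cX' (cr C'))); rewrite -e1' e' addr0.
apply: (le_trans (sdist_tri cX (cr C) cX')); rewrite -e1 e add0r.
by apply: (le_trans (sdist_tri (cr C) (cr C') cX')); rewrite e' addr0.
Qed.

End classes.

(** * Convergence of the lower masses *)

Section near_supp.
Context (R : realType).
Implicit Types (X Y : mmSpace R).

(* A ball of [X] around a support point has mass above [1 / M], so its
   [a]-fattening in [Y] cannot miss [supp Y] once [a * M < 1]. *)
Lemma near_supp X Y c a b r M s x h : mmnear (X := X) (Y := Y) c a b r ->
  compact [set: X] -> 0 < s -> 0 <= M -> ilm X s <= M -> a * M < 1 -> 0 <= a ->
  supp X x -> 0 < h -> exists2 y, supp Y y & c x y < s + a + h.
Proof.
move=> [C pl _ _ _ _] cX s0 M0 iM aM a0 sx h0.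
have := (ilm_leP cX s0 M0).1 iM x sx.
have := pl _ (mclosed_ball x s); set B := [set y | _] => p1 p2.
have : 0 < ms Y (fat c B a).
  rewrite ltNge; apply/negP => p3.
  have p4 : ms X B <= a by lra.
  have : M * ms X B <= M * a by exact: ler_wpM2l.
  by rewrite (mulrC M a); lra.
case/(ms_pos_supp (mmeas_fat C B a)) => y fy sy; exists y => //.
have [z Bz zy] := fy _ h0; have := cpl_l C z x y; move: Bz; rewrite /B /=; lra.
Qed.

(** A support point [y] of [Y] has a support point [x] of [X] within about [u + a]. The ball of
    radius [s] about [x] has mass at least the inverse of [ilm X s], and its [a]-fattening fits into
    the ball of radius [t] about [y], which therefore loses at most [a] of that mass. The conclusion
    is this bound with denominators cleared. *)
Lemma near_ilm X Y c a b r M s t u : mmnear (X := X) (Y := Y) c a b r ->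
  compact [set: X] -> compact [set: Y] -> 0 <= a -> 0 < s -> 0 < u ->
  s + u + 2 * a < t -> 0 <= M -> ilm Y u <= M -> a * M < 1 -> a * ilm X s < 1 ->
  ilm Y t * (1 - a * ilm X s) <= ilm X s.
Proof.
move=> nc cX cY a0 s0 u0 st M0 iM aM aK.
have t0 : 0 < t by lra.
set K := ilm X s in aK *; have K0 : 0 <= K by exact: ilm_ge0.
have aK0 : 0 < 1 - a * K by rewrite subr_gt0.
rewrite -ler_pdivlMr//; apply/(ilm_leP cY t0); first by rewrite divr_ge0// ltW.
move=> y sy; rewrite mulrAC ler_pdivlMr// mul1r.
set h := (t - (s + u + 2 * a)) / 3; have h0 : 0 < h by rewrite divr_gt0// subr_gt0.
have [x sx xy] := near_supp (near_sym nc) cY u0 M0 iM aM a0 sy h0.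
have := (ilm_leP cX s0 K0).1 (lexx _) x sx; rewrite -/K => K1.
have [C pl _ _ _ _] := nc.
have := pl _ (mclosed_ball x s); set B := [set _ | _] in K1 * => p1.
have p2 : ms Y (fat c B a) <= ms Y [set z | car_metric Y y z <= t].
  apply: le_ms; [exact: mmeas_fat|exact: mmeas_ball|].
  move=> z /(_ _ h0)[x' Bx' x'z] /=.
  have := cpl_dr C x y z; have := cpl_l C x' x z.
  by move: xy Bx'; rewrite /swap /B /= /h in x'z *; lra.
have : K * ms X B <= K * (ms Y [set z | car_metric Y y z <= t] + a).
  by apply: ler_wpM2l => //; lra.
by rewrite mulrDr (mulrC K a); lra.
Qed.

End near_supp.

Definition tends0 (R : realType) (u : nat -> R) : Prop :=
  forall e, 0 < e -> \forall n \near \oo, u n < e.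

Section ilm_convergence.
Context (R : realType) (X_ : nat -> mmSpace R) (X : mmSpace R).
Hypotheses (cX_ : forall n, compact [set: X_ n]) (cX : compact [set: X]).

Definition ilm_eventually_bounded : Prop :=
  forall s, 0 < s -> exists M, \forall n \near \oo, ilm (X_ n) s <= M.

(** Both functions are nonincreasing. If the bound failed, the value for [Y] at [s] would exceed the
    value for [X] at [s / 2] by more than [1], so the truncated gap would equal [1] on the whole
    interval from [s / 2] to [s], and the integral would reach [s / 2]. *)
Lemma ilm_dist_bounded (Y : mmSpace R) s : compact [set: Y] -> 0 < s -> s <= 1 ->
  ilm_dist Y X < s / 2 -> ilm Y s <= ilm X (s / 2) + 1.
Proof.
move=> cY s0 s1; apply: contraTT; rewrite -!ltNge -leNgt => h.
have s20 : 0 < s / 2 by rewrite divr_gt0.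
have ss : s / 2 < s by rewrite ltr_pdivrMr// ltr_pMr// ltr1n.
rewrite -lee_fin -ilm_distE//.
apply: (@le_trans _ _ (\int[lebesgue_measure]_(t in `](s / 2)%R, s]) (cst 1 t))%E).
  rewrite integral_cst//= lebesgue_measure_itv/= lte_fin ss mul1e -EFinB lee_fin.
  by rewrite [X in _ <= X - _](splitr s) addrK.
apply: (@le_trans _ _ (\int[lebesgue_measure]_(t in `](s / 2)%R, s]) (ilm_gap Y X t)%:E)%E).
  apply: ge0_le_integral => //.
  - apply/measurable_EFinP; apply: measurable_funS (measurable_ilm_gap cY cX) => //.
    by move=> t /=; rewrite !in_itv/= => /andP[h1 h2]; apply/andP; split; lra.
  - move=> t /=; rewrite in_itv/= => /andP[h1 h2]; rewrite lee_fin /ilm_gap le_min lexx/=.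
    have t0 := lt_trans s20 h1.
    have := ilm_anti cY t0 h2; have := ilm_anti cX s20 (ltW h1).
    by move=> h3 h4; rewrite ger0_norm; lra.
apply: ge0_subset_integral => //.
- by apply/measurable_EFinP; exact: measurable_ilm_gap.
- by move=> t _; rewrite lee_fin ilm_gap_ge0.
- by move=> t /=; rewrite !in_itv/= => /andP[h1 h2]; apply/andP; split; lra.
Qed.

Lemma ilm_dist_eventually_bounded :
  tends0 (fun n => ilm_dist (X_ n) X) -> ilm_eventually_bounded.
Proof.
move=> h s s0; pose s' := Num.min s 1.
have s'0 : 0 < s' by rewrite lt_min s0 ltr01.
have s'1 : s' <= 1 by rewrite ge_min lexx orbT.
have s's : s' <= s by rewrite ge_min lexx.
exists (ilm X (s' / 2) + 1).
have s'20 : 0 < s' / 2 by rewrite divr_gt0.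
apply: filterS (h _ s'20) => n hn.
exact: le_trans (ilm_anti (@cX_ n) s'0 s's) (ilm_dist_bounded (@cX_ n) s'0 s'1 hn).
Qed.

Hypothesis gX : tends0 (fun n => ghp (X_ n) X).
Hypothesis bX : ilm_eventually_bounded.

Lemma ilm_limsup s t e : 0 < s -> s < t -> 0 < e ->
  \forall n \near \oo, ilm (X_ n) t <= ilm X s + e.
Proof.
move=> s0 st e0; have u0 : 0 < (t - s) / 4 by rewrite divr_gt0// subr_gt0.
set u := (t - s) / 4 in u0; have [M MP] := bX u0; have [M' MP'] := bX (lt_trans s0 st).
set K := ilm X s; have K0 : 0 <= K by exact: ilm_ge0.
pose N := `|M| + `|M'| + K + 1.
have M0 := normr_ge0 M; have M'0 := normr_ge0 M'.
have N0 : 0 < N by rewrite /N; lra.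
have NM : `|M| <= N by rewrite /N; lra.
have NM' : `|M'| <= N by rewrite /N; lra.
have NK : K <= N by rewrite /N; lra.
(* One bound for each requirement: [u] makes the radii fit, [s + u + 2 * a < t], since
   [t - s = 4 * u]; the second keeps [a * N < 1]; the third bounds the final error [a * N * N] by
   [e]. *)
pose a := Num.min u (Num.min (2 * N)^-1 (e / (N * N))).
have a0 : 0 < a by rewrite !lt_min u0 invr_gt0 mulr_gt0//= divr_gt0// mulr_gt0.
have a1 : a <= u by rewrite ge_min lexx.
have a2 : a <= (2 * N)^-1 by rewrite !ge_min lexx orbT.
have a3 : a <= e / (N * N) by rewrite !ge_min lexx !orbT.
have aN : a * N < 1.
  have : a * N <= (2 * N)^-1 * N by rewrite ler_pM2r.
  by rewrite invfM -mulrA mulVf ?gt_eqF// mulr1; lra.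
have aNN : a * N * N <= e by rewrite -mulrA -ler_pdivlMr// mulr_gt0.
have aL L : L <= N -> a * L <= a * N by move=> LN; rewrite ler_pM2l.
apply: filterS3 (gX a0) MP MP' => n /ghp_near[]// c /near_sym nc Mn Mn'.
have Mn2 : ilm (X_ n) u <= `|M| by apply: le_trans Mn (ler_norm _).
have h : ilm (X_ n) t * (1 - a * ilm X s) <= ilm X s.
  apply: (near_ilm nc) u0 _ M0 Mn2 _ _ => //; first exact: ltW.
  - by rewrite /u in a1 *; lra.
  - by apply: le_lt_trans aN; apply: aL.
  - by apply: le_lt_trans aN; apply: aL.
have I0 : 0 <= ilm (X_ n) t by exact: ilm_ge0.
have IN : ilm (X_ n) t <= N by exact: le_trans (le_trans Mn' (ler_norm _)) NM'.
have : ilm (X_ n) t * (a * K) <= N * (a * N).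
  by apply: ler_pM => //; [rewrite mulr_ge0// ltW|exact: aL].
by rewrite (mulrC N (a * N)); move: h; rewrite mulrBr mulr1 -/K; lra.
Qed.

(** The two spaces exchange their roles in [near_ilm]: the auxiliary bound at radius [u] now
    concerns the fixed limit, and the eventual bound on the sequence is used at [t]. *)
Lemma ilm_liminf s t e : 0 < t -> t < s -> 0 < e ->
  \forall n \near \oo, ilm X s <= ilm (X_ n) t + e.
Proof.
move=> t0 st e0; have u0 : 0 < (s - t) / 4 by rewrite divr_gt0// subr_gt0.
set u := (s - t) / 4 in u0; have [M MP] := bX t0.
set K := ilm X s; have K0 : 0 <= K by exact: ilm_ge0.
have L0 := ilm_ge0 X u.
pose N := `|M| + K + ilm X u + 1.
have M0 := normr_ge0 M.
have N0 : 0 < N by rewrite /N; lra.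
have NM : `|M| <= N by rewrite /N; lra.
have NL : ilm X u <= N by rewrite /N; lra.
have NK : K <= N by rewrite /N; lra.
pose a := Num.min u (Num.min (2 * N)^-1 (e / (N * N))).
have a0 : 0 < a by rewrite !lt_min u0 invr_gt0 mulr_gt0//= divr_gt0// mulr_gt0.
have a1 : a <= u by rewrite ge_min lexx.
have a2 : a <= (2 * N)^-1 by rewrite !ge_min lexx orbT.
have a3 : a <= e / (N * N) by rewrite !ge_min lexx !orbT.
have aN : a * N < 1.
  have : a * N <= (2 * N)^-1 * N by rewrite ler_pM2r.
  by rewrite invfM -mulrA mulVf ?gt_eqF// mulr1; lra.
have aNN : a * N * N <= e by rewrite -mulrA -ler_pdivlMr// mulr_gt0.
have aL L : L <= N -> a * L <= a * N by move=> LN; rewrite ler_pM2l.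
apply: filterS2 (gX a0) MP => n /ghp_near[]// c nc Mn.
have Mn2 : ilm (X_ n) t <= `|M| by apply: le_trans Mn (ler_norm _).
have I0 : 0 <= ilm (X_ n) t by exact: ilm_ge0.
have h : ilm X s * (1 - a * ilm (X_ n) t) <= ilm (X_ n) t.
  apply: (near_ilm nc) u0 _ L0 (lexx _) _ _ => //; first exact: ltW.
  - by rewrite /u in a1 *; lra.
  - by apply: le_lt_trans aN; apply: aL.
  - by apply: le_lt_trans aN; apply: aL; exact: le_trans Mn2 NM.
have IN : ilm (X_ n) t <= N by exact: le_trans Mn2 NM.
have : K * (a * ilm (X_ n) t) <= N * (a * N).
  by apply: ler_pM => //; [rewrite mulr_ge0// ltW|exact: aL].
by rewrite (mulrC N (a * N)); move: h; rewrite mulrBr mulr1 -/K; lra.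
Qed.

Definition ilm_jump : set R :=
  [set t | 0 < t /\ exists2 e, 0 < e &
    forall s s', 0 < s -> s < t -> t < s' -> ilm X s' + e <= ilm X s].

(** Each jump is assigned a rational strictly between the values on its right and those on its left;
    the value at the midpoint of two jumps separates their rationals. *)
Lemma countable_ilm_jump : countable ilm_jump.
Proof.
have ex t : exists q : rat, ilm_jump t ->
    (forall s', t < s' -> ilm X s' < ratr q) /\
    (forall s, 0 < s -> s < t -> ratr q < ilm X s).
  have [[t0 [e e0 he]]|] := pselect (ilm_jump t); last by exists 0.
  pose S := [set ilm X s' | s' in [set s' | t < s']].
  have t20 : 0 < t / 2 by rewrite divr_gt0.
  have tt : t / 2 < t by rewrite ltr_pdivrMr// ltr_pMr// ltr1n.
  have hS : has_sup S.
    split; first by exists (ilm X (t + 1)), (t + 1) => //=; rewrite ltrDl.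
    exists (ilm X (t / 2)) => _ [s' ts' <-]; have := he _ _ t20 tt ts'; lra.
  have : sup S < sup S + e by rewrite ltrDl.
  move=> /rat_in_itvoo[q]; rewrite in_itv/= => /andP[q1 q2].
  exists q => _; split=> [s' ts'|s s0 st].
    by apply: le_lt_trans q1; apply: ub_le_sup hS.2 _ _; exists s'.
  apply: (lt_le_trans q2); rewrite -lerBrDr; apply: ge_sup; first exact: hS.1.
  by move=> _ [s' ts' <-]; rewrite lerBrDr; exact: he.
have [q qP] := choice ex.
apply/countable_injP; exists (fun t => choice.pickle (q t)).
have lt_q t t' : ilm_jump t -> ilm_jump t' -> t < t' -> q t != q t'.
  move=> jt jt' tt'; apply/negP => /eqP qq.
  have [/(_ ((t + t') / 2)) h1 _] := qP t jt.
  have [_ /(_ ((t + t') / 2)) h2] := qP t' jt'.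
  have m1 : t < (t + t') / 2 by rewrite midf_lt.
  have m2 : (t + t') / 2 < t' by rewrite midf_lt.
  have := h1 m1; have := h2 (lt_trans jt.1 m1) m2.
  by rewrite qq => h3 h4; have := lt_trans h3 h4; rewrite ltxx.
move=> t t' /set_mem jt /set_mem jt' /(pcan_inj choice.pickleK) qq.
have [tt'|tt'|//] := ltgtP t t'.
  by have := lt_q _ _ jt jt' tt'; rewrite qq eqxx.
by have := lt_q _ _ jt' jt tt'; rewrite qq eqxx.
Qed.

Lemma ilm_gap_cvg t : 0 < t -> ~ ilm_jump t ->
  tends0 (fun n => ilm_gap (X_ n) X t).
Proof.
move=> t0 nj e e0.
have [s [s' [s0 st ts' ss]]] : exists s s', [/\ 0 < s, s < t, t < s' &
    ilm X s < ilm X s' + e / 2].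
  apply: contrapT => h; apply: nj; split => //; exists (e / 2); first by rewrite divr_gt0.
  move=> s s' s0 st ts'; rewrite leNgt; apply/negP => ss; apply: h.
  by exists s, s'.
have e20 : 0 < e / 4 by rewrite divr_gt0.
apply: filterS2 (ilm_limsup s0 st e20) (ilm_liminf t0 ts' e20) => n h1 h2.
have := ilm_anti cX s0 (ltW st); have := ilm_anti cX t0 (ltW ts') => h3 h4.
by rewrite /ilm_gap gt_min ltr_norml; apply/orP; right; apply/andP; split; lra.
Qed.

(** Dominated convergence: the gap is at most [1] and tends to [0] off the countable set of
    jumps. *)
Lemma ilm_dist_cvg : tends0 (fun n => ilm_dist (X_ n) X).
Proof.
move=> e e0.
have mD : measurable (`]0%R, 1%R] : set R) by [].
have [|||||_ _] := @dominated_convergence _ _ R lebesgue_measure (`]0%R, 1%R] : set R) mD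
  (fun n t => (ilm_gap (X_ n) X t)%:E) (cst 0%E) (cst 1%E).
- by move=> n; apply/measurable_EFinP; exact: measurable_ilm_gap.
- exact: measurable_cst.
- exists ilm_jump; split.
  + exact: countable_measurable countable_ilm_jump.
  + exact: countable_lebesgue_measure0 countable_ilm_jump.
  move=> t /= h; apply: contrapT => nj; apply: h; rewrite in_itv/= => /andP[t0 _].
  apply: cvg_EFin; first by apply: nearW.
  apply/cvgrPdist_lt => d d0; apply: filterS (ilm_gap_cvg t0 nj d0) => n.
  by rewrite /= sub0r normrN ger0_norm// ilm_gap_ge0.
- apply/integrableP; split; first exact: measurable_cst.
  have -> : (fun x : R => `|cst 1%E x|%E) = cst 1%E :> (R -> \bar R).
    by apply/funext => x; rewrite gee0_abs.
  by rewrite integral_cst//= lebesgue_measure_itv/= lte_fin ltr01 mul1e -EFinB ltry.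
- apply: aeW => t n _ /=; rewrite lee_fin ger0_norm ?ilm_gap_ge0//.
  exact: ilm_gap_le1.
rewrite integral0 => h.
have {}h : (fun n => (ilm_dist (X_ n) X)%:E) @ \oo --> 0%E.
  by apply: cvg_trans h; apply: near_eq_cvg; apply: nearW => n /=; rewrite -ilm_distE.
have /fine_cvgP[_ /cvgrPdist_lt/(_ _ e0)] := h.
by apply: filterS => n; rewrite /= sub0r normrN ger0_norm// ilm_dist_ge0.
Qed.

Lemma sdist_cvg : tends0 (fun n => sdist (X_ n) X).
Proof.
move=> e e0; have e20 : 0 < e / 2 by rewrite divr_gt0.
by apply: filterS2 (gX e20) (ilm_dist_cvg e20) => n; rewrite /sdist; lra.
Qed.

End ilm_convergence.

(** * Gromov-Hausdorff-weak convergence *)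

Section bump.
Context (R : realType) (E : metricType R).

Lemma lipschitz_continuous (g : E -> R) (L : R) : 0 < L ->
  (forall x y, `|g x - g y| <= L * mdist x y) -> continuous g.
Proof.
move=> L0 gL x; apply/cvgrPdist_lt => e e0; apply/nbhs_mdist.
exists (e / L); first by rewrite divr_gt0.
by move=> y xy; apply: (le_lt_trans (gL x y)); rewrite mulrC -ltr_pdivlMr.
Qed.

Context (f : nat -> E) (r : R) (r0 : 0 < r).

Definition clip (s : R) : R := Num.max 0 (Num.min 1 (3 - s / r)).

(* Equal to [1] within [2 r], and to [0] beyond [3 r], of [f @` s]. *)
Definition bump (s : seq nat) (x : E) : R :=
  \big[Num.max/0]_(i <- s) clip (mdist (f i) x).

Lemma clip01 s : 0 <= clip s <= 1.
Proof. by rewrite /clip le_max lexx /= ge_max ler01 ge_min lexx. Qed.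

Lemma clamp_lip (u v w : R) : v - u <= w -> u - v <= w ->
  `|Num.max 0 (Num.min 1 (3 - u)) - Num.max 0 (Num.min 1 (3 - v))| <= w.
Proof.
move=> h1 h2; rewrite ler_norml !minEle.
repeat (case: ifPn; rewrite -?ltNge => ?); rewrite !maxEle;
  by repeat (case: ifPn; rewrite -?ltNge => ?); apply/andP; split; lra.
Qed.

Lemma clip_lip s t : `|clip s - clip t| <= r^-1 * `|s - t|.
Proof.
have e : r^-1 * `|s - t| = `|s / r - t / r|.
  by rewrite -mulrBl normrM (gtr0_norm (_ : 0 < r^-1)) ?invr_gt0// mulrC.
rewrite e /clip; move: (s / r) (t / r) => {e}u v.
by apply: clamp_lip; [rewrite distrC|]; exact: ler_norm.
Qed.

Lemma bump01 s x : 0 <= bump s x <= 1.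
Proof.
rewrite /bump; elim: s => [|i s IH]; first by rewrite big_nil lexx ler01.
rewrite big_cons; have := clip01 (mdist (f i) x); move: IH.
by rewrite maxEle; case: ifP.
Qed.

Lemma bump_lip s x y : `|bump s x - bump s y| <= r^-1 * mdist x y.
Proof.
have h0 : 0 <= r^-1 * mdist x y by rewrite mulr_ge0 ?mdist_ge0// invr_ge0 ltW.
rewrite /bump; elim: s => [|i s IH]; first by rewrite !big_nil subrr normr0.
rewrite !big_cons.
have : `|clip (mdist (f i) x) - clip (mdist (f i) y)| <= r^-1 * mdist x y.
  apply: (le_trans (clip_lip _ _)); rewrite ler_pM2l ?invr_gt0// ler_norml.
  have := metric_triangle (f i) x y; have := metric_triangle (f i) y x.
  by rewrite (metric_sym y x); lra.
move: IH; move: (_ * _) (\big[_/_]_(_ <- _) _) (\big[_/_]_(_ <- _) _) => u a b.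
move: (clip _) (clip _) => c d; rewrite !ler_norml => /andP[? ?] /andP[? ?].
by rewrite !maxEle; repeat (case: ifPn; rewrite -?ltNge => ?); apply/andP; split; lra.
Qed.

Lemma continuous_bump s : continuous (bump s).
Proof. by apply: lipschitz_continuous (bump_lip s); rewrite invr_gt0. Qed.

Lemma bump_eq1 s x i : i \in s -> mdist (f i) x <= 2 * r -> bump s x = 1.
Proof.
move=> si ix; have h : clip (mdist (f i) x) = 1.
  have : mdist (f i) x / r <= 2 by rewrite ler_pdivrMr.
  by rewrite /clip; move: (_ / r) => u; rewrite maxEle minEle; do 2 case: ifPn; rewrite -?ltNge; lra.
apply/eqP; rewrite eq_le (andP (bump01 s x)).2/=.
move: si; rewrite /bump; elim: s => // j s IH; rewrite inE big_cons le_max.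
by move=> /predU1P[<-|/IH ->]; rewrite ?h ?lexx ?orbT.
Qed.

Lemma bump_gt0 s x : 0 < bump s x -> exists2 i, i \in s & mdist (f i) x < 3 * r.
Proof.
rewrite /bump; elim: s => [|j s IH]; first by rewrite big_nil ltxx.
rewrite big_cons lt_max => /orP[h|/IH[i si ix]]; last first.
  by exists i => //; rewrite inE si orbT.
exists j; first by rewrite inE eqxx.
move: h; rewrite /clip lt_max ltxx/= lt_min ltr01/= subr_gt0 ltr_pdivrMr//.
Qed.

End bump.

Section mean.
Context (R : realType).
Implicit Types (X : mmSpace R).

Definition mean X (f : car X -> R) : R := fine (\int[mu X]_(x in setT) (f x : R)%:E)%E.

Definition mmeasf X (f : car X -> R) : Prop :=
  measurable_fun (setT : set (borelType X)) (f : borelType X -> R).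

Lemma meanE X f : mmeasf f -> (forall x, 0 <= f x <= 1) ->
  (\int[mu X]_(x in setT) (f x : R)%:E)%E = (mean f)%:E.
Proof.
move=> mf f01; rewrite /mean fineK// ge0_fin_numE; last first.
  by apply: integral_ge0 => x _; rewrite lee_fin; have /andP[] := f01 x.
apply: (@le_lt_trans _ _ (\int[mu X]_(x in setT) (cst 1 x))%E).
  apply: ge0_le_integral => //.
  - by move=> x _; rewrite lee_fin; have /andP[] := f01 x.
  - by apply/measurable_EFinP.
  - by move=> x _; rewrite lee_fin; have /andP[] := f01 x.
by rewrite integral_cst// mul1e ltey_eq fin_num_measure.
Qed.

Lemma mean_le_ms X f (A : set (car X)) : mmeasf f -> (forall x, 0 <= f x <= 1) ->
  mmeas X A -> (forall x, 0 < f x -> A x) -> mean f <= ms X A.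
Proof.
move=> mf f01 mA fA; rewrite -lee_fin -meanE// -msE//.
rewrite -[X in (_ <= mu _ X)%E]setIT -integral_indic//.
apply: ge0_le_integral => //.
- by move=> x _; rewrite lee_fin; have /andP[] := f01 x.
- by apply/measurable_EFinP.
- by apply/measurable_EFinP; exact: measurable_indic.
- move=> x _; rewrite lee_fin indicE; have [xA|xA] := boolP (x \in A).
    by have /andP[] := f01 x.
  by rewrite leNgt; apply/negP => /fA /mem_set; rewrite (negbTE xA).
Qed.

Lemma ms_le_mean X f (A : set (car X)) : mmeasf f -> (forall x, 0 <= f x <= 1) ->
  mmeas X A -> (forall x, A x -> f x = 1) -> ms X A <= mean f.
Proof.
move=> mf f01 mA fA; rewrite -lee_fin -meanE// -msE//.
rewrite -[X in (mu _ X <= _)%E]setIT -integral_indic//.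
apply: ge0_le_integral => //.
- by apply/measurable_EFinP; exact: measurable_indic.
- by apply/measurable_EFinP.
- move=> x _; rewrite lee_fin indicE; have [/set_mem/fA->//|xA] := boolP (x \in A).
  by have /andP[] := f01 x.
Qed.

Lemma isometry_mmeasf X (E : pointedMetricType R) (phi : X -> E) (f : E -> R) :
  isometric phi -> continuous f -> mmeasf (f \o phi).
Proof.
move=> ip cf; apply: measurable_fun_borel_real => x.
apply: continuous_comp; last exact: cf.
exact: isometry_continuous.
Qed.

Lemma mean_pushforward X (E : pointedMetricType R) (phi : X -> E) (f : E -> R) :
  isometric phi -> continuous f -> (forall x, 0 <= f x) ->
  (\int[pushforward (mu X) (phi : borelType X -> borelType E)]_x (f x)%:E =
   \int[mu X]_(x in setT) (f (phi x))%:E)%E.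
Proof.
move=> ip cf f0; have mp := measurable_fun_borel (isometry_continuous ip).
rewrite (ge0_integral_pushforward mp)//.
  by apply/measurable_EFinP; exact: measurable_fun_borel_real.
by move=> x _; rewrite lee_fin.
Qed.

End mean.

Section GHw_to_sdist.
Context (R : realType) (Y_ : nat -> mmSpace R) (Y : mmSpace R).
Hypotheses (cY_ : forall n, compact [set: Y_ n]) (cY : compact [set: Y]).
Hypotheses (fY_ : forall n, full (Y_ n)) (fY : full Y).
Context (E : pointedMetricType R) (phi_ : forall n, Y_ n -> E) (phi : Y -> E).
Arguments phi_ : clear implicits.
Hypotheses (ip_ : forall n, isometric (@phi_ n)) (ip : isometric phi).
Hypotheses (rp_ : forall n, @phi_ n point = point) (rp : phi point = point).
Hypothesis wc : weak_cvg
  (fun n => pushforward (mu (Y_ n)) (phi_ n : borelType (Y_ n) -> borelType E))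
  (pushforward (mu Y) (phi : borelType Y -> borelType E)).
Hypothesis hc : (hausdorff_dist (phi_ n @` supp (Y_ n)) (phi @` supp Y))
  @[n --> \oo] --> 0%E.

Let c n (u : car (Y_ n)) (v : car Y) : R := mdist (phi_ n u) (phi v).

Let cC n : coupling (car_metric (Y_ n)) (car_metric Y) (@c n).
Proof.
have i_ u u' : mdist (phi_ n u) (phi_ n u') = car_metric (Y_ n) u u' by exact: ip_.
have i v v' : mdist (phi v) (phi v') = car_metric Y v v' by exact: ip.
split; rewrite /c.
- by move=> x' x y; rewrite -i_; exact: metric_triangle.
- by move=> y' x y; rewrite -i; exact: metric_triangle.
- by move=> y x x'; rewrite -i_ (metric_sym (phi_ n x')); exact: metric_triangle.
- by move=> x y y'; rewrite -i (metric_sym _ (phi y)); exact: metric_triangle.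
Qed.

Let supp_near e : 0 < e -> \forall n \near \oo,
  (forall u, supp (Y_ n) u -> exists2 v, supp Y v & c u v < e) /\
  (forall v, supp Y v -> exists2 u, supp (Y_ n) u & c u v < e).
Proof.
move=> e0.
have nb : nbhs (0%E : \bar R) [set x | x < e%:E]%E.
  apply: open_nbhs_nbhs; split; last by rewrite /= lte_fin.
  exact: open_ereal_lt_ereal.
have H : \forall n \near \oo,
    (hausdorff_dist (phi_ n @` supp (Y_ n)) (phi @` supp Y) < e%:E)%E by exact: hc nb.
apply: filterS H => n /ereal_inf_lt[_ [e' [e'0 h1 h2] <-]].
rewrite lte_fin => e'e; have d0 : 0 < e - e' by rewrite subr_gt0.
split=> [u su|v sv].
  have /enlargeP/(_ _ d0)[_ [v sv <-] uv] := h2 (phi_ n u) (ex_intro2 _ _ u su erefl).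
  by exists v => //; rewrite /c; lra.
have /enlargeP/(_ _ d0)[_ [u su <-] uv] := h1 (phi v) (ex_intro2 _ _ v sv erefl).
by exists u => //; rewrite /c metric_sym; lra.
Qed.

Let wc_mean (f : E -> R) e : continuous f -> (forall x, 0 <= f x <= 1) -> 0 < e ->
  \forall n \near \oo, `|mean (X := Y_ n) (f \o phi_ n) - mean (X := Y) (f \o phi)| < e.
Proof.
move=> cf f01 e0; have f0 x : 0 <= f x by have /andP[] := f01 x.
have bf : exists M, forall x, `|f x| <= M.
  by exists 1 => x; rewrite ger0_norm//; have /andP[] := f01 x.
have := wc cf bf.
rewrite mean_pushforward// (meanE (isometry_mmeasf ip cf)); last by move=> x; exact: f01.
rewrite (_ : (fun n => _) = (fun n => (mean (X := Y_ n) (f \o phi_ n))%:E)); last first.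
  apply/funext => n; rewrite mean_pushforward// (meanE (isometry_mmeasf (@ip_ n) cf))//.
  by move=> x; exact: f01.
move=> /fine_cvgP[_ /cvgrPdist_lt/(_ _ e0)].
by apply: filterS => n /=; rewrite distrC.
Qed.

(** Weak convergence is not uniform over closed sets, but finitely many test functions suffice here:
    one bump for each subset [J] of a finite net of the image of [Y]. For large [n] all their means
    are close at once, and a closed set [A] is handled by the bump over the net points near [A]. *)
Let prohorov_near e : 0 < e -> \forall n \near \oo,
  (forall A, mclosed (Y_ n) A -> ms (Y_ n) A <= ms Y (fat (@c n) A e) + e) /\
  (forall A, mclosed Y A -> ms Y A <= ms (Y_ n) (fat (swap (@c n)) A e) + e).
Proof.
(* From [A] to the net it is at most [2 * r], and from the net to a point where the bump is positive
   at most [3 * r]; the sum stays below [e = 8 * r]. *)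
move=> e0; pose r := e / 8; have r0 : 0 < r by rewrite divr_gt0.
have cK : compact (phi @` [set: Y]).
  apply: continuous_compact => //; apply: continuous_subspaceT.
  exact: isometry_continuous.
have [N [f fP]] := compact_net cK r0.
pose b (J : {set 'I_N}) : E -> R := bump f r [seq val i | i <- enum J].
have bin (J : {set 'I_N}) i (iN : (i < N)%N) : Ordinal iN \in J -> i \in [seq val i | i <- enum J].
  by move=> iI; apply/mapP; exists (Ordinal iN); rewrite ?mem_enum.
have inb (J : {set 'I_N}) i : i \in [seq val i | i <- enum J] -> exists2 j : 'I_N, j \in J & i = val j.
  by move=> /mapP[j]; rewrite mem_enum => jI ->; exists j.
have b01 J x : 0 <= b J x <= 1 by exact: bump01.
have cb J : continuous (b J) by exact: continuous_bump.
have /filter_forall : forall J, \forall n \near \oo,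
    `|mean (X := Y_ n) (b J \o phi_ n) - mean (X := Y) (b J \o phi)| < r by move=> J; exact: wc_mean.
apply: filterS2 (supp_near r0) => n [h1 h2] h; split=> A cA.
(* Only the part of [A] inside the support is known to lie near the image of [Y]; the rest has no
   mass. Such a point is within [r] of a point of that image, which is within [r] of the net, hence
   [2 * r]. *)
- pose J := [set i : 'I_N | `[< exists2 a, (A `&` supp (Y_ n)) a &
    mdist (f i) (phi_ n a) < 2 * r >]]%SET.
  have mA := closed_mmeas cA.
  have cS := mclosed_supp (X := Y_ n).
  have mAS : mmeas (Y_ n) (A `&` supp (Y_ n)) by apply: mmeasI => //; exact: closed_mmeas.
  have p1 : ms (Y_ n) (A `&` supp (Y_ n)) <= mean (X := Y_ n) (b J \o phi_ n).
    apply: ms_le_mean => //; first exact: isometry_mmeasf.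
      by move=> x; exact: b01.
    move=> a [Aa sa]; have [v sv av] := h1 a sa.
    have [i iN ix] := fP (phi v) (ex_intro2 _ _ v I erefl).
    have ai : mdist (f i) (phi_ n a) < 2 * r.
      have := metric_triangle (f i) (phi v) (phi_ n a).
      by rewrite (metric_sym (phi v)); move: av; rewrite /c; lra.
    apply: (bump_eq1 r0 (i := i)); last exact: ltW.
    by apply: (bin _ _ iN); rewrite inE; apply/asboolP; exists a.
  have p2 : mean (X := Y) (b J \o phi) <= ms Y (fat (@c n) A e).
    apply: mean_le_ms; [exact: isometry_mmeasf|by move=> x; exact: b01|exact: mmeas_fat|].
    move=> v /(bump_gt0 r0)[_ /inb[i iI ->] iv] k k0.
    move: iI; rewrite inE => /asboolP[a [Aa _] ia]; exists a => //.
    have := metric_triangle (phi_ n a) (f i) (phi v); rewrite (metric_sym _ (f i)) /c.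
    by move: ia iv; rewrite /r; lra.
  have := h J; rewrite ltr_norml => /andP[]; move: p1 p2; rewrite ms_supp// /r; lra.
- pose J := [set i : 'I_N | `[< exists2 a, A a & mdist (f i) (phi a) < r >]]%SET.
  have mA := closed_mmeas cA.
  have p1 : ms Y A <= mean (X := Y) (b J \o phi).
    apply: ms_le_mean => //; first exact: isometry_mmeasf.
      by move=> x; exact: b01.
    move=> a Aa.
    have [i iN ix] := fP (phi a) (ex_intro2 _ _ a I erefl).
    apply: (bump_eq1 r0 (i := i)); last by lra.
    by apply: (bin _ _ iN); rewrite inE; apply/asboolP; exists a.
  have p2 : mean (X := Y_ n) (b J \o phi_ n) <= ms (Y_ n) (fat (swap (@c n)) A e).
    apply: mean_le_ms; [exact: isometry_mmeasf|by move=> x; exact: b01| |].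
      by apply: mmeas_fat; exact: coupling_swap.
    move=> v /(bump_gt0 r0)[_ /inb[i iI ->] iv] k k0.
    move: iI; rewrite inE => /asboolP[a Aa ia]; exists a => //.
    have := metric_triangle (phi_ n v) (f i) (phi a); rewrite (metric_sym _ (f i)) /swap /c.
    by move: ia iv; rewrite /r; lra.
  have := h J; rewrite ltr_norml => /andP[]; move: p1 p2; rewrite /r; lra.
Qed.

Lemma GHw_ghp : tends0 (fun n => ghp (Y_ n) Y).
Proof.
move=> e e0; have e40 : 0 < e / 4 by rewrite divr_gt0.
apply: filterS2 (supp_near e40) (prohorov_near e40) => n [h1 h2] [p1 p2].
have cr : c (mm_root (Y_ n)) (mm_root Y) = 0.
  have := rp_ n; have := rp; rewrite /point /= /c => -> ->.
  by rewrite mdistxx.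
have nc : mmnear (@c n) (e / 4) (e / 4) (e / 4).
  split => //.
  - move=> u k k0; have [su|->] := fY_ u.
      by have [v _ uv] := h1 u su; exists v; lra.
    by exists (mm_root Y); rewrite cr; lra.
  - move=> v k k0; have [sv|->] := fY v.
      by have [u _ uv] := h2 v sv; exists u; lra.
    by exists (mm_root (Y_ n)); rewrite cr; lra.
  - by rewrite cr ltW.
by have := near_ghp (@cY_ n) cY (ltW e40) nc; lra.
Qed.

(** For a support point [u] of [Y_ n] and a support point [v] of [Y] near it, the ball of radius
    [s / 4] about [v] is fattened into the ball of radius [s] about [u]. The Prohorov error
    satisfies [K * e <= 1 / 2], so at most half of the bound is lost: hence [2 * K]. *)
Lemma GHw_ilm_bounded : ilm_eventually_bounded Y_.
Proof.
move=> s s0; have s40 : 0 < s / 4 by rewrite divr_gt0.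
set K := ilm Y (s / 4); have K0 : 0 <= K by exact: ilm_ge0.
exists (2 * K); pose e := Num.min (s / 4) (2 * K + 1)^-1.
have K1 : 0 < 2 * K + 1 by lra.
have e0 : 0 < e by rewrite lt_min s40 invr_gt0.
have e1 : e <= s / 4 by rewrite ge_min lexx.
have e2 : e * (2 * K + 1) <= 1 by rewrite -ler_pdivlMr// mul1r ge_min lexx orbT.
apply: filterS2 (supp_near e0) (prohorov_near e0) => n [h1 _] [_ p2].
apply/(ilm_leP (@cY_ n) s0); first lra.
move=> u su; have [v sv uv] := h1 u su.
have := (ilm_leP cY s40 K0).1 (lexx _) v sv.
have := p2 _ (mclosed_ball v (s / 4)); set B := [set _ | _] => q1 q2.
have q3 : ms (Y_ n) (fat (swap (@c n)) B e) <= ms (Y_ n) [set y | car_metric (Y_ n) u y <= s].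
  apply: le_ms; [by apply: mmeas_fat; exact: coupling_swap|exact: mmeas_ball|].
  move=> w /(_ _ s40)[v' Bv' wv'] /=.
  have := cpl_dl (@cC n) v u w; have := cpl_r (@cC n) v' w v.
  move: Bv' wv'; rewrite /B /swap /= (metric_symm _ v v'); lra.
have : K * ms Y B <= K * (ms (Y_ n) [set y | car_metric (Y_ n) u y <= s] + e).
  by apply: ler_wpM2l => //; lra.
rewrite mulrDr -mulrA (mulrC K e); move: e2; rewrite mulrDr mulr1 mulrCA; lra.
Qed.

Lemma GHw_sdist : tends0 (fun n => sdist (Y_ n) Y).
Proof. by apply: sdist_cvg => //; [exact: GHw_ghp|exact: GHw_ilm_bounded]. Qed.

End GHw_to_sdist.

(** * Prohorov bounds imply weak convergence, through level sets *)

Section levels.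
Context (R : realType).

(** A discrete layer-cake formula: the number of thresholds passed by [s] is its integer part capped
    at [J]. The induction also carries the exact count [J] in the case [J <= s]. *)
Lemma sum_levels (s : R) (J : nat) : 0 <= s ->
  \sum_(j < J) (j.+1%:R <= s)%R%:R <= s /\
  (s <= J%:R -> s <= 1 + \sum_(j < J) (j.+1%:R <= s)%R%:R).
Proof.
move=> s0; have [h1 [_ h3]] : \sum_(j < J) (j.+1%:R <= s)%R%:R <= s /\
  (J%:R <= s -> \sum_(j < J) (j.+1%:R <= s)%R%:R = J%:R :> R) /\
  (s <= J%:R -> s <= 1 + \sum_(j < J) (j.+1%:R <= s)%R%:R); last by split.
elim: J => [|J [IH1 [IH2 IH3]]].
  by rewrite big_ord0; split => //; split => // h; rewrite addr0; apply: le_trans h _.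
rewrite big_ord_recr /=; have JJ : J.+1%:R = J%:R + 1 :> R by rewrite -natr1.
have [Js|sJ] := leP J.+1%:R s.
  have e : \sum_(j < J) (j.+1%:R <= s)%R%:R = J%:R :> R by apply: IH2; rewrite JJ in Js; lra.
  by rewrite e -natr1 in Js *; rewrite /=; split; [|split]; lra.
rewrite addr0; split => //; split => //.
move=> _; have [/IH3//|Js] := leP s J%:R.
by rewrite IH2 ?ltW//; rewrite JJ in sJ; lra.
Qed.

Context (X : mmSpace R) (f : car X -> R) (mf : mmeasf f).
Hypothesis f01 : forall x, 0 <= f x <= 1.

Definition level (J j : nat) : set (car X) := [set x | j.+1%:R <= J.+1%:R * f x].

Lemma mmeas_level J j : mmeas X (level J j).
Proof.
have -> : level J j = f @^-1` [set` `[j.+1%:R / J.+1%:R, +oo[].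
  by apply/funext => x; rewrite /level /preimage /= in_itv/= andbT ler_pdivrMr ?ltr0n// mulrC.
by have := mf measurableT (measurable_itv `[j.+1%:R / J.+1%:R, +oo[); rewrite setTI.
Qed.

Let lsum J x : R := J.+1%:R^-1 * \sum_(j < J.+1) \1_(level J j) x.

Let lsum_ge0 J x : 0 <= lsum J x.
Proof. by rewrite /lsum mulr_ge0 ?invr_ge0// sumr_ge0. Qed.

Let lsum_bounds J x : lsum J x <= f x <= J.+1%:R^-1 + lsum J x.
Proof.
have J0 : 0 < J.+1%:R :> R by [].
have [f0 f1] := andP (f01 x).
have s0 : 0 <= J.+1%:R * f x by rewrite mulr_ge0.
have [h1 h2] := sum_levels J.+1 s0.
have -> : lsum J x = J.+1%:R^-1 * \sum_(j < J.+1) (j.+1%:R <= J.+1%:R * f x)%R%:R.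
  by rewrite /lsum; congr (_ * _); apply: eq_bigr => j _; rewrite indicE /level mem_setE.
apply/andP; split; first by rewrite ler_pdivrMl.
rewrite -[X in X + _]mulr1 -mulrDr ler_pdivlMl//; apply: h2.
by rewrite -[X in _ <= X]mulr1 ler_pM2l.
Qed.

Let integral_lsum J : (\int[mu X]_(x in setT) (lsum J x)%:E =
  (J.+1%:R^-1 * \sum_(j < J.+1) ms X (level J j))%:E)%E.
Proof.
have ml j : measurable_fun (setT : set (borelType X)) (\1_(level J j) : borelType X -> R).
  by apply: measurable_indic; exact: mmeas_level.
rewrite /lsum; under eq_integral do rewrite EFinM -sumEFin.
rewrite ge0_integralZl_EFin//; last 2 first.
- by move=> x _; apply: sume_ge0.
- by apply: emeasurable_sum => j; apply/measurable_EFinP.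
rewrite ge0_integral_sum//; last by move=> j; apply/measurable_EFinP.
rewrite EFinM -sumEFin; congr (_ * _)%E; apply: eq_bigr => j _.
rewrite -(msE (@mmeas_level J j)) -[X in mu _ X]setIT -integral_indic//.
exact: mmeas_level.
Qed.

Let measurable_lsum J : measurable_fun (setT : set (borelType X)) (lsum J : borelType X -> R).
Proof.
apply: measurable_funM => //; apply: measurable_sum => j.
by apply: measurable_indic; exact: mmeas_level.
Qed.

Lemma mean_ge_levels J : J.+1%:R^-1 * \sum_(j < J.+1) ms X (level J j) <= mean f.
Proof.
rewrite -lee_fin -integral_lsum -meanE//; apply: ge0_le_integral => //.
- by move=> x _; rewrite lee_fin.
- by apply/measurable_EFinP; exact: measurable_lsum.
- by apply/measurable_EFinP.
- by move=> x _; rewrite lee_fin; have /andP[] := lsum_bounds J x.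
Qed.

Lemma mean_le_levels J : mean f <=
  J.+1%:R^-1 * ms X setT + J.+1%:R^-1 * \sum_(j < J.+1) ms X (level J j).
Proof.
rewrite -lee_fin EFinD -integral_lsum -meanE// EFinM -(msE mmeasT).
rewrite -(integral_cst _ measurableT) -ge0_integralD//; last 3 first.
- by move=> x _; rewrite lee_fin invr_ge0.
- by move=> x _; rewrite lee_fin.
- by apply/measurable_EFinP; exact: measurable_lsum.
apply: ge0_le_integral => //.
- by move=> x _; rewrite lee_fin; have /andP[] := f01 x.
- by apply/measurable_EFinP.
- by apply: emeasurable_funD => //; apply/measurable_EFinP; exact: measurable_lsum.
- by move=> x _; rewrite lee_fin; have /andP[] := lsum_bounds J x.
Qed.

Lemma mean_compl : mean (fun x => 1 - f x) = ms X setT - mean f.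
Proof.
apply: EFin_inj; rewrite EFinB -meanE; last 2 first.
- by apply: measurable_funB.
- by move=> x; have := f01 x; rewrite subr_ge0 gerBl => /andP[-> ->].
rewrite -meanE// -(msE mmeasT).
have if1 : (mu X).-integrable (setT : set (borelType X)) (cst 1%E).
  apply/integrableP; split; first exact: measurable_cst.
  have -> : (fun x : borelType X => `|cst 1%E x|%E) = cst 1%E :> (borelType X -> \bar R).
    by apply/funext => x; rewrite gee0_abs.
  by rewrite integral_cst// mul1e ltey_eq fin_num_measure.
under eq_integral do rewrite EFinB.
rewrite integralB//; first by rewrite integral_cst// mul1e.
apply: le_integrable if1 => //; first by apply/measurable_EFinP.
by move=> x _; rewrite /= lee_fin !ger0_norm//; have /andP[] := f01 x.
Qed.

End levels.

(** Bad pairs at smaller and smaller distance have an ultralimit in [K], where continuity would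
    fail. The second point ranges over all of [E], since the images of the approximating spaces lie
    near [K] and not in it. *)
Lemma compact_uniform (R : realType) (E : pointedMetricType R) (K : set E) (g : E -> R) e :
  compact K -> continuous g -> 0 < e -> exists2 d : R, 0 < d &
    forall k x, K k -> mdist k x < d -> `|g k - g x| < e.
Proof.
move=> cK cg e0; apply: contrapT => h.
have bad n : exists kx : E * E, [/\ K kx.1, mdist kx.1 kx.2 < n.+1%:R^-1 & e <= `|g kx.1 - g kx.2|].
  apply: contrapT => hn; apply: h; exists n.+1%:R^-1; first by rewrite invr_gt0.
  move=> k x Kk kx; rewrite ltNge; apply/negP => ge; apply: hn.
  by exists (k, x).
have [kx kxP] := choice bad.
have [U [UU fU]] := free_ultrafilter.
have [k Kk kl] := compact_ulim (x_ := fun n => (kx n).1) cK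
  (ultraW (fun n => let: And3 a _ _ := kxP n in a)).
have e20 : 0 < e / 2 by rewrite divr_gt0.
have /cvgrPdist_lt/(_ _ e20)/nbhs_mdist[d d0 dP] := cg k.
have d20 : 0 < d / 2 by rewrite divr_gt0.
have [n [/= n1 n2]] := ultra_ex2 (kl _ d20) (inv_nat_U fU d20).
have [_ n3 n4] := kxP n.
have d1 : mdist k (kx n).1 < d by apply: (lt_trans n1); rewrite ltr_pdivrMr// ltr_pMr// ltr1n.
have d2 : mdist k (kx n).2 < d.
  have := metric_triangle k (kx n).1 (kx n).2.
  by move: n3 n2; set r := n.+1%:R^-1; lra.
have := dP _ d1; have := dP _ d2; move: n4.
have := ler_distD (g k) (g (kx n).1) (g (kx n).2).
by rewrite (distrC (g (kx n).1) (g k)); lra.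
Qed.

Section prohorov_weak.
Context (R : realType) (Y_ : nat -> mmSpace R) (Y : mmSpace R) (cY : compact [set: Y]).
Context (c : forall n, car (Y_ n) -> car Y -> R) (e : nat -> R).
Hypotheses (e0 : forall n, 0 <= e n) (et : tends0 e).
Arguments c : clear implicits.
Hypothesis nc : forall n, mmnear (c n) (e n) (e n) 0.
Context (E : pointedMetricType R) (phi_ : forall n, Y_ n -> E) (phi : Y -> E).
Arguments phi_ : clear implicits.
Hypotheses (ip_ : forall n, isometric (phi_ n)) (ip : isometric phi).
Hypothesis pc : forall n u v, mdist (phi_ n u) (phi v) <= c n u v.

Lemma mass_cvg d : 0 < d -> \forall n \near \oo, `|ms (Y_ n) setT - ms Y setT| < d.
Proof.
move=> d0; apply: filterS (et d0) => n en; have nn := nc n.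
have := near_pl nn (closedT : mclosed (Y_ n) setT).
have := near_pr nn (closedT : mclosed Y setT).
have C := near_cpl nn.
have := le_ms (mmeas_fat C setT (e n)) (mmeasT (X := Y)) (@subsetT _ _).
have := le_ms (mmeas_fat (coupling_swap C) setT (e n)) (mmeasT (X := Y_ n)) (@subsetT _ _).
by rewrite ltr_norml => *; apply/andP; split; lra.
Qed.

(** Across distances below [r] the function [g] changes by less than the level height [h], so the
    fattening of level [j + 1] over [Y_ n] lies in level [j] over [Y]. Summing these mass bounds,
    shifted by one level, compares the means. *)
Let mean_limsup (g : E -> R) d : continuous g -> (forall x, 0 <= g x <= 1) -> 0 < d ->
  \forall n \near \oo, mean (X := Y_ n) (fun u => g (phi_ n u)) <=
    mean (X := Y) (fun v => g (phi v)) + d.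
Proof.
move=> cg g01 d0; set m := ms Y setT; have m0 : 0 <= m by exact: ms_ge0.
(* Two terms below [h * (m + 1) < d / 4] are lost, one to discretisation and one to the lowest
   level, and [e n < d / 4] to the Prohorov error. *)
have [J Jd] : exists J : nat, J.+1%:R^-1 < d / (4 * (m + 1)).
  by apply: inv_nat_lt; rewrite divr_gt0// mulr_gt0// ltr_wpDl.
set h := J.+1%:R^-1 in Jd; have h0 : 0 < h by rewrite invr_gt0.
have hd : h * (m + 1) < d / 4.
  rewrite -ltr_pdivlMr ?ltr_wpDl//; apply: (lt_le_trans Jd).
  by rewrite invfM mulrA.
have cK : compact (phi @` [set: Y]).
  apply: continuous_compact => //; apply: continuous_subspaceT.
  exact: isometry_continuous.
have [r r0 rP] := compact_uniform cK cg h0.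
have r20 : 0 < r / 2 by rewrite divr_gt0.
have d40 : 0 < d / 4 by rewrite divr_gt0.
apply: filterS3 (et r20) (et d40) (mass_cvg ltr01) => n en ed.
rewrite ltr_norml => /andP[_ mn].
have mg_ : mmeasf (X := Y_ n) (g \o phi_ n) := isometry_mmeasf (@ip_ n) cg.
have mg : mmeasf (X := Y) (g \o phi) := isometry_mmeasf ip cg.
have C := near_cpl (nc n).
have lev j : ms (Y_ n) (level (X := Y_ n) (fun u => g (phi_ n u)) J j.+1) <=
    ms Y (level (X := Y) (fun v => g (phi v)) J j) + e n.
  set A := level _ _ _.
  have cA : mclosed (Y_ n) A.
    have -> : A = (fun u => g (phi_ n u)) @^-1` [set x | j.+2%:R / J.+1%:R <= x].
      by apply/funext => u; rewrite /A /level /preimage /= ler_pdivrMr ?ltr0n// mulrC.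
    apply: (@preimage_closed (Y_ n) R (g \o phi_ n)); last exact: closed_ge.
    by move=> x _; apply: continuous_comp; [exact: (isometry_continuous (@ip_ n))|exact: cg].
  apply: (le_trans (near_pl (nc n) cA)); rewrite lerD2r; apply: le_ms.
  - exact: mmeas_fat.
  - exact: mmeas_level.
  - move=> v /(_ _ r20)[u Au uv].
    have d1 : mdist (phi v) (phi_ n u) < r.
      by rewrite metric_sym; apply: (le_lt_trans (pc u v)); lra.
    have := rP (phi v) (phi_ n u) (ex_intro2 _ _ v I erefl) d1.
    rewrite ltr_norml => /andP[b1 b2].
    have b3 : g (phi_ n u) <= g (phi v) + h by lra.
    move: Au; rewrite /A /level /= => Au.
    have : J.+1%:R * g (phi_ n u) <= J.+1%:R * (g (phi v) + h) by rewrite ler_pM2l// ltr0n.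
    rewrite mulrDr /h mulfV ?pnatr_eq0// => b4.
    by move: Au; rewrite -(natr1 j.+1); lra.
have u1 := mean_le_levels mg_ (fun u => g01 (phi_ n u)) J.
have u2 := mean_ge_levels mg (fun v => g01 (phi v)) J.
have s1 : \sum_(j < J.+1) ms (Y_ n) (level (X := Y_ n) (fun u => g (phi_ n u)) J j) <=
    ms (Y_ n) setT + (\sum_(j < J.+1) ms Y (level (X := Y) (fun v => g (phi v)) J j) + J.+1%:R * e n).
  (* The shift leaves the lowest level over [Y_ n] without a partner; the total mass bounds it. *)
  rewrite big_ord_recl lerD//.
    by apply: le_ms => //; [exact: mmeas_level|exact: mmeasT].
  apply: (@le_trans _ _ (\sum_(j < J) (ms Y (level (X := Y) (fun v => g (phi v)) J j) + e n))).
    by apply: ler_sum => j _; exact: lev.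
  rewrite big_split/= sumr_const card_ord big_ord_recr/=.
  have := ms_ge0 (X := Y) (level (X := Y) (fun v => g (phi v)) J J).
  have := e0 n; rewrite -[e n *+ J]mulr_natl -natr1 mulrDl mul1r.
  move: (\sum_(_ < _) _) (_ * e n) => a b; lra.
have : h * (\sum_(j < J.+1) ms (Y_ n) (level (X := Y_ n) (fun u => g (phi_ n u)) J j)) <=
  h * (ms (Y_ n) setT + (\sum_(j < J.+1) ms Y (level (X := Y) (fun v => g (phi v)) J j) + J.+1%:R * e n)).
  by rewrite ler_pM2l.
rewrite !mulrDr mulrA [h * J.+1%:R]mulVf ?pnatr_eq0// mul1r.
have : h * ms (Y_ n) setT <= h * (m + 1) by rewrite ler_pM2l// /m; lra.
move: u1 u2; rewrite -/h /comp.
move: (\sum_(_ < _) _) (\sum_(_ < _) _) => a b; lra.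
Qed.

Lemma mean_cvg (g : E -> R) d : continuous g -> (forall x, 0 <= g x <= 1) -> 0 < d ->
  \forall n \near \oo, `|mean (X := Y_ n) (fun u => g (phi_ n u)) -
    mean (X := Y) (fun v => g (phi v))| < d.
Proof.
move=> cg g01 d0; have d20 : 0 < d / 4 by rewrite divr_gt0.
have cg' : continuous (fun x => 1 - g x).
  by move=> x; apply: cvgB; [exact: cvg_cst|exact: cg].
have g01' x : 0 <= 1 - g x <= 1.
  by have := g01 x; rewrite subr_ge0 gerBl => /andP[-> ->].
apply: filterS3 (mean_limsup cg g01 d20) (mean_limsup cg' g01' d20) (mass_cvg d20) => n h1.
have mg_ : mmeasf (X := Y_ n) (g \o phi_ n) := isometry_mmeasf (@ip_ n) cg.
have mg : mmeasf (X := Y) (g \o phi) := isometry_mmeasf ip cg.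
rewrite (mean_compl mg_ (fun u => g01 (phi_ n u))) (mean_compl mg (fun u => g01 (phi u))) /comp.
by rewrite !ltr_norml => h2 /andP[h3 h4]; apply/andP; split; lra.
Qed.

End prohorov_weak.

(** * Gluing all spaces of a sequence to their limit *)

Section metric_quotient.
Context (R : realType) (T : Type) (p : T -> T -> R).
Hypotheses (p0 : forall x, p x x = 0) (ps : forall x y, p x y = p y x).
Hypothesis pt : forall y x z, p x z <= p x y + p y z.

(* Classes are predicates in [T -> Prop] rather than in [set T], whose universe
   is too large for the quotient to be the carrier of an [mmSpace]. *)
Lemma metric_quotient : exists (Q : Type) (d : metric R Q) (q : T -> Q),
  (forall x y, d (q x) (q y) = p x y) /\ forall z, exists x, q x = z.
Proof.
pose Q := {A : T -> Prop | exists x, A = (fun y => p x y = 0)}.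
pose q x : Q := exist _ (fun y => p x y = 0) (ex_intro _ x erefl).
have qs z : exists x, q x = z.
  by case: z => A [x e]; exists x; apply: eq_sig_hprop => // ? ? ?; exact: Prop_irrelevance.
have p00 x y : 0 <= p x y by have := pt y x x; rewrite p0 (ps y x); lra.
have qE x y : q x = q y <-> p x y = 0.
  split=> [/(congr1 sval)/= e|e]; first by have -> : (p x y = 0) = (p y y = 0) := congr1 (fun A => A y) e.
  apply: eq_sig_hprop => /=; first by move=> ? ? ?; exact: Prop_irrelevance.
  apply/funext => z; apply/propext; split => h; apply/eqP; rewrite eq_le p00 andbT.
    by have := pt x y z; rewrite h (ps y x) e; lra.
  by have := pt y x z; rewrite h e; lra.
have [r rP] := choice qs.
have pr x y z : q x = q y -> p x z = p y z.
  move=> /qE e; apply/eqP; rewrite eq_le; have := pt y x z; have := pt x y z.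
  by rewrite (ps y x) e => h1 h2; apply/andP; split; lra.
have d0 z : p (r z) (r z) = 0 by [].
have d1 z w : p (r z) (r w) = 0 -> z = w by move/qE; rewrite !rP.
have ds z w : p (r z) (r w) = p (r w) (r z) by [].
have dt w z v : p (r z) (r v) <= p (r z) (r w) + p (r w) (r v) by [].
exists Q, (IsMetric d0 d1 ds dt), q; split => // x y /=.
by rewrite (pr (r (q x)) x) ?rP// ps (pr (r (q y)) y) ?rP// ps.
Qed.

End metric_quotient.

(** Gromov-Hausdorff-weak convergence sends all roots to one point, so the roots have to be brought
    to distance [0]. The route through both roots is offered as an alternative to [c]; adding [e] to
    [c] pays for the original distance of the roots in those triangle inequalities that mix the two
    routes. *)
Lemma near_root_glue (R : realType) (X Y : mmSpace R) c e :
  mmnear (X := X) (Y := Y) c e e e -> 0 <= e ->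
  exists c', mmnear (X := X) (Y := Y) c' (2 * e) (2 * e) 0.
Proof.
move=> nc e0; have [C pl pr hl hr rt] := nc.
pose rX := mm_root X; pose rY := mm_root Y.
pose c' x y := Num.min (c x y + e) (car_metric X x rX + car_metric Y rY y).
have c'P x y : (c' x y = c x y + e \/ c' x y = car_metric X x rX + car_metric Y rY y) /\
    c' x y <= c x y + e /\ c' x y <= car_metric X x rX + car_metric Y rY y.
  by rewrite /c' minEle; case: ifPn; rewrite -?ltNge => h; split; [left| |right|]; split; lra.
have c'E x y M : c' x y <= M <->
    c x y + e <= M \/ car_metric X x rX + car_metric Y rY y <= M.
  rewrite /c' ge_min; split; first by move/orP.
  by move=> h; apply/orP.
have C' : coupling (car_metric X) (car_metric Y) c'.
  split.
  - move=> x' x y; apply/c'E; have [[->|->] _] := c'P x' y.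
      by left; have := cpl_l C x' x y; lra.
    by right; have := metric_tri (car_metric X) x' x rX; lra.
  - move=> y' x y; apply/c'E; have [[->|->] _] := c'P x y'.
      by left; have := cpl_r C y' x y; lra.
    by right; have := metric_tri (car_metric Y) y' rY y; lra.
  - move=> y x x'.
    have := cpl_dl C y x x'; have := cpl_dl C y x rX; have := cpl_dl C y rX x'.
    have := cpl_r C rY rX y; have := metric_tri (car_metric X) rX x x'.
    have := metric_ge0 (car_metric Y) rY y; rewrite (metric_symm _ rX x').
    by have [[->|->] _] := c'P x y; have [[->|->] _] := c'P x' y; rewrite /rX /rY in rt *; lra.
  - move=> x y y'.
    have := cpl_dr C x y y'; have := cpl_dr C x rY y'; have := cpl_dr C x y rY.
    have := cpl_l C rX x rY; have := metric_tri (car_metric Y) rY y y'.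
    have := metric_ge0 (car_metric X) x rX; rewrite (metric_symm _ y rY).
    by have [[->|->] _] := c'P x y; have [[->|->] _] := c'P x y'; rewrite /rX /rY in rt *; lra.
have cc x y : c' x y <= c x y + e by have [_ []] := c'P x y.
exists c'; split => //.
- move=> A cA; have := pl A cA.
  have : ms Y (fat c A e) <= ms Y (fat c' A (2 * e)).
    apply: le_ms; [exact: mmeas_fat|exact: mmeas_fat|].
    by move=> y fy h h0; have [a Aa ay] := fy h h0; exists a => //; have := cc a y; lra.
  lra.
- move=> A cA; have := pr A cA.
  have : ms X (fat (swap c) A e) <= ms X (fat (swap c') A (2 * e)).
    apply: le_ms; [by apply: mmeas_fat; exact: coupling_swap|
                   by apply: mmeas_fat; exact: coupling_swap|].
    by move=> y fy h h0; have [a Aa ay] := fy h h0; exists a => //; have := cc y a; rewrite /swap in ay *; lra.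
  lra.
- by move=> x h h0; have [y] := hl x h h0; exists y; have := cc x y; lra.
- by move=> y h h0; have [x] := hr y h h0; exists x; have := cc x y; lra.
- by apply/c'E; right; rewrite !metric_xx addr0.
Qed.

Section star_gluing.
Context (R : realType) (Y_ : nat -> mmSpace R) (Y : mmSpace R).
Context (c : forall n, car (Y_ n) -> car Y -> R).
Arguments c : clear implicits.
Hypothesis C : forall n, coupling (car_metric (Y_ n)) (car_metric Y) (c n).

Let T := (car Y + {n & car (Y_ n)})%type.

Let i n (x : car (Y_ n)) : T := inr (existT _ n x).

Definition glue_lip (f : T -> R) : Prop :=
  [/\ forall y y', `|f (inl y) - f (inl y')| <= car_metric Y y y',
      forall n x x', `|f (i (n := n) x) - f (i x')| <= car_metric (Y_ n) x x' &
      forall n x y, `|f (i (n := n) x) - f (inl y)| <= c n x y].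

(* Kuratowski-style gluing: the largest pseudometric for which both the metrics
   and the couplings are upper bounds, written as a supremum over test functions. *)
Definition glue_dist (s t : T) : R := sup [set `|f s - f t| | f in glue_lip].

Let b (t : T) : R := match t with
  | inl y => car_metric Y y (mm_root Y)
  | inr (existT n x) => c n x (mm_root Y) end.

Let f_b f t : glue_lip f -> `|f t - f (inl (mm_root Y))| <= b t.
Proof. by case=> h1 h2 h3; case: t => [y|[n x]] /=; [exact: h1|exact: h3]. Qed.

Let hs s t : has_sup [set `|f s - f t| | f in glue_lip].
Proof.
split.
  exists 0, (fun=> 0); last by rewrite subrr normr0.
  split=> [y y'|n x x'|n x y]; rewrite subrr normr0.
  - exact: metric_ge0.
  - exact: metric_ge0.
  - exact: cpl_ge0 (C n) _ _.
exists (b s + b t) => _ [f fg <-]; have := f_b s fg; have := f_b t fg.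
rewrite (distrC (f t)); have := ler_distD (f (inl (mm_root Y))) (f s) (f t); lra.
Qed.

Lemma glue_dist_le s t M : (forall f, glue_lip f -> `|f s - f t| <= M) -> glue_dist s t <= M.
Proof. by move=> h; apply: ge_sup; [exact: (hs s t).1|move=> _ [f /h ? <-]]. Qed.

Lemma glue_dist_ge f s t : glue_lip f -> `|f s - f t| <= glue_dist s t.
Proof. by move=> fg; apply: ub_le_sup; [exact: (hs s t).2|exists f]. Qed.

Lemma glue_dist_pseudo : [/\ forall s, glue_dist s s = 0,
  forall s t, glue_dist s t = glue_dist t s &
  forall t s u, glue_dist s u <= glue_dist s t + glue_dist t u].
Proof.
split.
- move=> s; apply/eqP; rewrite eq_le; apply/andP; split.
    by apply: glue_dist_le => f _; rewrite subrr normr0.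
  have [[w [f fg _]] _] := hs s s.
  by apply: le_trans (glue_dist_ge s s fg).
- move=> s t; congr sup; apply/seteqP; split => _ [f fg <-]; exists f => //; exact: distrC.
- move=> t s u; apply: glue_dist_le => f fg.
  by have := ler_distD (f t) (f s) (f u); have := glue_dist_ge s t fg;
    have := glue_dist_ge t u fg; lra.
Qed.

(** The upper bound is built into [glue_lip]; the lower one comes from the test function that
    measures the distance to [y] in every space. *)
Lemma glue_dist_inl y y' : glue_dist (inl y) (inl y') = car_metric Y y y'.
Proof.
apply/eqP; rewrite eq_le; apply/andP; split; first by apply: glue_dist_le => f [].
pose f t := match t with inl z => car_metric Y y z
  | inr (existT n x) => c n x y end.
have fg : glue_lip f.
  split=> [z z'|n x x'|n x z]; rewrite /f /i ler_norml.
  - have := metric_tri (car_metric Y) z y z'; have := metric_tri (car_metric Y) z' y z.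
    by rewrite (metric_symm _ z' z) => h1 h2; apply/andP; split; lra.
  - have := cpl_l (C n) x' x y; have := cpl_l (C n) x x' y.
    by rewrite (metric_symm _ x' x) => h1 h2; apply/andP; split; lra.
  - have := cpl_r (C n) z x y; have := cpl_dr (C n) x y z.
    by rewrite (metric_symm _ z y) => h1 h2; apply/andP; split; lra.
have := glue_dist_ge (inl y) (inl y') fg.
by rewrite /f metric_xx sub0r normrN ger0_norm// metric_ge0.
Qed.

Lemma glue_dist_inr n x x' : glue_dist (i (n := n) x) (i x') = car_metric (Y_ n) x x'.
Proof.
apply/eqP; rewrite eq_le; apply/andP; split; first by apply: glue_dist_le => f [].
(* Distance to [x]: in its own space, after transport along [n = m]; in any other space, by the
   infimal route through [Y]. *)
pose g m (z : car (Y_ m)) : R :=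
  if pselect (n = m) is left e then car_metric (Y_ m) (eq_rect n (fun k => car (Y_ k)) x m e) z
  else ccomp (c n) (swap (c m)) x z.
pose f (t : T) : R := match t with inl y => c n x y
  | inr (existT m z) => g m z end.
have fg : glue_lip f.
  split=> [z z'|m u u'|m u z]; rewrite /f /i.
  - have := cpl_r (C n) z x z'; have := cpl_r (C n) z' x z.
    by rewrite (metric_symm _ z' z) ler_norml => h1 h2; apply/andP; split; lra.
  - rewrite /g; case: pselect => [e|_].
      case: _ / e u u' => u u' /=.
      have := metric_tri (car_metric (Y_ n)) u x u'; have := metric_tri (car_metric (Y_ n)) u' x u.
      by rewrite (metric_symm _ u' u) ler_norml => h1 h2; apply/andP; split; lra.
    have CC := coupling_comp (mm_root Y) (C n) (coupling_swap (C m)).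
    have := cpl_r CC u x u'; have := cpl_r CC u' x u.
    by rewrite (metric_symm _ u' u) ler_norml => h1 h2; apply/andP; split; lra.
  - rewrite /g; case: pselect => [e|_].
      case: _ / e u => u /=.
      have := cpl_l (C n) u x z; have := cpl_dl (C n) z x u.
      by rewrite ler_norml => h1 h2; apply/andP; split; lra.
    rewrite ler_norml; apply/andP; split.
      rewrite lerBrDr; apply: (ccomp_ge (mm_root Y)) => y.
      by rewrite /swap; have := cpl_r (C n) y x z; have := cpl_dr (C m) u y z; lra.
    have := ccomp_le (C n) (coupling_swap (C m)) z x u; rewrite /swap; lra.
have := glue_dist_ge (i x) (i x') fg; rewrite /f /i /g.
case: pselect => [e|//]; rewrite (Prop_irrelevance e erefl) /=.
by rewrite metric_xx sub0r normrN ger0_norm// metric_ge0.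
Qed.

Lemma glue_dist_mix n x y : glue_dist (i (n := n) x) (inl y) <= c n x y.
Proof. by apply: glue_dist_le => f []. Qed.

End star_gluing.

Section sdist_to_GHw.
Context (R : realType) (X_ : nat -> mmSpace R) (X : mmSpace R).
Let Y_ n := mm_iota (X_ n).
Let Y := mm_iota X.
Hypotheses (cY_ : forall n, compact [set: Y_ n]) (cY : compact [set: Y]).
Hypothesis sY : tends0 (fun n => sdist (Y_ n) Y).

Lemma sdist_GHw : GHw_cvg X_ X.
Proof.
have gY : tends0 (fun n => ghp (Y_ n) Y).
  move=> e e0; apply: filterS (sY e0) => n; rewrite /sdist.
  by have := ilm_dist_ge0 (Y_ n) Y; lra.
have iY : tends0 (fun n => ilm_dist (Y_ n) Y).
  move=> e e0; apply: filterS (sY e0) => n; rewrite /sdist.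
  by have := ghp_ge0 (Y_ n) Y; lra.
have bY := ilm_dist_eventually_bounded cY_ cY iY.
(* The added term makes the bound strict and positive, since the infimum defining [ghp] need not be
   attained and may be [0]. *)
pose a n := ghp (Y_ n) Y + n.+1%:R^-1.
have r0 n : 0 < n.+1%:R^-1 :> R by rewrite invr_gt0.
have a0 n : 0 < a n by rewrite /a ltr_wpDl// ghp_ge0.
have exc n : exists c, mmnear (X := Y_ n) (Y := Y) c (2 * a n) (2 * a n) 0.
  have [|c nc] := @ghp_near R (Y_ n) Y (a n) (@cY_ n) cY; first by rewrite /a ltrDl.
  by apply: near_root_glue nc _; exact: ltW.
have exc' n : {c | mmnear (X := Y_ n) (Y := Y) c (2 * a n) (2 * a n) 0}.
  exact: cid (exc n).
pose c n := projT1 (exc' n).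
have nc n : mmnear (c n) (2 * a n) (2 * a n) 0 := projT2 (exc' n).
pose e n := 2 * a n.
have e0 n : 0 <= e n by rewrite /e mulr_ge0// ltW.
have et : tends0 e.
  move=> d d0; have d40 : 0 < d / 4 by rewrite divr_gt0.
  have [N Nd] := inv_nat_lt d40.
  have hN : \forall n \near \oo, (N <= n)%N by exists N.
  apply: filterS2 (gY _ d40) hN => n g1 Nn.
  have : n.+1%:R^-1 <= N.+1%:R^-1 :> R by rewrite lef_pV2 ?posrE// ler_nat.
  by move: Nd; rewrite /e /a; set u := N.+1%:R^-1; set v := n.+1%:R^-1; lra.
have C n := near_cpl (nc n).
have [p0 ps pt] := glue_dist_pseudo C.
(* Points of different spaces, the roots among them, can be at distance [0]; the common space is
   therefore a quotient. *)
have [Q [d [q [qE qs]]]] := metric_quotient p0 ps pt.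
pose rho := q (inl (mm_root Y)).
pose E := pmspace d rho.
pose phi (y : Y) : E := q (inl y).
pose phi_ n (x : Y_ n) : E := q (inr (existT (fun k => car (Y_ k)) n x)).
have ip : isometric phi by move=> x y; rewrite /mdist /= qE glue_dist_inl.
have ip_ n : isometric (@phi_ n).
  by move=> x y; rewrite /mdist /= qE glue_dist_inr.
have pc n (u : Y_ n) (v : Y) : mdist (phi_ n u) (phi v) <= c n u v.
  by rewrite /mdist /= qE; exact: glue_dist_mix.
exists E, phi_, phi; split.
- move=> n; split; first exact: ip_.
  have e1 : d (phi_ n (mm_root (Y_ n))) (phi (mm_root Y)) = 0.
    apply/eqP; rewrite eq_le metric_ge0 andbT.
    exact: (le_trans (pc n _ _) (near_root (nc n))).
  exact: metric_eq0 e1.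
- by [].
- move=> f cf [M fM]; have M0 : 0 < `|M| + 1 by rewrite ltr_wpDl.
  set B := `|M| + 1 in M0.
  have fB x : - B <= f x <= B.
    rewrite -ler_norml; apply: (le_trans (fM x)); rewrite /B.
    by have := ler_norm M; lra.
  (* Weak convergence tests all bounded continuous functions, [mean_cvg] only those with values in
     the unit interval. Since [f = 2 * B * g - B], the constant part is left to the total masses. *)
  pose g x := (f x + B) / (2 * B).
  have B20 : 0 < 2 * B by rewrite mulr_gt0.
  have g01 x : 0 <= g x <= 1.
    have /andP[f1 f2] := fB x.
    by rewrite /g divr_ge0 ?ler_pdivrMr//=; lra.
  have cg : continuous g.
    move=> x; apply: (@cvgM _ _ (nbhs x) _ (fun y => f y + B) (fun=> (2 * B)^-1)).
      by apply: (@cvgD _ _ _ (nbhs x) _ f (fun=> B)); [exact: cf|exact: cvg_cst].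
    exact: cvg_cst.
  have intf (Z : mmSpace R) (psi : Z -> E) : isometric psi ->
      (\int[pushforward (mu Z) (psi : borelType Z -> borelType E)]_x (f x)%:E =
      (2 * B * mean (X := Z) (fun z => g (psi z)) - B * ms Z setT)%:E)%E.
    move=> ipsi; have mpsi := measurable_fun_borel (isometry_continuous ipsi).
    have mg : mmeasf (X := Z) (fun z => g (psi z)) := isometry_mmeasf ipsi cg.
    have if1 : (mu Z).-integrable (setT : set (borelType Z)) (cst 1%E).
      apply/integrableP; split; first exact: measurable_cst.
      have -> : (fun x : borelType Z => `|cst 1%E x|%E) = cst 1%E :> (borelType Z -> \bar R).
        by apply/funext => x; rewrite gee0_abs.
      by rewrite integral_cst// mul1e ltey_eq fin_num_measure.
    have ig : (mu Z).-integrable (setT : set (borelType Z)) (fun z => (g (psi z))%:E).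
      apply: le_integrable if1 => //; first by apply/measurable_EFinP.
      by move=> x _; rewrite /= lee_fin !ger0_norm//; have /andP[] := g01 (psi x).
    have iB : (mu Z).-integrable (setT : set (borelType Z)) (fun z => (2 * B)%:E * (g (psi z))%:E)%E.
      exact: integrableZl.
    have iC : (mu Z).-integrable (setT : set (borelType Z)) (fun z => B%:E * cst 1%E z)%E.
      exact: integrableZl.
    have fE z : (f (psi z))%:E = ((2 * B)%:E * (g (psi z))%:E - B%:E * cst 1%E z)%E.
      rewrite -EFinM -EFinM -EFinB /g mulr1 mulrCA mulfV ?gt_eqF// mulr1.
      by congr EFin; rewrite addrK.
    rewrite (integral_pushforward mpsi) //=; last 2 first.
    - by apply/measurable_EFinP; exact: measurable_fun_borel_real.
    - rewrite (_ : _ \o _ = (fun z => (2 * B)%:E * (g (psi z))%:E - B%:E * cst 1%E z)%E).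
        exact: (integrableB measurableT iB iC).
      by apply/funext => z /=; rewrite fE.
    rewrite preimage_setT; under eq_integral do rewrite /= fE.
    rewrite integralB// !integralZl//.
    have e1 : (\int[mu Z]_(x in setT) cst 1 x = (ms Z setT)%:E)%E.
      by rewrite integral_cst// mul1e; exact: (msE (mmeasT (X := Z))).
    rewrite (meanE mg (fun z => g01 (psi z))) e1.
    by rewrite -EFinM -EFinM -EFinB.
  rewrite (intf _ phi ip) (_ : (fun n => _) = (fun n => (2 * B *
    mean (X := Y_ n) (fun z => g (phi_ n z)) - B * ms (Y_ n) setT)%:E)); last first.
    by apply/funext => n; rewrite (intf _ (phi_ n) (@ip_ n)).
  apply: cvg_EFin; first exact: nearW.
  apply/cvgrPdist_lt => t t0.
  have t20 : 0 < t / (4 * B) by rewrite divr_gt0// mulr_gt0.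
  apply: filterS2 (mean_cvg cY e0 et nc ip_ ip pc cg g01 t20) (mass_cvg et nc t20) => n.
  rewrite /= !ltr_norml !ltr_pdivlMr ?mulr_gt0// -!mulNr !ltr_pdivrMr ?mulr_gt0//.
  rewrite -/(Y_ n) -/Y.
  move: (mean _) (mean _) (ms _ _) (ms _ _) => m1 m2 m3 m4 /andP[h1 h2] /andP[h3 h4].
  by apply/andP; split; nra.
- have hK : forall t : R, 0 < t -> \forall n \near \oo,
      (hausdorff_dist (phi_ n @` iota_supp (X := X_ n)) (phi @` iota_supp (X := X)) <= t%:E)%E.
    move=> t t0; have t40 : 0 < t / 4 by rewrite divr_gt0.
    have [M MP] := bY _ t40.
    pose K := ilm Y (t / 4); have K0 : 0 <= K by exact: ilm_ge0.
    have M0 := normr_ge0 M.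
    (* This dominates the inverse lower masses of both sides at radius [t / 4], so that
       [e n * N < 1] allows [near_supp] in both directions; its radius, error and slack are at most
       [t / 4] each. *)
    pose N := `|M| + K + 1; have N0 : 0 < N by rewrite /N; lra.
    have tN : 0 < Num.min (t / 4) (2 * N)^-1 by rewrite lt_min t40 invr_gt0 mulr_gt0.
    apply: filterS2 (et _ tN) MP => n; rewrite lt_min => /andP[et1 et2] Mn.
    have eN : e n * N < 1.
      by move: et2; rewrite -[(2 * N)^-1]mul1r ltr_pdivlMr ?mulr_gt0// /N; lra.
    have eM : e n * `|M| < 1.
      by apply: le_lt_trans eN; apply: ler_wpM2l => //; rewrite /N; lra.
    have eK : e n * K < 1.
      by apply: le_lt_trans eN; apply: ler_wpM2l => //; rewrite /N; lra.
    have Mn' : ilm (Y_ n) (t / 4) <= `|M| by apply: le_trans Mn (ler_norm _).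
    apply: ereal_inf_lbound; exists t => //; split => //.
    + move=> _ [v /supp_iota sv <-]; apply/enlargeP => h h0.
      have [u su vu] := near_supp (near_sym (nc n)) cY t40 K0 (lexx _) eK (e0 n) sv t40.
      exists (phi_ n u); first by exists u => //; exact/supp_iota.
      by rewrite metric_sym; have := pc n u v; move: vu; rewrite /swap -/(e n); lra.
    + move=> _ [u /supp_iota su <-]; apply/enlargeP => h h0.
      have [v sv uv] := near_supp (nc n) (@cY_ n) t40 M0 Mn' eM (e0 n) su t40.
      exists (phi v); first by exists v => //; exact/supp_iota.
      by have := pc n u v; move: uv; rewrite -/(e n); lra.
  have h0 n : (0 <= hausdorff_dist (phi_ n @` iota_supp (X := X_ n)) (phi @` iota_supp (X := X)))%E.
    by apply: le_ereal_inf_tmp => _ [t [/ltW t0 _ _] <-]; rewrite lee_fin.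
  apply/fine_cvgP; split.
    apply: filterS (hK 1 ltr01) => n hn.
    by rewrite ge0_fin_numE//; apply: le_lt_trans hn _; rewrite ltry.
  apply/cvgrPdist_le => t t0; apply: filterS (hK t t0) => n hn /=.
  move: hn (h0 n); case: (hausdorff_dist _ _) => [r| |] //; rewrite !lee_fin => rt r1.
  by rewrite sub0r normrN ger0_norm.
Qed.

End sdist_to_GHw.

(** * Extension of contents to measures *)

Section content_extension.
Context (R : realType) (E : pointedMetricType R) (cE : compact [set: E]).
Variable l : set E -> R.
Hypothesis l_ge0 : forall K, closed K -> 0 <= l K.
Hypothesis l_mono : forall K K', closed K -> closed K' -> K `<=` K' -> l K <= l K'.
Hypothesis l_sub : forall K K', closed K -> closed K' -> l (K `|` K') <= l K + l K'.
Hypothesis l_super : forall K K', closed K -> closed K' -> K `&` K' `<=` set0 ->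
  l K + l K' <= l (K `|` K').

(** Inner content of open sets; the outer measure [m] is then its infimum over open supersets. *)
Let b (G : set E) : R := sup [set l K | K in [set K | closed K /\ K `<=` G]].

Let l0 : l set0 = 0.
Proof.
apply/eqP; rewrite eq_le l_ge0 ?andbT; last exact: closed0.
by have := l_super (@closed0 E) (@closed0 E) (fun x => @proj1 _ _); rewrite setU0; lra.
Qed.

Let b_sup G : has_sup [set l K | K in [set K | closed K /\ K `<=` G]].
Proof.
split; first by exists (l set0), set0 => //; split; [exact: closed0|exact: sub0set].
by exists (l setT) => _ [K [cK _] <-]; apply: l_mono => //; exact: closedT.
Qed.

Let b_ge K G : closed K -> K `<=` G -> l K <= b G.
Proof. by move=> cK KG; apply: ub_le_sup; [exact: (b_sup G).2|exists K]. Qed.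

Let b_le G M : (forall K, closed K -> K `<=` G -> l K <= M) -> b G <= M.
Proof. by move=> h; apply: ge_sup; [exact: (b_sup G).1|move=> _ [K [cK KG] <-]; exact: h]. Qed.

Let b_ge0 G : 0 <= b G.
Proof. by rewrite -l0; apply: b_ge; [exact: closed0|exact: sub0set]. Qed.

Let b_ex G e : 0 < e -> exists K, [/\ closed K, K `<=` G & b G - e < l K].
Proof.
move=> e0; have [_ [K [cK KG] <-] h] := sup_adherent e0 (b_sup G).
by exists K.
Qed.

Let b_sub G H : open G -> open H -> b (G `|` H) <= b G + b H.
Proof.
move=> oG oH; apply: b_le => K cK KGH.
(* A Lebesgue number of the cover of [K] by [G] and [H]: the parts of [K] at depth [d] inside [G]
   and inside [H] are closed and together exhaust [K]. *)
have [d d0 dP] : exists2 d : R, 0 < d & forall x, K x ->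
    (forall y, mdist x y < d -> G y) \/ (forall y, mdist x y < d -> H y).
  apply: contrapT => h.
  have bad n : exists x : E, K x /\ (exists y z, [/\ mdist x y < n.+1%:R^-1, ~ G y,
      mdist x z < n.+1%:R^-1 & ~ H z]).
    apply: contrapT => hn; apply: h; exists n.+1%:R^-1; first by rewrite invr_gt0.
    move=> x Kx; apply: contrapT => /not_orP[/existsNP[y /not_implyP[xy Gy]]].
    move=> /existsNP[z /not_implyP[xz Hz]]; apply: hn; exists x; split => //.
    by exists y, z.
  have [x_ xP] := choice bad.
  have [U [UU fU]] := free_ultrafilter.
  have cKc : compact K by apply: (@subclosed_compact _ K setT).
  have [x Kx xl] := compact_ulim (x_ := x_) cKc (ultraW (fun n => (xP n).1)).
  have lim (O : set E) : open O -> O x -> exists n, forall y, mdist (x_ n) y < n.+1%:R^-1 -> O y.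
    move=> /open_mdistP/[apply][[e e0 eO]]; have e20 : 0 < e / 2 by rewrite divr_gt0.
    have [n [/= n1 n2]] := ultra_ex2 (xl _ e20) (inv_nat_U fU e20).
    exists n => y ny; apply: eO; have := metric_triangle x (x_ n) y.
    by move: n1 n2 ny; set r := n.+1%:R^-1; lra.
  have [Gx|Hx] := KGH x Kx.
    by have [n nP] := lim G oG Gx; have [_ [y [z [h1 h2 _ _]]]] := xP n; apply/h2/nP.
  by have [n nP] := lim H oH Hx; have [_ [y [z [_ _ h1 h2]]]] := xP n; apply/h2/nP.
pose S (O : set E) := K `&` [set x | forall y, mdist x y < d -> O y].
have cS O : closed (S O).
  apply: closedI => //; apply/closed_mdistP => x h y xy.
  have e0 : 0 < d - mdist x y by rewrite subr_gt0.
  have [a aP xa] := h _ e0; apply: aP; have := metric_triangle a x y.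
  by rewrite (metric_sym a x); lra.
have SO O : S O `<=` O by move=> x [_]; apply; rewrite mdistxx.
have -> : K = S G `|` S H.
  by apply/seteqP; split => [x Kx|x [[]|[]]] //; have [h|h] := dP x Kx; [left|right].
by apply: (le_trans (l_sub (cS G) (cS H))); apply: lerD; apply: b_ge.
Qed.

Let b_bigsub (G : nat -> set E) n : (forall i, open (G i)) ->
  b (\bigcup_(i < n) G i) <= \sum_(i < n) b (G i).
Proof.
move=> oG; elim: n => [|n IH].
  rewrite bigcup_mkord !big_ord0; apply: b_le => K cK; rewrite subset0 => ->.
  by rewrite l0.
rewrite bigcup_mkord big_ord_recr big_ord_recr /= -bigcup_mkord.
apply: (le_trans (b_sub _ (oG n))); first exact: bigcup_open.
by rewrite lerD2r.
Qed.

Let b_cover (G : nat -> set E) K : (forall i, open (G i)) -> closed K ->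
  K `<=` \bigcup_i G i -> exists n : nat, l K <= \sum_(i < n) b (G i).
Proof.
move=> oG cK KG; have [n nP] : exists n, K `<=` \bigcup_(i < n) G i.
  apply: contrapT => h; have bad n : exists x, K x /\ ~ (\bigcup_(i < n) G i) x.
    apply: contrapT => hn; apply: h; exists n => x Kx; apply: contrapT => nx.
    by apply: hn; exists x.
  have [x_ xP] := choice bad.
  have [U [UU fU]] := free_ultrafilter.
  have cKc : compact K by apply: (@subclosed_compact _ K setT).
  have [x Kx xl] := compact_ulim (x_ := x_) cKc (ultraW (fun n => (xP n).1)).
  have [i _ Gx] := KG x Kx; have /open_mdistP/(_ x Gx)[e e0 eG] := oG i.
  have [n [/= n1 n2]] := ultra_ex2 (xl _ e0) (fU i.+1).
  by have [_ h2] := xP n; apply: h2; exists i => //; exact: eG.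
by exists n; apply: (le_trans (b_ge cK nP)); exact: b_bigsub.
Qed.

Let m (A : set E) : R := inf [set b G | G in [set G | open G /\ A `<=` G]].

Let m_inf A : has_inf [set b G | G in [set G | open G /\ A `<=` G]].
Proof.
split; first by exists (b setT), setT => //; split; [exact: openT|exact: subsetT].
by exists 0 => _ [G _ <-]; exact: b_ge0.
Qed.

Let m_le A G : open G -> A `<=` G -> m A <= b G.
Proof. by move=> oG AG; apply: ge_inf; [exact: (m_inf A).2|exists G]. Qed.

Let m_ge A M : (forall G, open G -> A `<=` G -> M <= b G) -> M <= m A.
Proof.
move=> h; apply: lb_le_inf; first exact: (m_inf A).1.
by move=> _ [G [oG AG] <-]; exact: h.
Qed.

Let m_ge0 A : 0 <= m A. Proof. by apply: m_ge => G _ _; exact: b_ge0. Qed.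

Let m_ex A e : 0 < e -> exists G, [/\ open G, A `<=` G & b G < m A + e].
Proof.
move=> e0; have [_ [G [oG AG] <-] h] := inf_adherent e0 (m_inf A).
by exists G.
Qed.

Let mE (A : set E) : \bar R := (m A)%:E.

Let mE0 : mE set0 = 0%E.
Proof.
congr EFin; apply/eqP; rewrite eq_le m_ge0 andbT.
apply: (le_trans (m_le (@open0 E) (@subset_refl _ set0))); apply: b_le => K _.
by rewrite subset0 => ->; rewrite l0.
Qed.

Let mE_ge0 A : (0 <= mE A)%E. Proof. by rewrite lee_fin. Qed.

Let mE_mono : {homo mE : A B / A `<=` B >-> (A <= B)%E}.
Proof.
move=> A B AB; rewrite lee_fin; apply: m_ge => G oG BG.
by apply: m_le => //; exact: subset_trans AB BG.
Qed.

Let mE_sub : sigma_subadditive mE.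
Proof.
move=> A; apply/lee_addgt0Pr => e e0.
have ex i : exists G, [/\ open G, A i `<=` G & b G < m (A i) + e / (2 ^ i.+1)%:R].
  by apply: m_ex; rewrite divr_gt0// ltr0n expn_gt0.
have [G GP] := choice ex.
have oG i : open (G i) by have [] := GP i.
apply: (@le_trans _ _ (b (\bigcup_i G i))%:E).
  rewrite lee_fin; apply: m_le; first exact: bigcup_open.
  by move=> x [i _ Ax]; exists i => //; have [_ AG _] := GP i; exact: AG.
apply: le_trans (epsilon_trick xpredT _ (ltW e0)) => //.
set S := (\sum_(_ <oo) _)%E.
have h K : closed K -> K `<=` \bigcup_i G i -> ((l K)%:E <= S)%E.
  move=> cK KG; have [n nP] := b_cover oG cK KG.
  apply: (@le_trans _ _ (\sum_(0 <= i < n) (mE (A i) + (e / (2 ^ i.+1)%:R)%:E))%E).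
    rewrite big_mkord /mE; under eq_bigr do rewrite -EFinD.
    rewrite sumEFin lee_fin (le_trans nP)//; apply: ler_sum => i _.
    by have [_ _ /ltW] := GP i.
  apply: nneseries_lim_ge => i _ _; apply: adde_ge0 => //.
  by rewrite lee_fin divr_ge0// ltW.
move: h; case: S => [s| |] h //; last first.
- by have := h set0 closed0 (@sub0set _ _); rewrite leeNy_eq.
- exact: leey.
by rewrite lee_fin; apply: b_le => K cK /(h K cK).
Qed.

HB.instance Definition _ := isOuterMeasure.Build R E mE mE0 mE_ge0 mE_mono mE_sub.

(** Inside an open [V] containing [A], an almost optimal closed [K] is chosen in the part of [V]
    within [G], and then an almost optimal closed [K'] in [V] minus [K]. They are disjoint, so
    superadditivity applies, and [V] minus [K] still contains [A] minus [G]. *)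
Let open_cara (G : set E) : open G -> caratheodory_measurable mE G.
Proof.
move=> oG; apply: le_caratheodory_measurable => A.
rewrite -EFinD lee_fin; apply: m_ge => V oV AV; apply/ler_addgt0Pr => e e0.
have e20 : 0 < e / 2 by rewrite divr_gt0.
have [K [cK KVG bK]] := b_ex (V `&` G) e20.
have [K' [cK' KV' bK']] := b_ex (V `\` K) e20.
have h1 : m (A `&` G) <= b (V `&` G).
  by apply: m_le; [exact: openI|exact: setSI].
have h2 : m (A `&` ~` G) <= b (V `\` K).
  apply: m_le; first by apply: openI => //; rewrite openC.
  by move=> x [/AV Vx nGx]; split => // /KVG[].
have h3 := l_super cK cK' (fun x xK => let: conj a c := xK in (KV' x c).2 a).
have h4 : l (K `|` K') <= b V.
  apply: b_ge; first exact: closedU.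
  by move=> x [/KVG[]|/KV'[]].
lra.
Qed.

Let open_borel_cara (A : set (borelType E)) : measurable A -> caratheodory_measurable mE A.
Proof.
apply: (@smallest_sub _ (sigma_algebra setT) _ (caratheodory_measurable mE)).
  split.
  - exact: caratheodory_measurable_set0.
  - by move=> B mB; rewrite setTD; exact: caratheodory_measurable_setC.
  - by move=> B mB; exact: caratheodory_measurable_bigcup.
by move=> G oG; exact: open_cara.
Qed.

Let nu (A : set (borelType E)) : \bar R := mE A.

Let nu0 : nu set0 = 0%E. Proof. exact: mE0. Qed.

Let nu_ge0 A : (0 <= nu A)%E. Proof. exact: mE_ge0. Qed.

Let nu_add : semi_sigma_additive nu.
Proof.
move=> F mF tF mUF.
apply: (@caratheodory_measure_sigma_additive R E mE F) => //.
  by move=> i; exact: open_borel_cara.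
exact: open_borel_cara.
Qed.

HB.instance Definition _ := isMeasure.Build _ _ _ nu nu0 nu_ge0 nu_add.

Let nu_fin : fin_num_fun nu.
Proof. by []. Qed.

HB.instance Definition _ := Measure_isFinite.Build _ _ _ nu nu_fin.

(** Since [l] need not be outer regular, a closed set may gain mass in the extension. An upper bound
    holds after thickening, because the open [d]-neighbourhood of [F] fits between [F] and [K]. *)
Lemma content_extension : exists nu : {finite_measure set (borelType E) -> \bar R},
  forall F, closed F -> ((l F)%:E <= nu F)%E /\
    forall K d, closed K -> 0 < d -> (forall x y, F x -> mdist x y < d -> K y) ->
      (nu F <= (l K)%:E)%E.
Proof.
exists nu => F cF; split.
  by rewrite lee_fin; apply: m_ge => G oG FG; exact: b_ge.
move=> K d cK d0 FK; rewrite lee_fin.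
pose G := \bigcup_(x in F) [set y | mdist x y < d].
have oG : open G by apply: bigcup_open => x _; exact: open_mdist_ball.
apply: (@le_trans _ _ (b G)).
  by apply: m_le => // x Fx; exists x => //=; rewrite mdistxx.
apply: b_le => K' cK' K'G; apply: l_mono => // y /K'G[x Fx /= xy].
exact: FK Fx xy.
Qed.

End content_extension.

(** * Completeness *)

Section ultrafilter_facts.
Context (R : realType) (U : set_system nat) {UU : UltraFilter U}.

Lemma ultra_lt_bigI (A : nat -> set nat) K : (forall n, (n < K)%N -> U (A n)) ->
  U [set m | forall n, (n < K)%N -> A n m].
Proof.
elim: K => [|K IH] h; first by apply: ultraW => m n.
have h1 := IH (fun n nK => h n (ltnW nK)); have h2 := h K (ltnSn K).
apply: filterS2 h1 h2 => m h1 h2 n; rewrite ltnS leq_eqVlt => /orP[/eqP->//|]; exact: h1.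
Qed.

Lemma ulim_le_const (u : nat -> R) M : ubounded u -> U [set n | u n <= M] -> ulim U u <= M.
Proof. by move=> bu h; apply: ulim_le => // e e0; apply: filterS h => n /=; lra. Qed.

(** If the inclusion failed for [U]-many [m], a choice of witnesses would be a section [y] violating
    the hypothesis. This turns facts about points of the ultraproduct into inclusions of sets in the
    factors. *)
Lemma overspill (T : nat -> Type) (t0 : forall m, T m) (A B : forall m, set (T m)) :
  (forall y : forall m, T m, U [set m | A m (y m)] -> U [set m | B m (y m)]) ->
  U [set m | A m `<=` B m].
Proof.
move=> h; have [//|/= nU] := in_ultra_setVsetC [set m | A m `<=` B m] UU.
have ex m : exists w, ~ (A m `<=` B m) -> A m w /\ ~ B m w.
  have [AB|nAB] := pselect (A m `<=` B m); first by exists (t0 m).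
  by move: (nAB) => /existsNP[w /not_implyP[Aw Bw]]; exists w.
have ex' m : {w | ~ (A m `<=` B m) -> A m w /\ ~ B m w} := cid (ex m).
pose y m := projT1 (ex' m); have yP m : ~ (A m `<=` B m) -> A m (y m) /\ ~ B m (y m) := projT2 (ex' m).
have h1 : U [set m | A m (y m)] by apply: filterS nU => m /yP[].
by have [m [/= Bm /yP[]]] := ultra_ex2 (h y h1) nU.
Qed.

End ultrafilter_facts.

Section closed_sets.
Context (R : realType) (X : mmSpace R) (A B : set (car X)).

Lemma mclosed_compact : compact [set: X] -> mclosed X A -> compact (A : set X).
Proof. by move=> cX cA; apply: (@subclosed_compact X A setT). Qed.

Lemma mclosedU : mclosed X A -> mclosed X B -> mclosed X (A `|` B).
Proof. exact: (@closedU X). Qed.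

Lemma mclosedI : mclosed X A -> mclosed X B -> mclosed X (A `&` B).
Proof. exact: (@closedI X). Qed.

End closed_sets.

Section compact_metric.
Context (R : realType) (T : Type) (d : metric R T) (x0 : T).
Hypothesis cT : compact [set: pmspace d x0].

Lemma compact_metric_complete : complete_space (mtype d).
Proof.
move=> F FF cF; pose F' : set_system (pmspace d x0) := F.
have : cvg F'.
  by apply: (@compact_cauchy_cvg (pmspace d x0) setT F') => //; exact: filterT.
by exists (lim F').
Qed.

Lemma compact_metric_separable : separable_space (mtype d).
Proof.
have net n : exists Nf : nat * (nat -> T), forall x, exists2 i, (i < Nf.1)%N & d (Nf.2 i) x < n.+1%:R^-1.
  have r0 : 0 < n.+1%:R^-1 :> R by rewrite invr_gt0.
  by have [N [f fP]] := compact_net cT r0; exists (N, f) => x; exact: fP.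
have [Nf NfP] := choice net.
exists ((fun ni : nat * nat => (Nf ni.1).2 ni.2) @` setT).
  by apply: (card_le_trans (card_image_le _ _)); exact: countableP.
move=> O [x Ox] oO.
have /open_mdistP/(_ _ Ox)[e e0 eO] : open (O : set (pmspace d x0)) := oO.
have [n ne] := inv_nat_lt e0; have [i _ ix] := NfP n x.
exists ((Nf n).2 i); split; last by exists (n, i).
by apply: eO; rewrite /mdist /= metric_symm; exact: lt_trans ix ne.
Qed.

End compact_metric.

(** * The metric ultraproduct and its Loeb measure *)

Section ultraproduct.
Context (R : realType) (U : set_system nat) {UU : UltraFilter U}.
Hypothesis fU : forall n, U [set m | (n <= m)%N].
Context (X : nat -> mmSpace R) (cX : forall n, compact [set: X n]).
Context (c : forall n m, car (X n) -> car (X m) -> R).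
Arguments c : clear implicits.
Let r n : R := n.+1%:R^-1.
Hypothesis nc : forall n m, mmnear (c n m) (r n + r m) (r n + r m) (r n + r m).

Let C n m := near_cpl (nc n m).

Let r_gt0 n : 0 < r n. Proof. by rewrite invr_gt0. Qed.

Let r_le1 n : r n <= 1. Proof. by rewrite invf_le1// ler1n. Qed.

Let rU e : 0 < e -> U [set m | r m < e]. Proof. exact: inv_nat_U. Qed.

Let bound : exists B, forall m (x y : car (X m)), car_metric (X m) x y <= B.
Proof.
have [B BP] := compact_bounded (@cX 0).
exists (2 * B + 6) => m x y.
have [a ax] := near_hr (nc 0 m) x ltr01; have [b bx] := near_hr (nc 0 m) y ltr01.
have := cpl_dr (C 0 m) a x y; have := cpl_l (C 0 m) b a y.
have := metric_tri (car_metric (X 0)) (mm_root (X 0)) a b; rewrite (metric_symm _ a (mm_root (X 0))).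
by have := BP a; have := BP b; have := r_le1 0; have := r_le1 m; lra.
Qed.

Definition uprod := forall m, car (X m).

Definition uprod_dist (x y : uprod) : R := ulim U (fun m => car_metric (X m) (x m) (y m)).

Let pb (x y : uprod) : ubounded (fun m => car_metric (X m) (x m) (y m)).
Proof.
have [B BP] := bound; exists B => m; rewrite ger0_norm ?BP//; exact: metric_ge0.
Qed.

Lemma uprod_dist_pseudo : [/\ forall x, uprod_dist x x = 0,
  forall x y, uprod_dist x y = uprod_dist y x &
  forall y x z, uprod_dist x z <= uprod_dist x y + uprod_dist y z].
Proof.
split.
- move=> x; apply: ulim_eq => // e e0; apply: ultraW => m /=.
  by rewrite metric_xx subrr normr0.
- move=> x y; apply: ulim_eq => // e e0; apply: filterS (ulimP (pb y x) e0) => m /=.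
  by rewrite metric_symm.
move=> y x z; apply: ulim_le => // e e0; have e20 : 0 < e / 2 by rewrite divr_gt0.
apply: filterS2 (ulimP (pb x y) e20) (ulimP (pb y z) e20) => m /=.
have := metric_tri (car_metric (X m)) (y m) (x m) (z m).
by rewrite !ltr_norml /uprod_dist => h /andP[_ h1] /andP[_ h2]; lra.
Qed.

Context (Q : Type) (dQ : metric R Q) (q : uprod -> Q) (s : Q -> uprod).
Hypotheses (qE : forall x y, dQ (q x) (q y) = uprod_dist x y) (sK : forall z, q (s z) = z).

Let dE z w : dQ z w = uprod_dist (s z) (s w). Proof. by rewrite -qE !sK. Qed.

(** The coupling of [X n] with the ultraproduct. Its error is of order [r n], since the share [r m]
    of the error of [c n m] vanishes along [U]. *)
Let D n (x : car (X n)) (z : Q) : R := ulim U (fun m => c n m x (s z m)).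

Arguments D : clear implicits.

Let Db n x (y : uprod) : ubounded (fun m => c n m x (y m)).
Proof.
have [B BP] := bound; exists (B + 3) => m; rewrite ger0_norm; last exact: (cpl_ge0 (C n m)).
have [a ax] := near_hr (nc n m) (y m) ltr01; have := cpl_l (C n m) a x (y m).
by have := BP n x a; have := r_le1 n; have := r_le1 m; lra.
Qed.

Arguments Db : clear implicits.

Let DE n x y : D n x (q y) = ulim U (fun m => c n m x (y m)).
Proof.
apply: ulim_eq; [exact: Db|move=> e e0]; have e20 : 0 < e / 2 by rewrite divr_gt0.
have d0 : uprod_dist (s (q y)) y < e / 2 by rewrite -qE sK metric_xx.
apply: filterS2 (ulim_lt (pb _ _) d0) (ulimP (Db n x y) e20) => m /=.
have := cpl_r (C n m) (y m) x (s (q y) m); have := cpl_r (C n m) (s (q y) m) x (y m).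
rewrite (metric_symm _ (y m)) => h1 h2 h3.
by rewrite !ltr_norml => /andP[h4 h5]; apply/andP; split; lra.
Qed.

Let D_lt n x y M : D n x (q y) < M -> U [set m | c n m x (y m) < M].
Proof. by rewrite DE; apply: ulim_lt; exact: Db. Qed.

Let D_le n x y M : (forall e, 0 < e -> U [set m | c n m x (y m) <= M + e]) -> D n x (q y) <= M.
Proof. by rewrite DE; apply: ulim_le; exact: Db. Qed.

Let CD n : coupling (car_metric (X n)) dQ (D n).
Proof.
split.
- move=> x' x z; apply: ulim_le; [exact: Db|move=> e e0].
  apply: filterS (ulimP (Db n x' (s z)) e0) => m /=.
  by rewrite ltr_norml -/(D _ _) => /andP[_]; have := cpl_l (C n m) x' x (s z m); rewrite /D; lra.
- move=> z' x z; rewrite dE; apply: ulim_le; [exact: Db|move=> e e0].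
  have e20 : 0 < e / 2 by rewrite divr_gt0.
  apply: filterS2 (ulimP (Db n x (s z')) e20) (ulimP (pb (s z') (s z)) e20) => m /=.
  rewrite !ltr_norml => /andP[_ h1] /andP[_ h2].
  by have := cpl_r (C n m) (s z' m) x (s z m); rewrite /D /uprod_dist; lra.
- move=> z x x'; apply/ler_addgt0Pr => e e0; have e20 : 0 < e / 2 by rewrite divr_gt0.
  have [m [/= + +]] := ultra_ex2 (ulimP (Db n x (s z)) e20) (ulimP (Db n x' (s z)) e20).
  rewrite !ltr_norml => /andP[_ h1] /andP[_ h2].
  by have := cpl_dl (C n m) (s z m) x x'; rewrite /D; lra.
- move=> x z z'; rewrite dE; apply: ulim_le; [exact: pb|move=> e e0].
  have e20 : 0 < e / 2 by rewrite divr_gt0.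
  apply: filterS2 (ulimP (Db n x (s z)) e20) (ulimP (Db n x (s z')) e20) => m /=.
  rewrite !ltr_norml => /andP[_ h1] /andP[_ h2].
  by have := cpl_dr (C n m) x (s z m) (s z' m); rewrite /D; lra.
Qed.

Let D_lim n (A : set (car (X n))) (x_ : nat -> car (X n)) (y : uprod) : mclosed (X n) A ->
  U [set m | A (x_ m) /\ c n m (x_ m) (y m) < r n + r m + r m] ->
  exists2 x, A x & D n x (q y) <= r n.
Proof.
move=> cA hU; have cAc := mclosed_compact (@cX n) cA.
have hA : U [set m | A (x_ m)] by apply: filterS hU => m [].
have [x Ax xl] := compact_ulim (E := X n) (x_ := x_) cAc hA.
exists x => //; apply: D_le => e e0; have e30 : 0 < e / 3 by rewrite divr_gt0.
apply: filterS3 hU (xl _ e30) (rU e30) => m /= [_ h1] h2 h3.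
by have := cpl_l (C n m) (x_ m) x (y m); rewrite /mdist /= in h2; lra.
Qed.

Let D_hl n x : exists z, D n x z <= r n.
Proof.
have ex m : {y | c n m x y < r n + r m + r m} := cid (near_hl (nc n m) x (r_gt0 m)).
pose y : uprod := fun m => projT1 (ex m).
exists (q y); apply: D_le => e e0; have e20 : 0 < e / 2 by rewrite divr_gt0.
by apply: filterS (rU e20) => m /=; have := projT2 (ex m); rewrite -/(y m); lra.
Qed.

Let D_hr n z : exists x, D n x z <= r n.
Proof.
have [x_ xP] := choice (fun m => near_hr (nc n m) (s z m) (r_gt0 m)).
have [|x _ xz] := @D_lim n setT x_ (s z) (@closedT (X n)); last by exists x; rewrite sK in xz.
by apply: ultraW => m; split => //; exact: xP.
Qed.

Let root : Q := q (fun m => mm_root (X m)).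

Let D_root n : D n (mm_root (X n)) root <= r n.
Proof.
by apply: D_le => e e0; apply: filterS (rU e0) => m /=; have := near_root (nc n m); lra.
Qed.

Let E : pointedMetricType R := pmspace dQ root.

(* Countable saturation of the ultraproduct. *)
Let saturation (x : forall n, car (X n)) :
  (forall K, exists z, forall n, (n < K)%N -> D n (x n) z < 3 * r n) ->
  exists z, forall n, D n (x n) z <= 3 * r n.
Proof.
move=> fin.
pose A m K := exists w : car (X m), forall n, (n < K)%N -> c n m (x n) w < 3 * r n.
have AU K : U [set m | A m K].
  have [z zP] := fin K; have hU n : (n < K)%N -> U [set m | c n m (x n) (s z m) < 3 * r n].
    by move=> nK; apply: D_lt; rewrite sK; exact: zP.
  by apply: filterS (ultra_lt_bigI hU) => m h; exists (s z m).
(* At index [m] a solution is taken for the largest solvable [K <= m], where [K = 0] always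
   qualifies; each fixed finite subsystem is then solved for [U]-many [m]. *)
have ex m : exists w : car (X m), forall K, (K <= m)%N -> A m K ->
    forall n, (n < K)%N -> c n m (x n) w < 3 * r n.
  have A0 : exists K, (K <= m)%N && `[< A m K >].
    by exists 0%N => /=; apply/asboolP; exists (mm_root (X m)).
  have Am K : (K <= m)%N && `[< A m K >] -> (K <= m)%N by case/andP.
  case: (ex_maxnP A0 Am) => K /andP[_ /asboolP[w wP]] max.
  exists w => K' K'm AK' n nK'; apply: wP; apply: leq_trans nK' (max K' _).
  by rewrite K'm; apply/asboolP.
have ex' m := cid (ex m).
pose W : uprod := fun m => projT1 (ex' m).
exists (q W) => n; apply: D_le => e e0.
apply: filterS2 (AU n.+1) (fU n.+1) => m /= Am nm; apply/ltW.
by have := projT2 (ex' m) n.+1 nm Am n (ltnSn n); rewrite -/(W m); lra.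
Qed.

(** The images of an ultrafilter [V] in the compact spaces [X n] converge to points [x n]. Finitely
    many of the conditions [D n (x n) z < 3 * r n] hold together by the filter property, so
    saturation yields one [z] for all of them, up to equality; it is within [6 * r n] of [V]-many
    points, for every [n]. *)
Lemma uprod_compact : compact [set: E].
Proof.
rewrite compact_ultra => V VV _.
have ex n : exists x, V [set z | D n x z < 3 * r n].
  have [g gP] := choice (D_hr n).
  have [x [_ xcl]] := @cX n (g @ V) _ filterT.
  exists x; have h : V [set z | car_metric (X n) x (g z) < r n].
    have [//|nV] := in_ultra_setVsetC [set z | car_metric (X n) x (g z) < r n] VV.
    have nb : nbhs (x : X n) [set y | mdist (x : X n) y < r n].
      by apply/nbhs_mdist; exists (r n).
    by have [y [ny /= yx]] := xcl (~` [set y | mdist (x : X n) y < r n]) _ nV nb.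
  apply: filterS h => z /= xz; have := cpl_l (CD n) (g z) x z; have := gP z.
  by have := r_gt0 n; lra.
have ex' n := cid (ex n); pose x n := projT1 (ex' n).
have xV n : V [set z | D n (x n) z < 3 * r n] := projT2 (ex' n).
have [K|z zP] := @saturation x.
  suff /filter_ex[z zP] : V [set z | forall n, (n < K)%N -> D n (x n) z < 3 * r n] by exists z.
  elim: K => [|K IH]; first by apply: filterS filterT => z _ n.
  apply: filterS2 IH (xV K) => z h1 h2 n.
  by rewrite ltnS leq_eqVlt => /orP[/eqP->//|]; exact: h1.
exists z; split => // B /nbhs_mdist[e e0 eB].
have [n ne] : exists n, r n < e / 6 by apply: inv_nat_lt; rewrite divr_gt0.
apply: filterS (xV n) => w /= wP; apply: eB; rewrite /mdist /=.
by have := cpl_dr (CD n) (x n) z w; have := zP n; rewrite /= in wP *; lra.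
Qed.

Let internal (K : set Q) (B : forall m, set (car (X m))) :=
  (forall m, mclosed (X m) (B m)) /\ forall y, K (q y) -> U [set m | B m (y m)].

Let v (B : forall m, set (car (X m))) : R := ulim U (fun m => ms (X m) (B m)).

Let vb B : (forall m, mclosed (X m) (B m)) -> ubounded (fun m => ms (X m) (B m)).
Proof.
move=> cB; exists (ms (X 0) setT + 2) => m; rewrite ger0_norm ?ms_ge0//.
apply: (@le_trans _ _ (ms (X m) setT)).
  by apply: le_ms; [exact: closed_mmeas|exact: mmeasT|].
have := near_pr (nc 0 m) (@closedT (X m)).
have := le_ms (mmeas_fat (coupling_swap (C 0 m)) setT (r 0 + r m)) (mmeasT (X := X 0)) (@subsetT _ _).
by have := r_le1 0; have := r_le1 m; lra.
Qed.

(* The outer Loeb measure, restricted to closed internal sets. *)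
Let l (K : set E) : R := inf [set v B | B in internal K].

Let l_inf K : has_inf [set v B | B in internal K].
Proof.
split.
  exists (v (fun=> setT)), (fun=> setT) => //; split => [m|y _]; first exact: (@closedT (X m)).
  exact: ultraW.
exists 0 => _ [B [cB _] <-]; apply: ulim_ge; first exact: vb.
by move=> e /ltW e0; apply: ultraW => m /=; rewrite addr_ge0// ms_ge0.
Qed.

Let l_le K B : internal K B -> l K <= v B.
Proof. by move=> iB; apply: ge_inf; [exact: (l_inf K).2|exists B]. Qed.

Let l_ge K M : (forall B, internal K B -> M <= v B) -> M <= l K.
Proof. by move=> h; apply: lb_le_inf; [exact: (l_inf K).1|move=> _ [B /h ? <-]]. Qed.

Let l_ex K e : 0 < e -> exists2 B, internal K B & v B < l K + e.
Proof. by move=> e0; have [_ [B iB <-] h] := inf_adherent e0 (l_inf K); exists B. Qed.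

(** Approximates [K] at scale [n] inside [X n]; fattening the trace into all the [X m] gives an
    internal closed cover of [K]. *)
Let trace n (K : set Q) : set (car (X n)) := [set x | exists2 z, K z & D n x z <= r n].

Arguments trace : clear implicits.

Let internal_fat n K : internal K (fun m => fat (c n m) (trace n K) (2 * r n)).
Proof.
split=> [m|y Ky]; first by apply: mclosed_fat; exact: C.
have [x xy] := D_hr n (q y).
have xy' : D n x (q y) < 2 * r n by have := r_gt0 n; lra.
apply: filterS (D_lt xy') => m /= xm h h0.
by exists x; [exists (q y)|lra].
Qed.

Let l_sub K K' : closed K -> closed K' -> l (K `|` K') <= l K + l K'.
Proof.
move=> _ _; apply/ler_addgt0Pr => e e0; have e40 : 0 < e / 4 by rewrite divr_gt0.
have [B [cB iB] vB] := l_ex K e40; have [B' [cB' iB'] vB'] := l_ex K' e40.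
have cBB m : mclosed (X m) (B m `|` B' m) by exact: mclosedU (cB m) (cB' m).
have := l_le (K := K `|` K') (B := fun m => B m `|` B' m).
suff : v (fun m => B m `|` B' m) <= v B + v B' + e / 2.
  move=> h1 h2; have : internal (K `|` K') (fun m => B m `|` B' m).
    split=> // y [/iB|/iB'] h; apply: filterS h => m; [by left|by right].
  by move/h2; lra.
apply: ulim_le_const; first exact: vb.
apply: filterS2 (ulimP (vb cB) e40) (ulimP (vb cB') e40) => m /=.
rewrite !ltr_norml => /andP[_ h1] /andP[_ h2].
by have := msU (closed_mmeas (cB m)) (closed_mmeas (cB' m)); rewrite /v; lra.
Qed.

Let separated (K K' : set E) : closed K -> closed K' -> K `&` K' `<=` set0 ->
  exists n, forall z z', K z -> K' z' -> 7 * r n <= dQ z z'.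
Proof.
move=> cK cK' KK'; apply: contrapT => h.
have bad n : exists zz : E * E, [/\ K zz.1, K' zz.2 & dQ zz.1 zz.2 < 7 * r n].
  apply: contrapT => hn; apply: h; exists n => z z' Kz Kz'; rewrite leNgt; apply/negP => zz.
  by apply: hn; exists (z, z').
have [w wP] := choice bad.
have cKc : compact K by apply: (@subclosed_compact _ K setT) => //; exact: uprod_compact.
have [z Kz zl] := compact_ulim (x_ := fun n => (w n).1) cKc
  (ultraW (fun n => let: And3 a _ _ := wP n in a)).
apply: (KK' z); split => //; apply: (closed_mdistP K').1 => // e e0.
have e20 : 0 < e / 14 by rewrite divr_gt0.
have [n [/= h1 h2]] := ultra_ex2 (zl _ e20) (rU e20).
have [_ k1 k2] := wP n; exists (w n).2 => //.
by have := metric_triangle z (w n).1 (w n).2; rewrite /mdist /= in h1 *; lra.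
Qed.

(** Any cover [B] of the union is cut by the fattened traces of [K] and of [K']. A common point
    would bring [K] and [K'] within [2 * (2 + 1) * r n] of each other, up to slack, while
    [separated] keeps them [7 * r n] apart. *)
Let l_super K K' : closed K -> closed K' -> K `&` K' `<=` set0 -> l K + l K' <= l (K `|` K').
Proof.
move=> cK cK' KK'; have [n sep] := separated cK cK' KK'.
have n0 := r_gt0 n.
apply: l_ge => B [cB iB].
pose F L m := B m `&` fat (c n m) (trace n L) (2 * r n).
have cF L m : mclosed (X m) (F L m).
  exact: mclosedI (cB m) ((internal_fat n L).1 m).
have iF L : L `<=` K `|` K' -> internal L (F L).
  move=> LK; split => // y Ly.
  by apply: filterS2 (iB y (LK _ Ly)) ((internal_fat n L).2 y Ly) => m; split.
have F0 m : F K m `&` F K' m = set0.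
  rewrite -subset0 => w [[_ h1] [_ h2]]; have n40 : 0 < r n / 4 by rewrite divr_gt0.
  have [x [z Kz xz] xw] := h1 _ n40; have [x' [z' Kz' xz'] xw'] := h2 _ n40.
  have := sep z z' Kz Kz'; have := cpl_dl (C n m) w x x'.
  by have := cpl_dr (CD n) x z z'; have := cpl_l (CD n) x' x z'; lra.
have h1 := l_le (iF K (@subsetUl _ _ _)); have h2 := l_le (iF K' (@subsetUr _ _ _)).
suff : v (F K) + v (F K') <= v B by lra.
apply: ulim_ge; [exact: vb|move=> e e0]; have e20 : 0 < e / 2 by rewrite divr_gt0.
apply: filterS2 (ulimP (vb (cF K)) e20) (ulimP (vb (cF K')) e20) => m /=.
rewrite !ltr_norml => /andP[h3 _] /andP[h4 _].
have := msDU (closed_mmeas (cF K m)) (closed_mmeas (cF K' m)) (F0 m).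
have : ms (X m) (F K m `|` F K' m) <= ms (X m) (B m).
  apply: le_ms; last by move=> w [[]|[]].
    by apply: mmeasU; exact: closed_mmeas.
  exact: closed_mmeas.
by rewrite /v; lra.
Qed.

Let l_ge0 K : closed K -> 0 <= l K.
Proof.
move=> _; apply: l_ge => B [cB _]; apply: ulim_ge; first exact: vb.
by move=> e /ltW e0; apply: ultraW => m /=; rewrite addr_ge0// ms_ge0.
Qed.

Let l_mono K K' : closed K -> closed K' -> K `<=` K' -> l K <= l K'.
Proof.
move=> _ _ KK'; apply: l_ge => B [cB iB]; apply: l_le; split => // y /KK'; exact: iB.
Qed.

(** The constant [6] comes from pulling masses back from [Z] to [X n]: [2 * r n] for the error of
    [c n m], [2 * r n] for the fattening of the trace, [r n] for the trace itself and [r n] for the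
    thickening asked by [content_extension]. *)
Lemma uprod_near : exists Z : mmSpace R, [/\ compact [set: Z],
  forall n, exists c', mmnear (X := X n) (Y := Z) c' (6 * r n) (6 * r n) (6 * r n) &
  (forall n, full (X n)) -> ilm_eventually_bounded X -> full Z].
Proof.
have [nu nuP] := content_extension uprod_compact l_ge0 l_mono l_sub l_super.
pose Z := MMSpace (compact_metric_complete uprod_compact)
  (compact_metric_separable uprod_compact) nu.
have lZ F : mclosed Z F -> l F <= ms Z F.
  move=> cF; have [h _] := nuP F cF.
  by have := msE (closed_mmeas cF); rewrite /mu /= => e; rewrite e lee_fin in h.
have Zl F K d : mclosed Z F -> mclosed Z K -> 0 < d ->
    (forall x y, F x -> dQ x y < d -> K y) -> ms Z F <= l K.
  move=> cF cK d0 FK; have [_ /(_ K d cK d0 FK) h] := nuP F cF.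
  by have := msE (closed_mmeas cF); rewrite /mu /= => e; rewrite e lee_fin in h.
exists Z; split.
- exact: uprod_compact.
- move=> n; exists (D n); have n0 := r_gt0 n; split.
  + exact: CD.
  + move=> A cA; pose F := fat (D n) A (r n).
    have cF : mclosed Z F := @mclosed_fat R (X n) Z _ (CD n) A (r n).
    have h1 : ms Z F <= ms Z (fat (D n) A (6 * r n)).
      apply: le_ms; [exact: closed_mmeas|exact: (@mmeas_fat R (X n) Z _ (CD n))|].
      by move=> z Fz h h0; have [a Aa az] := Fz h h0; exists a => //; lra.
    have h2 := lZ F cF.
    suff : ms (X n) A - r n <= l F by lra.
    apply: l_ge => B [cB iB].
    (* By overspill only sections [y] have to be considered. For these [D_lim] finds a point of [A]
       within [r n] of [q y], so [q y] lies in [F] and is covered by [B]. *)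
    have ov : U [set m | fat (c n m) A (r n + r m) `<=` B m].
      apply: (overspill (fun m => mm_root (X m))) => y yU; apply: iB.
      have ex m : exists x, fat (c n m) A (r n + r m) (y m) ->
          A x /\ c n m x (y m) < r n + r m + r m.
        have [/(_ _ (r_gt0 m))[x Ax xy]|h] := pselect (fat (c n m) A (r n + r m) (y m)).
          by exists x.
        by exists (mm_root (X n)) => /h.
      have [x_ xP] := choice ex.
      have [|x Ax xy] := D_lim (x_ := x_) (y := y) cA.
        by apply: filterS yU => m /= /xP.
      by move=> h h0; exists x => //; lra.
    apply: ulim_ge; [exact: vb|move=> e e0].
    apply: filterS2 ov (rU e0) => m /= Bm rm; have := near_pl (nc n m) cA.
    have := le_ms (mmeas_fat (C n m) A (r n + r m)) (closed_mmeas (cB m)) Bm; lra.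
  + move=> F cF; pose K : set Q := fat dQ F (r n).
    have CQ : coupling dQ dQ dQ.
      split=> [x' x y|y' x y|y x x'|x y y'].
      - exact: metric_tri.
      - exact: metric_tri.
      - by rewrite (metric_symm _ x' y); exact: metric_tri.
      - by rewrite (metric_symm _ x y); exact: metric_tri.
    have cK : mclosed Z K := @mclosed_fat R Z Z _ CQ F (r n).
    have h1 : ms Z F <= l K.
      by apply: (Zl F K (r n)) => // x y Fx xy h h0; exists x => //; lra.
    have h2 := l_le (internal_fat n K).
    suff : v (fun m => fat (c n m) (trace n K) (2 * r n)) <=
      ms (X n) (fat (swap (D n)) F (6 * r n)) + 2 * r n by lra.
    apply: ulim_le_const; first by apply: vb; exact: (internal_fat n K).1.
    apply: filterS (rU n0) => m /= rm.
    have := near_pr (nc n m) ((internal_fat n K).1 m).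
    set A := fat (swap (c n m)) _ _.
    suff : ms (X n) A <= ms (X n) (fat (swap (D n)) F (6 * r n)) by lra.
    apply: le_ms.
    * by apply: mmeas_fat; exact: coupling_swap.
    * by apply: (@mmeas_fat R Z (X n)); exact: coupling_swap (CD n).
    * move=> x Ax h h0; have h40 : 0 < h / 8 by rewrite divr_gt0.
      have [w wF xw] := Ax _ h40; have [a [z Kz az] aw] := wF _ h40.
      have [f Ff fz] := Kz _ h40; exists f => //; rewrite /swap in xw *.
      have := cpl_dl (C n m) w x a; have := cpl_l (CD n) a x z.
      by have := cpl_r (CD n) z x f; rewrite (metric_symm _ z f); lra.
  + by move=> x h h0; have [z xz] := D_hl x; exists z; lra.
  + by move=> z h h0; have [x xz] := D_hr n z; exists x; lra.
  + by have := D_root n; rewrite /=; lra.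
(* Away from the root, the representative of [z] is off the roots for [U]-many [m], hence in the
   supports, where balls of radius [e / 4] have mass at least [1 / M']. Every internal cover of the
   ball about [z] contains these balls, so the mass persists in the limit. *)
- move=> fX bX z; have [->|zr] := pselect (z = root); [by right|left].
  apply/(@suppP _ Z) => e e0; have e40 : 0 < e / 4 by rewrite divr_gt0.
  have [M [N _ MP]] := bX _ e40; have M0 := normr_ge0 M.
  pose M' := `|M| + 1; have M'0 : 0 < M' by rewrite /M'; lra.
  pose F : set Q := [set w | dQ z w <= e].
  have cF : mclosed Z F := @mclosed_ball R Z z e.
  apply: (lt_le_trans _ (lZ F cF)); apply: (@lt_le_trans _ _ M'^-1); first by rewrite invr_gt0.
  apply: l_ge => B [cB iB].
  have ov : U [set m | [set w | car_metric (X m) (s z m) w <= e / 4] `<=` B m].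
    apply: (overspill (fun m => mm_root (X m))) => y yU; apply: iB.
    rewrite /F /= -{1}(sK z) qE; apply: ulim_le_const; first exact: pb.
    by apply: filterS yU => m /=; lra.
  have zU : U [set m | 0 < car_metric (X m) (s z m) (mm_root (X m))].
    apply: ulim_gt; first exact: pb.
    rewrite -/(uprod_dist _ _) -qE sK lt_neqAle metric_ge0 andbT eq_sym.
    by apply/eqP => h; apply: zr; exact: metric_eq0 h.
  apply: ulim_ge; [exact: vb|move=> h h0].
  apply: filterS3 ov zU (fU N) => m /= Bm zm Nm.
  have [sz|e1] := fX m (s z m); last by rewrite {1}e1 metric_xx ltxx in zm.
  have Mm : ilm (X m) (e / 4) <= M' by have := MP m Nm; have := ler_norm M; rewrite /M' /=; lra.
  have := (ilm_leP (@cX m) e40 (ltW M'0)).1 Mm _ sz.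
  have := le_ms (mmeas_ball (s z m) (e / 4)) (closed_mmeas (cB m)) Bm.
  rewrite -[M'^-1]mulr1 => h1; rewrite -ler_pdivrMl//; lra.
Qed.

End ultraproduct.

Section completeness.
Context (R : realType) (X : nat -> mmSpace R).
Hypotheses (cX : forall n, compact [set: X n]) (fX : forall n, full (X n)).

Lemma ghp_complete : ilm_eventually_bounded X ->
  (forall e, 0 < e -> exists N, forall n m, (N <= n)%N -> (N <= m)%N -> ghp (X n) (X m) < e) ->
  exists Z : mmSpace R, [/\ compact [set: Z], full Z & tends0 (fun n => ghp (X n) Z)].
Proof.
move=> bX cauchyX; pose r n : R := n.+1%:R^-1.
have r0 n : 0 < r n by rewrite invr_gt0.
(* Taking [N k >= k] keeps the subsequence cofinal, so that the eventual bounds on [X] pass to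
   it. *)
have exN k : exists N, (k <= N)%N /\
    forall n m, (N <= n)%N -> (N <= m)%N -> ghp (X n) (X m) < r k.
  have [N NP] := cauchyX _ (r0 k); exists (maxn k N); split; first exact: leq_maxl.
  by move=> n m nN mN; apply: NP; [move: nN|move: mN]; rewrite geq_max => /andP[].
have [N NP] := choice exN; pose Y k := X (N k).
have cY k : compact [set: Y k] by exact: cX.
have exc k l : exists c, mmnear (X := Y k) (Y := Y l) c (r k + r l) (r k + r l) (r k + r l).
  apply: ghp_near => //; pose M := maxn (N k) (N l).
  apply: (le_lt_trans (@ghp_tri R (X M) _ _ (@cY k) (@cX M) (@cY l))).
  apply: ltrD; first by apply: (NP k).2 => //; exact: leq_maxl.
  by apply: (NP l).2 => //; exact: leq_maxr.
have exc' k l := cid (exc k l); pose c k l := projT1 (exc' k l).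
have nc k l : mmnear (c k l) (r k + r l) (r k + r l) (r k + r l) := projT2 (exc' k l).
have [U [UU fU]] := free_ultrafilter.
have [p0 ps pt] := @uprod_dist_pseudo R U UU Y cY c nc.
have [Q [dQ [q [qE qs]]]] := metric_quotient p0 ps pt.
have [s sK] := choice qs.
have [Z [cZ nZ fZ]] := uprod_near fU cY nc qE sK.
exists Z; split => //.
  apply: fZ => [k|t t0]; first exact: fX.
  have [M [K _ MP]] := bX t t0; exists M; exists K => // k /= Kk; apply: MP => /=.
  exact: leq_trans Kk (NP k).1.
(* The error [6 * r k] becomes [18 * r k] under [near_ghp], and one more [r k] separates [X n] from
   [Y k]. *)
move=> e e0; have [k ke] : exists k, r k < e / 19 by apply: inv_nat_lt; rewrite divr_gt0.
exists (N k) => // n /= Nn; have [c' nc'] := nZ k.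
have r60 : 0 <= 6 * r k by rewrite mulr_ge0// ltW.
have := near_ghp (@cY k) cZ r60 nc'; have := @ghp_tri R (Y k) (X n) Z (@cX n) (@cY k) cZ.
by have := (NP k).2 n (N k) Nn (leqnn _); rewrite -/(Y k); lra.
Qed.

(** Before any limit is known, the sequence is compared with one of its own terms [X N], whose
    inverse lower mass bounds the later ones. *)
Lemma sdist_complete :
  (forall e, 0 < e -> exists N, forall n m, (N <= n)%N -> (N <= m)%N -> sdist (X n) (X m) < e) ->
  exists Z : mmSpace R, [/\ compact [set: Z], full Z & tends0 (fun n => sdist (X n) Z)].
Proof.
move=> cauchyX.
have bX : ilm_eventually_bounded X.
  move=> t t0; pose u := Num.min t 1.
  have [u0 ut u1] : [/\ 0 < u, u <= t & u <= 1].
    by rewrite /u lt_min t0 ltr01 !ge_min !lexx orbT.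
  have u20 : 0 < u / 2 by rewrite divr_gt0.
  have [N NP] := cauchyX _ u20; exists (ilm (X N) (u / 2) + 1); exists N => // n /= Nn.
  apply: (le_trans (ilm_anti (@cX n) u0 ut)).
  apply: ilm_dist_bounded => //.
  by have := NP n N Nn (leqnn N); rewrite /sdist; have := ghp_ge0 (X n) (X N); lra.
have [e e0|Z [cZ fZ gZ]] := ghp_complete bX.
  have [N NP] := cauchyX e e0; exists N => n m Nn Nm; have := NP n m Nn Nm.
  by rewrite /sdist; have := ilm_dist_ge0 (X n) (X m); lra.
by exists Z; split => //; exact: sdist_cvg.
Qed.

End completeness.

(** * Separability *)

Section cells.
Context (R : realType) (X : mmSpace R).

Lemma ms_bigcup (V : nat -> set (car X)) n : (forall i, mmeas X (V i)) ->
  (forall i j x, V i x -> V j x -> i = j) ->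
  mmeas X (\bigcup_(i < n) V i) /\ ms X (\bigcup_(i < n) V i) = \sum_(i < n) ms X (V i).
Proof.
move=> mV tV; elim: n => [|n [mIH IH]].
  by rewrite bigcup_mkord !big_ord0; split; [exact: mmeas0|exact: ms0].
rewrite bigcup_mkord !big_ord_recr /= -bigcup_mkord -IH; split; first exact: mmeasU.
rewrite msDU// -subset0 => x [[i /= ilt Vi] Vn].
by move: ilt; rewrite (tV _ _ _ Vi Vn) ltnn.
Qed.

(** Assigning a point to the first net point within [d] makes the balls disjoint, so that their
    masses add. *)
Definition cell (x : nat -> car X) (d : R) (i : nat) : set (car X) :=
  [set z | car_metric X (x i) z <= d /\ forall j, (j < i)%N -> d < car_metric X (x j) z].

Lemma mmeas_cell x d i : mmeas X (cell x d i).
Proof.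
have -> : cell x d i = [set z | car_metric X (x i) z <= d] `&`
    ~` \bigcup_(j < i) [set z | car_metric X (x j) z <= d].
  apply/seteqP; split => z [h1 h2]; split => //.
    by move=> [j /= ji]; have := h2 j ji; rewrite leNgt => ->.
  by move=> j ji; rewrite ltNge; apply/negP => h; apply: h2; exists j.
apply: mmeasI; first exact: mmeas_ball.
apply: mmeasC; apply: bigcup_measurable => j _; exact: mmeas_ball.
Qed.

Lemma cell_disjoint x d i j z : cell x d i z -> cell x d j z -> i = j.
Proof.
move=> [i1 i2] [j1 j2]; case: (ltngtP i j) => // h.
  by have := j2 i h; rewrite ltNge i1.
by have := i2 j h; rewrite ltNge j1.
Qed.

Lemma cell_cover x d N z : (exists2 i, (i < N)%N & car_metric X (x i) z <= d) ->
  exists2 i, (i < N)%N & cell x d i z.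
Proof.
move=> [i iN iz]; have ex : exists i, car_metric X (x i) z <= d by exists i.
case: (ex_minnP ex) => k kz kmin; exists k; first exact: leq_ltn_trans (kmin i iz) iN.
by split => // j jk; rewrite ltNge; apply/negP => /kmin; rewrite leqNgt jk.
Qed.

End cells.

Section net_coupling.
Context (R : realType) (X Y : mmSpace R) (N : nat) (x : nat -> car X) (y : nat -> car Y) (d : R).
Hypothesis N0 : (0 < N)%N.
Hypothesis xy : forall i j, (i < N)%N -> (j < N)%N ->
  `|car_metric X (x i) (x j) - car_metric Y (y i) (y j)| <= d.

(** Crossing takes place at matching net points and costs [d], which absorbs the distortion bounded
    in [xy]. *)
Definition net_cpl (u : car X) (v : car Y) : R :=
  inf [set car_metric X u (x i) + car_metric Y (y i) v + d | i in [set i | (i < N)%N]].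

Let d0 : 0 <= d. Proof. by apply: le_trans (xy N0 N0). Qed.

Let hi u v : has_inf [set car_metric X u (x i) + car_metric Y (y i) v + d | i in [set i | (i < N)%N]].
Proof.
split; first by exists (car_metric X u (x 0) + car_metric Y (y 0) v + d), 0%N.
by exists 0 => _ [i _ <-]; rewrite !addr_ge0// metric_ge0.
Qed.

Lemma net_cpl_le u v i : (i < N)%N -> net_cpl u v <= car_metric X u (x i) + car_metric Y (y i) v + d.
Proof. by move=> iN; apply: ge_inf; [exact: (hi u v).2|exists i]. Qed.

Let net_cpl_ge u v M :
  (forall i, (i < N)%N -> M <= car_metric X u (x i) + car_metric Y (y i) v + d) -> M <= net_cpl u v.
Proof. by move=> h; apply: lb_le_inf; [exact: (hi u v).1|move=> _ [i /h ? <-]]. Qed.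

Lemma net_cpl_coupling : coupling (car_metric X) (car_metric Y) net_cpl.
Proof.
split.
- move=> u' u v; rewrite -lerBlDl; apply: net_cpl_ge => i iN; have := net_cpl_le u v iN.
  by have := metric_tri (car_metric X) u' u (x i); lra.
- move=> v' u v; rewrite -lerBlDr; apply: net_cpl_ge => i iN; have := net_cpl_le u v iN.
  by have := metric_tri (car_metric Y) v' (y i) v; lra.
- move=> v u u'; rewrite -lerBlDr; apply: net_cpl_ge => i iN.
  rewrite lerBlDr addrC -lerBlDr; apply: net_cpl_ge => j jN.
  have := xy iN jN; rewrite ler_norml => /andP[h1 h2].
  have := metric_tri (car_metric Y) v (y i) (y j); rewrite (metric_symm _ v (y j)).
  have := metric_tri (car_metric X) (x i) u u'; have := metric_tri (car_metric X) (x j) (x i) u'.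
  by rewrite (metric_symm _ u' (x j)); lra.
- move=> u v v'; rewrite -lerBlDr; apply: net_cpl_ge => i iN.
  rewrite lerBlDr addrC -lerBlDr; apply: net_cpl_ge => j jN.
  have := xy iN jN; rewrite ler_norml => /andP[h1 h2].
  have := metric_tri (car_metric X) u (x i) (x j); rewrite (metric_symm _ (x i) u).
  have := metric_tri (car_metric Y) (y i) v v'; have := metric_tri (car_metric Y) (y j) (y i) v'.
  by rewrite (metric_symm _ v (y i)); lra.
Qed.

End net_coupling.

Section codes.
Context (R : realType) (J : nat).
Let d : R := J.+1%:R^-1.

Let d_gt0 : 0 < d. Proof. by rewrite invr_gt0. Qed.

(* Size of a net, index of a net point near the root, distances within the net,
   masses of the cells of the net, and inverse lower masses at [1 / (j + 1)], all
   rounded down. *)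
Definition code : Type := (nat * nat * seq (seq nat) * seq nat * seq nat)%type.

(** Masses are multiplied by [N] before rounding, so that an error [1 / (N * (J + 1))] per cell sums
    to [1 / (J + 1)] over the [N] cells. *)
Definition has_code (X : mmSpace R) (k : code) : Prop :=
  let: (N, i0, D, W, q) := k in exists x : nat -> car X,
  [/\ forall z, exists2 i, (i < N)%N & car_metric X (x i) z <= d,
      (i0 < N)%N /\ car_metric X (x i0) (mm_root X) <= d,
      forall i j, (i < N)%N -> (j < N)%N ->
        nth 0%N (nth [::] D i) j = Num.truncn (J.+1%:R * car_metric X (x i) (x j)),
      forall i, (i < N)%N -> nth 0%N W i = Num.truncn (J.+1%:R * (N%:R * ms X (cell x d i))) &
      forall j, (j <= J)%N -> nth 0%N q j = Num.truncn (ilm X j.+1%:R^-1)].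

Lemma has_code_ex (X : mmSpace R) : compact [set: X] -> exists k, has_code X k.
Proof.
move=> cX; have [N [x xP]] := compact_net cX d_gt0.
have [i0 i0N i0P] := xP (mm_root X) I.
pose D := mkseq (fun i => mkseq (fun j => Num.truncn (J.+1%:R * car_metric X (x i) (x j))) N) N.
pose W := mkseq (fun i => Num.truncn (J.+1%:R * (N%:R * ms X (cell x d i)))) N.
pose q := mkseq (fun j => Num.truncn (ilm X j.+1%:R^-1)) J.+1.
exists (N, i0, D, W, q), x; split.
- by move=> z; have [i iN /ltW] := xP z I; exists i.
- by split => //; exact: ltW.
- by move=> i j iN jN; rewrite nth_mkseq// nth_mkseq.
- by move=> i iN; rewrite nth_mkseq.
- by move=> j jJ; rewrite nth_mkseq.
Qed.

Let truncn_dist (a b : R) : 0 <= a -> 0 <= b -> Num.truncn a = Num.truncn b -> `|a - b| <= 1.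
Proof.
move=> a0 b0 ab; have /andP[a1 a2] := truncn_itv a0; have /andP[b1 b2] := truncn_itv b0.
move: a1 a2 b1 b2; rewrite ab -natr1 ler_norml; move: (_%:R : R) => t a1 a2 b1 b2.
by apply/andP; split; lra.
Qed.

Let scaled (a b : R) : `|J.+1%:R * a - J.+1%:R * b| <= 1 -> `|a - b| <= d.
Proof. by rewrite -mulrBr normrM ger0_norm// /d -ler_pdivlMl ?ltr0n// mulr1. Qed.

(** The cells that meet [A] cover it. The matching cells of [Y] lie within [3 * d] of [A], with one
    [d] each for reaching the net, crossing and leaving the net, and the [N] mass errors [d / N] add
    up to [d]. *)
Let code_pl X Y N (x : nat -> car X) (y : nat -> car Y) (c : car X -> car Y -> R) A :
  coupling (car_metric X) (car_metric Y) c ->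
  (forall i u v, (i < N)%N -> c u v <= car_metric X u (x i) + car_metric Y (y i) v + d) ->
  (forall z, exists2 i, (i < N)%N & car_metric X (x i) z <= d) ->
  (forall i, (i < N)%N -> ms X (cell x d i) <= ms Y (cell y d i) + d / N%:R) ->
  mclosed X A -> ms X A <= ms Y (fat c A (3 * d)) + 3 * d.
Proof.
move=> C cle xnet mcell cA; have N0 : (0 < N)%N by have [i iN _] := xnet (mm_root X); exact: leq_ltn_trans iN.
pose meets i := exists z, A z /\ cell x d i z.
pose V i := cell x d i `&` [set _ | meets i]; pose W i := cell y d i `&` [set _ | meets i].
have VE (T : Type) (B : set T) i : B `&` [set _ | meets i] = if pselect (meets i) then B else set0.
  by apply/seteqP; split => z; case: pselect => h; [case|case|split|].
have mV i : mmeas X (V i).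
  by rewrite /V VE; case: pselect => h; [exact: mmeas_cell|exact: mmeas0].
have mW i : mmeas Y (W i).
  by rewrite /W VE; case: pselect => h; [exact: mmeas_cell|exact: mmeas0].
have [mVV sV] : mmeas X (\bigcup_(i < N) V i) /\ _ :=
  ms_bigcup N mV (fun i j z a b => cell_disjoint a.1 b.1).
have [mWW sW] : mmeas Y (\bigcup_(i < N) W i) /\ _ :=
  ms_bigcup N mW (fun i j z a b => cell_disjoint a.1 b.1).
apply: (@le_trans _ _ (ms X (\bigcup_(i < N) V i))).
  apply: le_ms => //; first exact: closed_mmeas.
  move=> z Az; have [i iN zi] := cell_cover (xnet z).
  by exists i => //; split => //; exists z.
apply: (@le_trans _ _ (ms Y (\bigcup_(i < N) W i) + d)).
  rewrite sV sW; apply: (@le_trans _ _ (\sum_(i < N) (ms Y (W i) + d / N%:R))).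
    apply: ler_sum => i _; rewrite /V /W !VE; case: pselect => h; first exact: mcell.
    by rewrite !ms0 add0r divr_ge0// ltW.
  have dN : (d / N%:R) *+ N = d.
    by rewrite -[LHS]mulr_natr -mulrA mulVf ?mulr1// pnatr_eq0 -lt0n.
  by rewrite big_split /= sumr_const card_ord dN.
apply: lerD; last by have := d_gt0; lra.
apply: le_ms => //; first exact: mmeas_fat.
move=> w [i /= iN [[wi _] [z [Az [zi _]]]]] h h0; exists z => //.
by have := cle i z w iN; rewrite (metric_symm _ z); lra.
Qed.

Lemma code_near X Y k : has_code X k -> has_code Y k ->
  exists c, mmnear (X := X) (Y := Y) c (3 * d) (3 * d) (3 * d).
Proof.
case: k => -[[[N i0] D] W] q [x [xnet [i0N xr] xD xW _]] [y [ynet [_ yr] yD yW _]].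
have N0 : (0 < N)%N by apply: leq_ltn_trans i0N.
have xy i j : (i < N)%N -> (j < N)%N ->
    `|car_metric X (x i) (x j) - car_metric Y (y i) (y j)| <= d.
  move=> iN jN; apply: scaled; apply: truncn_dist.
  - by rewrite mulr_ge0// metric_ge0.
  - by rewrite mulr_ge0// metric_ge0.
  - by rewrite -xD// -yD.
have w i : (i < N)%N -> `|ms X (cell x d i) - ms Y (cell y d i)| <= d / N%:R.
  move=> iN; have NR : 0 < N%:R :> R by rewrite ltr0n.
  rewrite ler_pdivlMr// mulrC -[X in X * _](ger0_norm (ltW NR)) -normrM mulrBr.
  apply: scaled; apply: truncn_dist.
  - by rewrite !mulr_ge0// ms_ge0.
  - by rewrite !mulr_ge0// ms_ge0.
  - by rewrite -xW// -yW.
have C := net_cpl_coupling N0 xy; have cle u v i := @net_cpl_le _ _ _ _ x y d N0 xy u v i.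
exists (net_cpl N x y d); split => //.
- move=> A cA; apply: (code_pl C _ xnet _ cA) => [i u v|i /w]; first exact: cle.
  by rewrite ler_norml => /andP[]; lra.
- move=> A cA; apply: (code_pl (coupling_swap C) _ ynet _ cA) => [i u v iN|i /w].
    by have := cle v u i iN; rewrite /swap (metric_symm _ v) (metric_symm _ u); lra.
  by rewrite ler_norml => /andP[]; lra.
- move=> z h h0; have [i iN xi] := xnet z; exists (y i).
  by have := cle z (y i) i iN; rewrite metric_xx (metric_symm _ z); have := d_gt0; lra.
- move=> z h h0; have [i iN yi] := ynet z; exists (x i).
  by have := cle (x i) z i iN; rewrite metric_xx; have := d_gt0; lra.
- by have := cle (mm_root X) (mm_root Y) i0 i0N; rewrite (metric_symm _ (mm_root X)); lra.
Qed.

Lemma code_ilm X Y k j : has_code X k -> has_code Y k -> (j <= J)%N ->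
  ilm Y j.+1%:R^-1 <= ilm X j.+1%:R^-1 + 1.
Proof.
case: k => -[[[N i0] D] W] q [x [_ _ _ _ xq]] [y [_ _ _ _ yq]] jJ.
have := truncn_dist (ilm_ge0 X j.+1%:R^-1) (ilm_ge0 Y j.+1%:R^-1).
rewrite -xq// -yq// => /(_ erefl); rewrite ler_norml => /andP[+ _].
by move: (ilm _ _) (ilm _ _) => a b; lra.
Qed.

End codes.

(** Common codes at finer and finer scales give GHP convergence, and agreement at radius
    [1 / (j + 1)] from [n = j] on bounds the inverse lower masses. By [sdist_cvg] such a bound
    already forces the integral term to vanish in the limit, so recording these values up to an
    error [1] is enough. *)
Lemma codes_dense (R : realType) (X : mmSpace R) (Y : nat -> mmSpace R) (k : nat -> code) :
  compact [set: X] -> (forall n, compact [set: Y n]) ->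
  (forall n, has_code n X (k n)) -> (forall n, has_code n (Y n) (k n)) ->
  tends0 (fun n => sdist (Y n) X).
Proof.
move=> cX cY kX kY; apply: sdist_cvg => //.
  move=> e e0; have [N Ne] : exists N, N.+1%:R^-1 < e / 9 by apply: inv_nat_lt; rewrite divr_gt0.
  exists N => // n /= Nn; have [c nc] := code_near (kY n) (kX n).
  have r0 : 0 <= n.+1%:R^-1 :> R by rewrite invr_ge0.
  have r30 : 0 <= 3 * n.+1%:R^-1 :> R by rewrite mulr_ge0.
  have := near_ghp (@cY n) cX r30 nc.
  have : n.+1%:R^-1 <= N.+1%:R^-1 :> R by rewrite lef_pV2 ?posrE// ler_nat.
  by move: Ne; set a := N.+1%:R^-1; set b := n.+1%:R^-1; lra.
move=> s s0; have [j js] := inv_nat_lt s0.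
exists (ilm X j.+1%:R^-1 + 1); exists j => // n /= jn.
apply: le_trans (code_ilm (kX n) (kY n) jn).
by apply: ilm_anti => //; exact: ltW.
Qed.

Section metric_type.
Context (R : realType) (T : Type) (d : metric R T).

Lemma mtype_nbhsP (x : mtype d) (A : set (mtype d)) :
  nbhs x A <-> exists2 e : R, 0 < e & forall y, d x y < e -> A y.
Proof.
split=> [/nbhs_ballP[e /= e0 eA]|[e e0 eA]].
  by exists e => // y xy; apply: eA; rewrite ballEmdist.
by apply/nbhs_ballP; exists e => // y; rewrite ballEmdist; exact: eA.
Qed.

Lemma mtype_cvgP (x_ : nat -> mtype d) (x : mtype d) :
  x_ n @[n --> \oo] --> x <-> tends0 (fun n => d (x_ n) x).
Proof.
split=> [h e e0|h A /mtype_nbhsP[e e0 eA]].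
  have /h : nbhs x [set y | d y x < e].
    by apply/mtype_nbhsP; exists e => // y /=; rewrite metric_symm.
  exact.
by apply: filterS (h e e0) => n /=; rewrite metric_symm; exact: eA.
Qed.

Lemma mtype_seq_open (U : set (mtype d)) :
  (forall x_ x, U x -> x_ n @[n --> \oo] --> x -> \forall n \near \oo, U (x_ n)) -> open U.
Proof.
move=> seqU; rewrite openE => x Ux; apply/mtype_nbhsP; apply: contrapT => h.
have bad n : exists y, d x y < n.+1%:R^-1 /\ ~ U y.
  apply: contrapT => hn; apply: h; exists n.+1%:R^-1; first by rewrite invr_gt0.
  by move=> y xy; apply: contrapT => nUy; apply: hn; exists y.
have [y yP] := choice bad.
have yx : (y : nat -> mtype d) n @[n --> \oo] --> x.
  apply/mtype_cvgP => e e0; have [N Ne] := inv_nat_lt e0.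
  exists N => // n /= Nn; rewrite metric_symm; apply: (lt_le_trans (yP n).1).
  apply: le_trans (ltW Ne); by rewrite lef_pV2 ?posrE// ler_nat.
have [N _ /(_ N (leqnn N))/= UN] := seqU y x Ux yx.
exact: (yP N).2.
Qed.

Lemma mtype_seq_complete :
  (forall x_ : nat -> T, (forall e, 0 < e -> exists N, forall n m, (N <= n)%N -> (N <= m)%N ->
      d (x_ n) (x_ m) < e) -> exists x, tends0 (fun n => d (x_ n) x)) ->
  complete_space (mtype d).
Proof.
move=> seqC F FF cF.
have ex n : exists x : T, F [set y | d x y < n.+1%:R^-1].
  have r0 : 0 < n.+1%:R^-1 :> R by rewrite invr_gt0.
  have [x Fx] := (cauchyP (R := R) F).1 cF _ r0; exists x.
  by apply: filterS Fx => y; rewrite ballEmdist.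
have [x_ xP] := choice ex.
have dx n m : d (x_ n) (x_ m) < n.+1%:R^-1 + m.+1%:R^-1.
  have Fnm : F ([set y | d (x_ n) y < n.+1%:R^-1] `&` [set y | d (x_ m) y < m.+1%:R^-1]).
    by apply: filterI.
  have [y [/= y1 y2]] := filter_ex Fnm.
  apply: (le_lt_trans (metric_tri d y _ _)).
  by rewrite (metric_symm d y); apply: ltrD.
have inv_le (N n : nat) : (N <= n)%N -> n.+1%:R^-1 <= N.+1%:R^-1 :> R.
  by move=> Nn; rewrite lef_pV2 ?posrE// ler_nat.
have [e e0|x xl] := seqC x_.
  have e20 : 0 < e / 2 by rewrite divr_gt0.
  have [N Ne] := inv_nat_lt e20; exists N => n m Nn Nm.
  have := dx n m; have := inv_le _ _ Nn; have := inv_le _ _ Nm.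
  by move: Ne; set a := N.+1%:R^-1; set b := n.+1%:R^-1; set c := m.+1%:R^-1; lra.
exists x => A /mtype_nbhsP[e e0 eA]; have e20 : 0 < e / 2 by rewrite divr_gt0.
have [N _ NP] := xl _ e20; have [M Me] := inv_nat_lt e20.
pose n := maxn N M; have h1 := NP n (leq_maxl _ _); have h2 := inv_le _ _ (leq_maxr N M).
apply: filterS (xP n) => y /= ny; apply: eA.
apply: (le_lt_trans (metric_tri d (x_ n) _ _)); rewrite (metric_symm d x).
by move: h1 h2 Me ny; rewrite -/n /=; set a := M.+1%:R^-1; set b := n.+1%:R^-1; lra.
Qed.

End metric_type.

Lemma image_iota_supp (R : realType) (X : mmSpace R) (E : Type) (phi : mm_iota X -> E) :
  phi @` iota_supp (X := X) = phi @` supp (mm_iota X).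
Proof. by congr (_ @` _); apply/seteqP; split => u /supp_iota. Qed.

Lemma GHw_cvg_sdist (R : realType) (X_ : nat -> mmSpace R) (X : mmSpace R) :
  (forall n, compact [set: mm_iota (X_ n)]) -> compact [set: mm_iota X] ->
  GHw_cvg X_ X -> tends0 (fun n => sdist (mm_iota (X_ n)) (mm_iota X)).
Proof.
move=> cX_ cX [E [phi_ [phi [iphi_ [iphi rphi] wc hc]]]].
apply: (GHw_sdist cX_ cX _ _ (phi_ := phi_) (phi := phi)) => //.
- by move=> n; exact: full_iota.
- exact: full_iota.
- by move=> n; have [] := iphi_ n.
- by move=> n; have [] := iphi_ n.
move: hc; rewrite image_iota_supp.
by under eq_fun do rewrite image_iota_supp.
Qed.

Theorem proposition5p5 (R : realType) :
  exists d : metric R (Xc R),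
    [/\ (forall (C C' : Xc R) (X X' : mmSpace R),
           represents X C -> represents X' C' -> (d C C')%:E = dsGHP X X'),
        (forall U : set (mtype d), open U <-> GHw_open U),
        (forall (C_ : nat -> mtype d) (C : mtype d),
           C_ n @[n --> \oo] --> C <-> GHw_cvg_class C_ C),
        complete_space (mtype d) &
        separable_space (mtype d)].
Proof.
have [d dE] := sGHP_metric_exists R.
have cvgE (C_ : nat -> mtype d) (C : mtype d) :
    C_ n @[n --> \oo] --> C <-> GHw_cvg_class C_ C.
  split=> [/mtype_cvgP h|[X_ [X [rX_ rX /GHw_cvg_sdist h]]]].
    have [X_ rX_] := choice (fun n => represents_ex (C_ n)).
    have [X rX] := represents_ex C.
    exists X_, X; split => //; apply: sdist_GHw.
    - by move=> n; exact: represents_compact (rX_ n).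
    - exact: represents_compact rX.
    - by move=> e e0; apply: filterS (h e e0) => n; rewrite (dE _ _ _ _ (rX_ n) rX).
  apply/mtype_cvgP => e e0; apply: filterS (h _ _ e e0) => [n|n|].
  - by rewrite (dE _ _ _ _ (rX_ n) rX).
  - exact: represents_compact (rX_ n).
  - exact: represents_compact rX.
exists d; split => //.
- move=> C C' X X' rX rX'; rewrite (dE _ _ _ _ rX rX') dsGHPE//.
    exact: represents_compact rX.
  exact: represents_compact rX'.
- move=> U; split=> [oU C_ C UC /cvgE CC|gU].
    by apply: CC; exact: open_nbhs_nbhs.
  by apply: mtype_seq_open => C_ C UC /cvgE; exact: gU.
- apply: mtype_seq_complete => C_ cauchyC.
  have [X_ rX_] := choice (fun n => represents_ex (C_ n)).
  have cX_ n : compact [set: mm_iota (X_ n)] := represents_compact (rX_ n).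
  have [e e0|Z [cZ fZ lZ]] := sdist_complete cX_ (fun n => @full_iota R (X_ n)).
    have [N NP] := cauchyC e e0; exists N => n m Nn Nm.
    by rewrite -(dE _ _ _ _ (rX_ n) (rX_ m)); exact: NP.
  have [C rC] := compact_represents cZ; exists C => e e0.
  (* Distances between classes are computed on [mm_iota]; for the full space [Z] this changes
     nothing up to strong equivalence. *)
  have eZ := full_equiv_iota fZ; have ciZ := strong_equiv_compact eZ cZ.
  apply: filterS (lZ e e0) => n; rewrite (dE _ _ _ _ (rX_ n) rC).
  apply: le_lt_trans; apply: (le_trans (sdist_tri (Y := Z) _ _ _)) => //.
  by rewrite ((sdist_eq0 cZ ciZ).2 eZ) addr0.
- have [[C0 _]|nC] := pselect (exists C : Xc R, True); last first.
    by exists set0 => // O [C _]; exfalso; apply: nC; exists C.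
  pose coded (Jk : nat * code) :=
    [set C : Xc R | exists X, represents X C /\ has_code Jk.1 (mm_iota X) Jk.2].
  (* One class for each realised code, and codes form a countable type; the default [C0] is taken
     only for codes that no class realises. *)
  pose p Jk : mtype d := @xget (mtype d) C0 (coded Jk).
  exists (p @` setT); first by apply: (card_le_trans (card_image_le _ _)); exact: countableP.
  move=> O [C OC] oO; have [X rX] := represents_ex C.
  have cX := represents_compact rX.
  have [k kP] := choice (fun J => has_code_ex J cX).
  have pP J : coded (J, k J) (p (J, k J)) 
    by apply: (@xgetI (mtype d) C0 (coded (J, k J)) C); exists X.
  have [Y YP] := choice pP.
  have cY n : compact [set: mm_iota (Y n)] := represents_compact (YP n).1.
  have lY := codes_dense cX cY kP (fun n => (YP n).2).
  have pC : (fun J => p (J, k J)) n @[n --> \oo] --> (C : mtype d).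
    apply/mtype_cvgP => e e0; apply: filterS (lY e e0) => n.
    by rewrite (dE _ _ _ _ (YP n).1 rX).
  have [N _ /(_ N (leqnn N))/= ON] := pC O (open_nbhs_nbhs (conj oO OC)).
  by exists (p (N, k N)); split => //; exists (N, k N).
Qed.
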